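(* Let $E=(E^0,E^1,r,s)$ be a directed graph which is row-finite and has no sources (every vertex receives a positive but finite number of edges). For each $v\in E^0$ let $T_v$ be a locally compact Hausdorff space, and for each $e\in E^1$ let $\phi_e\colon T_{s(e)}\to T_{r(e)}$ be a continuous map. Let $T=\bigsqcup_{v\in E^0}T_v$ be the disjoint union, let $A=\bigoplus_{v\in E^0}C_0(T_v)\cong C_0(T)$ ($c_0$-direct sum), and let $X=\bigoplus_{e\in E^1}X_e$ be the associated $C^*$-correspondence over $A$ (defined in the context). Suppose there is a continuous surjective map $\Phi\colon E^\infty\to T$ such that for every $e\in E^1$ one has $\Phi\circ\phi^E_e=\phi_e\circ\Phi$ as maps on $E^\infty_{s(e)}$ (so that, in particular, $\Phi(E^\infty_v)\subseteq T_v$ for every $v\in E^0$), where $\phi^E_e\colon E^\infty_{s(e)}\to E^\infty_{r(e)}$ is given by $\phi^E_e(\alpha)=e\alpha$. Then the Cuntz-Pimsner algebra $\mathcal{O}_X$ is isomorphic (as a $C^*$-algebra) to the graph algebra $C^*(E)$.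
   Context: Graphs and paths. A directed graph $E=(E^0,E^1,r,s)$ has vertex set $E^0$, edge set $E^1$, and range and source maps $r,s\colon E^1\to E^0$. Paths follow the convention that a finite path $e_1\cdots e_n$ satisfies $s(e_i)=r(e_{i+1})$ for $i=1,\dots,n-1$. An infinite path is a sequence $e_1e_2\cdots$ of edges with $s(e_i)=r(e_{i+1})$ for all $i\ge 1$; its range is $r(e_1)$. $E^\infty$ is the set of infinite paths with the topology inherited from the product topology on $\prod_{i\ge1}E^1$ ($E^1$ discrete); it is locally compact Hausdorff for row-finite $E$ without sources. For $v\in E^0$, $E^\infty_v=\{\alpha\in E^\infty\mid r(\alpha)=v\}$. Graph algebra. $C^*(E)$ is the universal $C^*$-algebra generated by mutually orthogonal projections $\{p_v\}_{v\in E^0}$ and partial isometries $\{s_e\}_{e\in E^1}$ satisfying $s_e^*s_e=p_{s(e)}$ for all $e\in E^1$ and $p_v=\sum_{r(e)=v}s_es_e^*$ for all $v\in E^0$ (the generators go the same way as the edges). The correspondence $X$. Put $A_v=C_0(T_v)$. For $e\in E^1$ with $r(e)=u$ and $s(e)=v$, $X_e$ is the $A_u$-$A_v$ correspondence which as a right Hilbert $A_v$-module is $A_v$ itself (right multiplication in $A_v$, inner product $\langle\xi,\eta\rangle=\xi^*\eta$), with left action of $f\in A_u$ given by $f\cdot\xi=(f\circ\phi_e)\xi$. The direct sum $X=\bigoplus_{e\in E^1}X_e$ is the Hilbert $A$-module direct sum (the $X_e$ being regarded as correspondences over $A$), with operations $$(a\xi)_e=a_{r(e)}\xi_e,\qquad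 (\xi a)_e=\xi_ea_{s(e)},\qquad \langle\xi,\eta\rangle_v=\sum_{s(e)=v}\langle\xi_e,\eta_e\rangle$$ for $a=(a_v)_{v\in E^0}\in A$ and $\xi=(\xi_e)_{e\in E^1},\eta=(\eta_e)_{e\in E^1}\in X$. Cuntz-Pimsner algebra. For a $C^*$-correspondence $X$ over $A$ with left action $\varphi\colon A\to\mathcal{L}(X)$, a Toeplitz representation of $X$ in a $C^*$-algebra $B$ is a pair $(\psi,\pi)$ with $\psi\colon X\to B$ linear and $\pi\colon A\to B$ a $*$-homomorphism such that $\psi(\xi)^*\psi(\eta)=\pi(\langle\xi,\eta\rangle)$ and $\psi(a\xi)=\pi(a)\psi(\xi)$ (hence also $\psi(\xi a)=\psi(\xi)\pi(a)$). It induces a homomorphism $\psi^{(1)}\colon\mathcal{K}(X)\to B$ with $\psi^{(1)}(\theta_{\xi,\eta})=\psi(\xi)\psi(\eta)^*$, where $\theta_{\xi,\eta}(\zeta)=\xi\langle\eta,\zeta\rangle$. The representation is covariant if $\psi^{(1)}(\varphi(a))=\pi(a)$ for all $a\in\varphi^{-1}(\mathcal{K}(X))\cap(\ker\varphi)^\perp$. $\mathcal{O}_X$ is the $C^*$-algebra generated by a universal covariant representation of $X$ (Katsura's definition). *)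

(* Defs.v *)
From HB Require Import structures.
From mathcomp Require Import all_boot all_order all_algebra finmap.
From mathcomp Require Import all_classical reals topology normedtype complex.
From mathcomp Require Import summability.
Set Implicit Arguments.
Unset Strict Implicit.
Unset Printing Implicit Defensive.
Import Order.TTheory GRing.Theory Num.Theory numFieldNormedType.Exports.
Local Open Scope classical_set_scope.
Local Open Scope ring_scope.

(* The complex numbers R[i] as a Banach space over themselves. Norms take their
   values in R[i], where [0 < e] forces e to be real. *)
HB.instance Definition _ (R : realType) := NormedModule.copy R[i] R[i]^o.

Section ComplexFacts.
Variable R : realType.
Implicit Types z : R[i].

Lemma ge0_ReK z : 0 <= z -> (complex.Re z)%:C%C = z.
Proof. by case: z => a b /=; rewrite lecE /= => /andP[/eqP -> _]. Qed.

Lemma normc_Re z : `|complex.Re z|%:C%C <= `|z|.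
Proof.
case: z => a b; rewrite normc_def /= lecE /= eqxx /=.
by rewrite -sqrtr_sqr ler_wsqrtr // lerDl sqr_ge0.
Qed.

Lemma normc_Im z : `|complex.Im z|%:C%C <= `|z|.
Proof.
case: z => a b; rewrite normc_def /= lecE /= eqxx /=.
by rewrite -sqrtr_sqr ler_wsqrtr // lerDr sqr_ge0.
Qed.

Lemma normc_ReIm z : `|z| <= (`|complex.Re z| + `|complex.Im z|)%:C%C.
Proof.
case: z => a b; rewrite normc_def /= lecE /= eqxx /=.
rewrite -[X in _ <= X]ger0_norm; last by rewrite addr_ge0.
rewrite -[X in _ <= X]sqrtr_sqr; apply: ler_wsqrtr.
rewrite sqrrD -!normrX !(ger0_norm (sqr_ge0 _)) addrAC lerDl.
by rewrite mulrn_wge0 // mulr_ge0.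
Qed.

Lemma complex_complete (F : set_system R[i]) :
  ProperFilter F -> cauchy F -> cvg F.
Proof.
move=> FF /cauchy_ballP Fc.
have Hpart (p : R[i] -> R) (Hp : forall z w, `|p z - p w|%:C%C <= `|z - w|) :
    cvg (p @ F).
  apply: cauchy_cvg; apply/cauchy_ballP => e e0.
  have e0' : 0 < e%:C%C :> R[i] by rewrite ltcR.
  have := Fc _ e0'; case=> -[A B] /= [FA FB] AB.
  exists (p @` A, p @` B).
    by split; [apply: (filterS _ FA) | apply: (filterS _ FB)] => x ?; exists x.
  move=> [_ _] /= [[x Ax <-] [y By <-]].
  rewrite /ball /= -ltcR; apply: le_lt_trans (Hp x y) _.
  by have := AB (x, y) (conj Ax By); rewrite -ball_normE.
have cR := Hpart (@complex.Re R) _.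
have cI := Hpart (@complex.Im R) _.
have {}cR : cvg (@complex.Re R @ F).
  by apply: cR => z w; rewrite -raddfB; exact: normc_Re.
have {}cI : cvg (@complex.Im R @ F).
  by apply: cI => z w; rewrite -raddfB; exact: normc_Im.
apply/cvg_ex; exists (lim (@complex.Re R @ F) +i* lim (@complex.Im R @ F))%C.
apply/cvgrPdist_lt => e e0.
have eE := ge0_ReK (ltW e0).
have e20 : 0 < complex.Re e / 2.
  by rewrite divr_gt0 // -ltcR eE.
move/cvgrPdist_lt : cR => /(_ _ e20) cR.
move/cvgrPdist_lt : cI => /(_ _ e20) cI.
near=> z.
apply: le_lt_trans (normc_ReIm _) _.
rewrite -eE ltcR [X in _ < X]splitr !raddfB /=.
by apply: ltrD; near: z.
Unshelve. all: by end_near. Qed.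

End ComplexFacts.

HB.instance Definition _ (R : realType) :=
  Uniform_isComplete.Build R[i] (@complex_complete R).

(* C*-algebras are not assumed unital, so the product is not a MathComp ring
   structure; [adj] is the involution. *)
HB.mixin Record isCStarAlgebra (R : realType) A
    & CompleteNormedModule R[i] A := {
  cmul : A -> A -> A ;
  adj : A -> A ;
  cmulA : associative cmul ;
  cmulDl : left_distributive cmul +%R ;
  cmulDr : right_distributive cmul +%R ;
  cscaleAl : forall (k : R[i]) (a b : A), k *: cmul a b = cmul (k *: a) b ;
  cscaleAr : forall (k : R[i]) (a b : A), k *: cmul a b = cmul a (k *: b) ;
  adjK : involutive adj ;
  adjD : forall a b, adj (a + b) = adj a + adj b ;
  adjZ : forall (k : R[i]) (a : A), adj (k *: a) = k^* *: adj a ;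
  adjM : forall a b, adj (cmul a b) = cmul (adj b) (adj a) ;
  cnormM : forall a b, `|cmul a b| <= `|a| * `|b| ;
  cnorm_adj : forall a, `|cmul (adj a) a| = `|a| ^+ 2
}.

#[short(type="cstarType")]
HB.structure Definition CStarAlgebra (R : realType) :=
  {A of isCStarAlgebra R A & CompleteNormedModule R[i] A}.

Reserved Notation "a ** b" (at level 40, left associativity).
Notation "a ** b" := (cmul a b) : ring_scope.

Section CStarFacts.
Variables (R : realType) (A : cstarType R).
Implicit Types a b : A.

Lemma cmul0r a : 0 ** a = 0.
Proof. by have := cscaleAl 0 a a; rewrite !scale0r. Qed.
Lemma cmulr0 a : a ** 0 = 0.
Proof. by have := cscaleAr 0 a a; rewrite !scale0r. Qed.
Lemma cmulNr a b : (- a) ** b = - (a ** b).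
Proof. by rewrite -scaleN1r -cscaleAl scaleN1r. Qed.
Lemma cmulrN a b : a ** (- b) = - (a ** b).
Proof. by rewrite -[- b]scaleN1r -cscaleAr scaleN1r. Qed.
Lemma cmulrBl a b c : (a - b) ** c = a ** c - b ** c.
Proof. by rewrite cmulDl cmulNr. Qed.
Lemma cmulrBr a b c : a ** (b - c) = a ** b - a ** c.
Proof. by rewrite cmulDr cmulrN. Qed.
Lemma adjN a : adj (- a) = - adj a.
Proof. by rewrite -scaleN1r adjZ rmorphN rmorph1 scaleN1r. Qed.
Lemma adjB a b : adj (a - b) = adj a - adj b.
Proof. by rewrite adjD adjN. Qed.
Lemma adj0 : adj (0 : A) = 0.
Proof. by have := adjZ 0 (0 : A); rewrite scale0r rmorph0 scale0r. Qed.
Lemma norm_adj a : `|adj a| = `|a|.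
Proof.
have H b : `|b| <= `|adj b|.
  have [->|b0] := eqVneq b 0; first by rewrite normr0.
  have := cnormM (adj b) b; rewrite cnorm_adj expr2 ler_pM2r //.
  by rewrite normr_gt0.
by apply/eqP; rewrite eq_le H andbT -{2}[a]adjK H.
Qed.
End CStarFacts.

Section ComplexCStar.
Variable R : realType.
Let mulcc (x y : R[i]) : R[i] := x * y.
Let conjcc (x : R[i]) : R[i] := x^*.
Let mulccA : associative mulcc. Proof. exact: mulrA. Qed.
Let mulccDl : left_distributive mulcc +%R. Proof. exact: mulrDl. Qed.
Let mulccDr : right_distributive mulcc +%R. Proof. exact: mulrDr. Qed.
Let scaleAl (k a b : R[i]) : k *: mulcc a b = mulcc (k *: a) b.
Proof. exact: mulrA. Qed.
Let scaleAr (k a b : R[i]) : k *: mulcc a b = mulcc a (k *: b).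
Proof. exact: mulrCA. Qed.
Let conjccK : involutive conjcc. Proof. exact: conjCK. Qed.
Let conjccD a b : conjcc (a + b) = conjcc a + conjcc b.
Proof. exact: rmorphD. Qed.
Let conjccZ (k a : R[i]) : conjcc (k *: a) = k^* *: conjcc a.
Proof. by rewrite /conjcc -[k *: a]/(k * a) rmorphM. Qed.
Let conjccM a b : conjcc (mulcc a b) = mulcc (conjcc b) (conjcc a).
Proof. by rewrite /conjcc /mulcc rmorphM mulrC. Qed.
Let normMcc a b : `|mulcc a b| <= `|a| * `|b|.
Proof. by rewrite /mulcc normrM. Qed.
Let norm_conjcc a : `|mulcc (conjcc a) a| = `|a| ^+ 2.
Proof. by rewrite /mulcc normrM /conjcc norm_conjC expr2. Qed.
HB.instance Definition _ := isCStarAlgebra.Build R R[i]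
  mulccA mulccDl mulccDr scaleAl scaleAr conjccK conjccD
  conjccZ conjccM normMcc norm_conjcc.
Lemma cmulcE (x y : R[i]) : x ** y = x * y. Proof. by []. Qed.
Lemma adjcE (x : R[i]) : adj x = x^*. Proof. by []. Qed.
End ComplexCStar.

(* A uniformly closed *-algebra of bounded sections of a family of C*-algebras;
   with the supremum norm it is a C*-algebra. This covers both C_0(T) (constant
   family R[i]) and c_0-direct sums. *)
Record sectionAlg (R : realType) (S : Type) (A : S -> cstarType R) := SectionAlg {
  inSec : set (forall s, A s) ;
  inSec_bounded : forall f, inSec f -> exists M : R[i], forall s, `|f s| <= M ;
  inSec0 : inSec (fun s => 0) ;
  inSecD : forall f g, inSec f -> inSec g -> inSec (fun s => f s + g s) ;
  inSecZ : forall (k : R[i]) f, inSec f -> inSec (fun s => k *: f s) ;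
  inSecM : forall f g, inSec f -> inSec g -> inSec (fun s => f s ** g s) ;
  inSec_adj : forall f, inSec f -> inSec (fun s => adj (f s)) ;
  inSec_ulim : forall f,
    (forall e : R[i], 0 < e ->
      exists2 g, inSec g & forall s, `|f s - g s| <= e) ->
    inSec f
}.

Record sections (R : realType) (S : Type) (A : S -> cstarType R)
    (P : sectionAlg A) := MkSection {
  section_fun :> forall s, A s ;
  section_funP : inSec P section_fun
}.

Section Sections.
Variables (R : realType) (S : Type) (A : S -> cstarType R) (P : sectionAlg A).
Local Notation V := (sections P).
Implicit Types f g : V.

Lemma section_ext f g : (forall s, f s = g s) -> f = g.
Proof.
case: f g => [f Pf] [g Pg] /= fg.
have E : f = g by apply: functional_extensionality_dep.
by case: _ / E Pg => Pg; congr MkSection; exact: Prop_irrelevance.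
Qed.

HB.instance Definition _ := gen_eqMixin V.
HB.instance Definition _ := gen_choiceMixin V.

Definition sec0 : V := MkSection (inSec0 P).
Definition secD f g : V := MkSection (inSecD (section_funP f) (section_funP g)).
Definition secZ (k : R[i]) f : V := MkSection (inSecZ k (section_funP f)).
Definition secM f g : V := MkSection (inSecM (section_funP f) (section_funP g)).
Definition sec_adj f : V := MkSection (inSec_adj (section_funP f)).

Fact secDA : associative secD.
Proof. by move=> f g h; apply: section_ext => s /=; rewrite addrA. Qed.
Fact secDC : commutative secD.
Proof. by move=> f g; apply: section_ext => s /=; rewrite addrC. Qed.
Fact sec0D : left_id sec0 secD.
Proof. by move=> f; apply: section_ext => s /=; rewrite add0r. Qed.
Fact secND : left_inverse sec0 (secZ (- 1)) secD.
Proof. by move=> f; apply: section_ext => s /=; rewrite scaleN1r addNr. Qed.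
HB.instance Definition _ := GRing.isZmodule.Build V secDA secDC sec0D secND.

Fact secZA (k l : R[i]) f : secZ k (secZ l f) = secZ (k * l) f.
Proof. by apply: section_ext => s /=; rewrite scalerA. Qed.
Fact secZ1 : left_id 1 secZ.
Proof. by move=> f; apply: section_ext => s /=; rewrite scale1r. Qed.
Fact secZDr : right_distributive secZ +%R.
Proof. by move=> k f g; apply: section_ext => s /=; rewrite scalerDr. Qed.
Fact secZDl f : {morph secZ^~ f : k l / k + l}.
Proof. by move=> k l; apply: section_ext => s /=; rewrite scalerDl. Qed.
HB.instance Definition _ :=
  GRing.Zmodule_isLmodule.Build R[i] V secZA secZ1 secZDr secZDl.

Lemma section0E s : (0 : V) s = 0. Proof. by []. Qed.
Lemma sectionDE f g s : (f + g) s = f s + g s. Proof. by []. Qed.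
Lemma sectionZE (k : R[i]) f s : (k *: f) s = k *: f s. Proof. by []. Qed.
Lemma sectionNE f s : (- f) s = - f s.
Proof. exact: scaleN1r. Qed.
Lemma sectionBE f g s : (f - g) s = f s - g s.
Proof. by rewrite sectionDE sectionNE. Qed.
Lemma section_sumE (I : Type) (r : seq I) (Q : pred I) (F : I -> V) s :
  (\sum_(i <- r | Q i) F i) s = \sum_(i <- r | Q i) F i s.
Proof. by elim/big_rec2: _ => // i x y _ <-. Qed.

Definition supnorm f : R[i] :=
  (sup [set complex.Re `|f s| | s in setT])%:C%C.

Lemma supnorm_ub f s : `|f s| <= supnorm f.
Proof.
have [M HM] := inSec_bounded (section_funP f).
rewrite -[X in X <= _]ge0_ReK // lecR; apply: ub_le_sup; last by exists s.
exists (complex.Re M) => _ [t _ <-].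
by have := HM t; rewrite lecE => /andP[].
Qed.

Lemma supnorm_le f (M : R[i]) : 0 <= M -> (forall s, `|f s| <= M) ->
  supnorm f <= M.
Proof.
move=> M0 HM; rewrite -(ge0_ReK M0) lecR.
have [[s]|nS] := pselect (inhabited S).
  apply: ge_sup; first by exists (complex.Re `|f s|); exists s.
  by move=> _ [t _ <-]; have := HM t; rewrite lecE => /andP[].
rewrite (_ : [set _ | _ in _] = set0) ?sup0.
  by move: M0; rewrite lecE => /andP[].
by apply/seteqP; split=> // x [s _ _]; case: nS; exists.
Qed.

Lemma supnorm_ge0 f : 0 <= supnorm f.
Proof.
rewrite lecR.
have [[s]|nS] := pselect (inhabited S).
  have := supnorm_ub f s; rewrite lecE => /andP[_]; apply: le_trans => /=.
  by have := normr_ge0 (f s); rewrite lecE => /andP[].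
rewrite (_ : [set _ | _ in _] = set0) ?sup0 //.
by apply/seteqP; split=> // x [s _ _]; case: nS; exists.
Qed.

Fact supnormD f g : supnorm (f + g) <= supnorm f + supnorm g.
Proof.
apply: supnorm_le; first by rewrite addr_ge0 ?supnorm_ge0.
by move=> s; apply: le_trans (ler_normD _ _) _; rewrite lerD ?supnorm_ub.
Qed.

Fact supnorm_eq0 f : supnorm f = 0 -> f = 0.
Proof.
move=> f0; apply: section_ext => s; apply/eqP; rewrite -normr_le0 -f0.
exact: supnorm_ub.
Qed.

Fact supnormZ (k : R[i]) f : supnorm (k *: f) = `|k| * supnorm f.
Proof.
have le_Z (l : R[i]) g : supnorm (l *: g) <= `|l| * supnorm g.
  apply: supnorm_le; first by rewrite mulr_ge0 ?supnorm_ge0.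
  by move=> s; rewrite sectionZE normrZ ler_wpM2l ?supnorm_ub.
apply/eqP; rewrite eq_le le_Z /=.
have [->|k0] := eqVneq k 0; first by rewrite normr0 mul0r supnorm_ge0.
have := le_Z k^-1 (k *: f); rewrite scalerA mulVf // scale1r normfV.
by rewrite ler_pdivlMl ?normr_gt0.
Qed.

HB.instance Definition _ :=
  Lmodule_isNormed.Build R[i] V supnormD supnormZ supnorm_eq0.

Lemma norm_section f : `|f| = supnorm f. Proof. by []. Qed.
Lemma section_norm_ub f s : `|f s| <= `|f|. Proof. exact: supnorm_ub. Qed.
Lemma section_norm_le f (M : R[i]) :
  0 <= M -> (forall s, `|f s| <= M) -> `|f| <= M.
Proof. exact: supnorm_le. Qed.

Fact section_complete (F : set_system V) :
  ProperFilter F -> cauchy F -> cvg F.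
Proof.
move=> FF /cauchy_ballP Fc.
have Fcs s : cvg ((fun f : V => f s) @ F).
  apply: cauchy_cvg; apply/cauchy_ballP => e e0.
  have := Fc _ e0; case=> -[B C] /= [FB FC] BC.
  exists ((fun f : V => f s) @` B, (fun f : V => f s) @` C).
    by split; [apply: (filterS _ FB)|apply: (filterS _ FC)] => f ?; exists f.
  move=> [_ _] /= [[f Bf <-] [g Cg <-]].
  have := BC (f, g) (conj Bf Cg); rewrite -!ball_normE /= -sectionBE.
  exact/le_lt_trans/section_norm_ub.
pose h s : A s := lim ((fun f : V => f s) @ F).
have hF (e : R[i]) : 0 < e -> exists2 B, F B &
    forall f, B f -> forall s, `|h s - f s| <= e.
  move=> e0; have e20 : 0 < e / 2 by rewrite divr_gt0.
  have := Fc _ e20; case=> -[B C] /= [FB FC] BC; exists B => // f Bf s.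
  have /cvgrPdist_lt/(_ _ e20) Hs := Fcs s.
  have /filter_ex[g [Cg hg]] : F (C `&` [set g : V | `|h s - g s| < e / 2]).
    exact: filterI.
  rewrite [e]splitr -[h s](subrK (g s)) -addrA ltW //.
  apply: le_lt_trans (ler_normD _ _) _; apply: ltrD => //.
  have := BC (f, g) (conj Bf Cg); rewrite -!ball_normE /= => fg.
  rewrite distrC -sectionBE; apply: le_lt_trans fg.
  exact: section_norm_ub.
have Ph : inSec P h.
  apply: inSec_ulim => e e0; have [B /filter_ex[f Bf] /(_ f Bf) hf] := hF _ e0.
  by exists f => //; exact: section_funP.
apply/cvg_ex; exists (MkSection Ph); apply/cvgrPdist_le => e e0.
have [B FB HB] := hF _ e0; apply: (filterS _ FB) => f Bf.
apply: section_norm_le; first exact: ltW.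
by move=> s; rewrite sectionBE; exact: HB.
Qed.

HB.instance Definition _ := Uniform_isComplete.Build V section_complete.

Fact secMA : associative secM.
Proof. by move=> f g h; apply: section_ext => s /=; rewrite cmulA. Qed.
Fact secMDl : left_distributive secM +%R.
Proof. by move=> f g h; apply: section_ext => s /=; rewrite cmulDl. Qed.
Fact secMDr : right_distributive secM +%R.
Proof. by move=> f g h; apply: section_ext => s /=; rewrite cmulDr. Qed.
Fact secZAl (k : R[i]) f g : k *: secM f g = secM (k *: f) g.
Proof. by apply: section_ext => s /=; exact: cscaleAl. Qed.
Fact secZAr (k : R[i]) f g : k *: secM f g = secM f (k *: g).
Proof. by apply: section_ext => s /=; exact: cscaleAr. Qed.
Fact sec_adjK : involutive sec_adj.
Proof. by move=> f; apply: section_ext => s /=; rewrite adjK. Qed.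
Fact sec_adjD f g : sec_adj (f + g) = sec_adj f + sec_adj g.
Proof. by apply: section_ext => s /=; rewrite adjD. Qed.
Fact sec_adjZ (k : R[i]) f : sec_adj (k *: f) = k^* *: sec_adj f.
Proof. by apply: section_ext => s /=; rewrite adjZ. Qed.
Fact sec_adjM f g : sec_adj (secM f g) = secM (sec_adj g) (sec_adj f).
Proof. by apply: section_ext => s /=; rewrite adjM. Qed.
Fact sec_normM f g : `|secM f g| <= `|f| * `|g|.
Proof.
apply: section_norm_le; first by rewrite mulr_ge0.
move=> s; apply: le_trans (cnormM _ _) _.
by rewrite ler_pM ?normr_ge0 ?section_norm_ub.
Qed.
Fact sec_norm_adj f : `|secM (sec_adj f) f| = `|f| ^+ 2.
Proof.
apply/eqP; rewrite eq_le; apply/andP; split.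
  apply: section_norm_le; first by rewrite exprn_ge0.
  move=> s /=; rewrite cnorm_adj lerXn2r ?nnegrE ?normr_ge0 //.
  exact: section_norm_ub.
set M := `|secM _ _|; have M0 : 0 <= M by exact: normr_ge0.
have sM0 : 0 <= sqrtC M by rewrite sqrtC_ge0.
rewrite -[M]sqrtCK lerXn2r ?nnegrE ?normr_ge0 //.
apply: section_norm_le => // s.
rewrite -(@ler_pXn2r _ 2) ?nnegrE ?normr_ge0 // sqrtCK -cnorm_adj.
exact: (section_norm_ub (secM (sec_adj f) f)).
Qed.

HB.instance Definition _ := isCStarAlgebra.Build R V secMA secMDl secMDr
  secZAl secZAr sec_adjK sec_adjD sec_adjZ sec_adjM sec_normM sec_norm_adj.

Lemma sectionME f g s : (f ** g) s = f s ** g s. Proof. by []. Qed.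
Lemma section_adjE f s : (adj f) s = adj (f s). Proof. by []. Qed.

End Sections.

Section C0.
Variables (R : realType) (T : topologicalType).
Implicit Types f g : T -> R[i].

Definition vanishes_at_infinity f := forall e : R[i], 0 < e ->
  exists2 K : set T, compact K & forall t, ~ K t -> `|f t| < e.

Lemma vanishes_le (M : R[i]) f g : 0 <= M ->
  (forall t, `|g t| <= M * `|f t|) ->
  vanishes_at_infinity f -> vanishes_at_infinity g.
Proof.
move=> M0 fg vf e e0.
have M1 : 0 < M + 1 by rewrite ltr_wpDl.
have [K cK HK] := vf _ (divr_gt0 e0 M1); exists K => // t /HK ft.
apply: le_lt_trans (fg t) _; rewrite ltr_pdivlMr // mulrC in ft.
by apply: le_lt_trans ft; rewrite ler_wpM2r // lerDl.
Qed.

Definition C0_set : set (T -> R[i]) :=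
  [set f | continuous f /\ vanishes_at_infinity f].

Lemma Re_norm_dist (x y : R[i]) :
  `|complex.Re `|x| - complex.Re `|y| |%:C%C <= `|x - y|.
Proof.
apply: le_trans (ler_dist_dist x y).
by have := normc_Re (`|x| - `|y|); rewrite raddfB.
Qed.

Fact C0_bounded f : C0_set f -> exists M : R[i], forall t, `|f t| <= M.
Proof.
case=> cf vf; have [K cK HK] := vf 1 ltr01.
pose g t : R := complex.Re `|f t|.
have cg : continuous g.
  move=> t; apply/cvgrPdist_lt => e e0.
  have e0' : 0 < e%:C%C :> R[i] by rewrite ltcR.
  have /cvgrPdist_lt/(_ _ e0') := cf t.
  apply: filterS => s fs; rewrite -ltcR; apply: le_lt_trans fs.
  exact: Re_norm_dist.
have /compact_bounded/ex_strict_bound_gt0[M M0 HM] : compact (g @` K).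
  by apply: continuous_compact => //; exact: continuous_subspaceT.
exists (M + 1)%:C%C => t.
have [Kt|/HK ft] := pselect (K t); last first.
  by apply: le_trans (ltW ft) _; rewrite lecR lerDr ltW.
rewrite -[X in X <= _]ge0_ReK // lecR.
have := HM (g t); rewrite /= => /(_ (ex_intro2 _ _ t Kt erefl)) gM.
by rewrite (le_trans (ler_norm _)) // (le_trans (ltW gM)) // lerDl.
Qed.

Fact C0_0 : C0_set (fun _ => 0).
Proof.
split; first by move=> t; exact: cvg_cst.
by move=> e e0; exists set0; [exact: compact0|move=> t _; rewrite normr0].
Qed.

Fact C0_D f g : C0_set f -> C0_set g -> C0_set (fun t => f t + g t).
Proof.
move=> [cf vf] [cg vg]; split; first by move=> t; apply: cvgD; [exact: cf|exact: cg].
move=> e e0; have e20 : 0 < e / 2 by rewrite divr_gt0.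
have [K cK HK] := vf _ e20; have [L cL HL] := vg _ e20.
exists (K `|` L); first exact: compactU.
move=> t /not_orP[/HK ft /HL gt]; rewrite [e]splitr.
exact: le_lt_trans (ler_normD _ _) (ltrD ft gt).
Qed.

Lemma conj_continuous (f : T -> R[i]) :
  continuous f -> continuous (fun t => (f t)^*).
Proof.
move=> cf t; apply/cvgrPdist_lt => e e0.
have /cvgrPdist_lt/(_ _ e0) := cf t; apply: filterS => s.
by rewrite -rmorphB norm_conjC.
Qed.

Fact C0_Z (k : R[i]) f : C0_set f -> C0_set (fun t => k *: f t).
Proof.
move=> [cf vf]; split; first by move=> t; apply: cvgZr; exact: cf.
by apply: (@vanishes_le `|k| f) => // t; rewrite normrZ.
Qed.

Fact C0_M f g : C0_set f -> C0_set g -> C0_set (fun t => f t ** g t).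
Proof.
move=> Cf Cg; have [M HM] := C0_bounded Cf; case: Cf Cg => [cf vf] [cg vg].
split; first by move=> t; apply: cvgM; [exact: cf|exact: cg].
apply: (@vanishes_le `|M| g) => // t; rewrite normrM ler_wpM2r //.
by rewrite (le_trans (HM t)) // real_ler_norm // (ger0_real (le_trans _ (HM t))).
Qed.

Fact C0_adj f : C0_set f -> C0_set (fun t => adj (f t)).
Proof.
move=> [cf vf]; split; first exact: conj_continuous.
by apply: (@vanishes_le 1 f) => // t; rewrite mul1r norm_adj.
Qed.

Fact C0_ulim f :
  (forall e : R[i], 0 < e ->
    exists2 g, C0_set g & forall t, `|f t - g t| <= e) ->
  C0_set f.
Proof.
move=> Hf; split.
  move=> t; apply/cvgrPdist_lt => e e0.
  have e20 : 0 < e / 2 by rewrite divr_gt0.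
  have [g [cg _] fg] := Hf _ (divr_gt0 e20 (ltr0Sn _ 1)).
  have /cvgrPdist_lt/(_ _ e20) := cg t; apply: filterS => s gts.
  have -> : f t - f s = (f t - g t) + (g t - g s) + (g s - f s).
    by rewrite !addrA !subrK.
  have -> : e = e / 2 / 2 + e / 2 + e / 2 / 2 by rewrite addrAC -!splitr.
  apply: le_lt_trans (ler_normD _ _) (ltr_leD _ _); last by rewrite distrC.
  by apply: le_lt_trans (ler_normD _ _) (ler_ltD _ _).
move=> e e0; have e20 : 0 < e / 2 by rewrite divr_gt0.
have [g [_ vg] fg] := Hf _ e20; have [K cK HK] := vg _ e20.
exists K => // t /HK gt; rewrite -[f t](subrK (g t)) [e]splitr.
by apply: le_lt_trans (ler_normD _ _) _; rewrite ler_ltD.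
Qed.

Definition C0_alg : sectionAlg (fun _ : T => R[i] : cstarType R) :=
  @SectionAlg R T (fun _ => R[i] : cstarType R) C0_set
    C0_bounded C0_0 C0_D C0_Z C0_M C0_adj C0_ulim.

Definition C0 : cstarType R := sections C0_alg.

End C0.

Section DirectSum.
Variables (R : realType) (I : choiceType) (A : I -> cstarType R).
Implicit Types a b : forall i, A i.

(* |a i| tends to 0 along the cofinite filter of I. *)
Definition c0_set : set (forall i, A i) :=
  [set a | forall e : R[i], 0 < e -> finite_set [set i | e <= `|a i|]].

Fact c0_bounded a : c0_set a -> exists M : R[i], forall i, `|a i| <= M.
Proof.
move=> /(_ 1 ltr01)/finite_fsetP[F EF].
exists (1 + \sum_(i <- F) `|a i|) => i.
have s0 : 0 <= \sum_(i <- F) `|a i| by apply: sumr_ge0.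
have [/idP iF|iF] := boolP (i \in F).
  rewrite (big_rem i) //= addrCA -[X in X <= _]addr0 lerD //.
  by rewrite addr_ge0 // sumr_ge0.
rewrite -[X in X <= _]addr0 lerD // ltW // real_ltNge //.
apply/negP => ai; move/negP : iF; apply.
by have := EF; rewrite predeqE => /(_ i) [/(_ ai)].
Qed.

Lemma c0_le (M : R[i]) a b : 0 <= M -> (forall i, `|b i| <= M * `|a i|) ->
  c0_set a -> c0_set b.
Proof.
move=> M0 ab ca e e0; have M1 : 0 < M + 1 by rewrite ltr_wpDl.
apply: sub_finite_set (ca _ (divr_gt0 e0 M1)) => i /= eb.
rewrite ler_pdivrMr // mulrC (le_trans eb) // (le_trans (ab i)) //.
by rewrite ler_wpM2r // lerDl.
Qed.

Fact c0_0 : c0_set (fun _ => 0).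
Proof.
move=> e e0; apply: sub_finite_set (finite_set0 I) => i /=.
by rewrite normr0 => /(lt_le_trans e0); rewrite ltxx.
Qed.

Lemma c0_split a b c : c0_set a -> c0_set b ->
  (forall i, `|c i| <= `|a i| + `|b i|) -> c0_set c.
Proof.
move=> ca cb H e e0; have e20 : 0 < e / 2 by rewrite divr_gt0.
have : finite_set ([set i | e / 2 <= `|a i|] `|` [set i | e / 2 <= `|b i|]).
  by rewrite finite_setU; split; [exact: ca|exact: cb].
apply: sub_finite_set => i /= ec.
have [|ha] := boolP (e / 2 <= `|a i|); first by left.
right; rewrite real_leNgt ?ger0_real // ?ltW //; apply/negP => hb.
move: ha; rewrite -real_ltNge ?ger0_real // ?ltW // => ha.
have := le_trans ec (H i); rewrite [e]splitr => /le_lt_trans/(_ (ltrD ha hb)).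
by rewrite ltxx.
Qed.

Fact c0_D a b : c0_set a -> c0_set b -> c0_set (fun i => a i + b i).
Proof. by move=> ca cb; apply: (c0_split ca cb) => i; exact: ler_normD. Qed.

Fact c0_Z (k : R[i]) a : c0_set a -> c0_set (fun i => k *: a i).
Proof. by apply: (@c0_le `|k|) => // i; rewrite normrZ. Qed.

Fact c0_M a b : c0_set a -> c0_set b -> c0_set (fun i => a i ** b i).
Proof.
move=> ca; have [M HM] := c0_bounded ca.
apply: (@c0_le `|M|) => // i; rewrite (le_trans (cnormM _ _)) // ler_wpM2r //.
by rewrite (le_trans (HM i)) // real_ler_norm // (ger0_real (le_trans _ (HM i))).
Qed.

Fact c0_adj a : c0_set a -> c0_set (fun i => adj (a i)).
Proof. by apply: (@c0_le 1) => // i; rewrite mul1r norm_adj. Qed.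

Fact c0_ulim a :
  (forall e : R[i], 0 < e ->
    exists2 b, c0_set b & forall i, `|a i - b i| <= e) ->
  c0_set a.
Proof.
move=> H e e0; have e20 : 0 < e / 2 by rewrite divr_gt0.
have [b cb ab] := H _ e20; apply: sub_finite_set (cb _ e20) => i /= ea.
rewrite -(lerD2l (e / 2)) -splitr (le_trans ea) // -[a i](subrK (b i)).
by rewrite (le_trans (ler_normD _ _)) // lerD2r.
Qed.

Definition c0_alg : sectionAlg A :=
  SectionAlg c0_bounded c0_0 c0_D c0_Z c0_M c0_adj c0_ulim.

Definition c0_sum : cstarType R := sections c0_alg.

Fact summand_c0 (i : I) (x : A i) :
  inSec c0_alg (@dfwith _ A (fun j => 0) i x).
Proof.
move=> e e0; apply: sub_finite_set (finite_set1 i) => j /= ej.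
apply: contrapT => /eqP ji; move: ej; rewrite dfwithout 1?eq_sym // normr0.
by move=> /(lt_le_trans e0); rewrite ltxx.
Qed.

Definition summand (i : I) (x : A i) : c0_sum :=
  @MkSection _ _ _ c0_alg _ (summand_c0 x).

End DirectSum.

Section StarHom.
Variable R : realType.

Record star_hom (A B : cstarType R) (f : A -> B) : Prop := StarHom {
  star_hom_linear : linear f ;
  star_homM : forall a b, f (a ** b) = f a ** f b ;
  star_hom_adj : forall a, f (adj a) = adj (f a)
}.

(* A bijective *-homomorphism between C*-algebras is automatically isometric,
   and its inverse is a *-homomorphism. *)
Definition star_isomorphic (A B : cstarType R) : Prop :=
  exists2 f : A -> B, star_hom f & bijective f.

Record cstar_subalgebra (A : cstarType R) (S : set A) : Prop := {
  subalg0 : S 0 ;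
  subalgD : forall a b, S a -> S b -> S (a + b) ;
  subalgZ : forall (k : R[i]) a, S a -> S (k *: a) ;
  subalgM : forall a b, S a -> S b -> S (a ** b) ;
  subalg_adj : forall a, S a -> S (adj a) ;
  subalg_closed : closed S
}.

(* No proper C*-subalgebra contains G. *)
Definition generates (A : cstarType R) (G : set A) : Prop :=
  forall S : set A, cstar_subalgebra S -> G `<=` S -> S = setT.

End StarHom.

Section Correspondence.
Variables (R : realType) (A : cstarType R).

(* A right Hilbert A-module (inner product linear in the second variable,
   complete for |ip x x|^(1/2)) with a *-homomorphism [lact] from A to the
   adjointable operators. Positivity of [ip x x] is expressed as being of the
   form b^* b. Additivity, homogeneity and right A-linearity of [lact a] follow
   from [lact_adj], as for any adjointable map. *)
Record correspondence := Correspondence {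
  corr :> lmodType R[i] ;
  ract : corr -> A -> corr ;
  lact : A -> corr -> corr ;
  ip : corr -> corr -> A ;
  ractDl : forall x y a, ract (x + y) a = ract x a + ract y a ;
  ractDr : forall x a b, ract x (a + b) = ract x a + ract x b ;
  ractZl : forall (k : R[i]) x a, ract (k *: x) a = k *: ract x a ;
  ractZr : forall (k : R[i]) x a, ract x (k *: a) = k *: ract x a ;
  ractM : forall x a b, ract x (a ** b) = ract (ract x a) b ;
  ipDr : forall x y z, ip x (y + z) = ip x y + ip x z ;
  ipZr : forall (k : R[i]) x y, ip x (k *: y) = k *: ip x y ;
  ip_ract : forall x y a, ip x (ract y a) = ip x y ** a ;
  ip_adj : forall x y, adj (ip x y) = ip y x ;
  ip_pos : forall x, exists b, ip x x = adj b ** b ;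
  ip_eq0 : forall x, ip x x = 0 -> x = 0 ;
  ip_complete : forall u : nat -> corr,
    (forall e : R[i], 0 < e -> exists N, forall m n,
      (N <= m)%N -> (N <= n)%N -> sqrtC `|ip (u m - u n) (u m - u n)| < e) ->
    exists l, forall e : R[i], 0 < e -> exists N, forall n,
      (N <= n)%N -> sqrtC `|ip (u n - l) (u n - l)| < e ;
  lactD : forall a b x, lact (a + b) x = lact a x + lact b x ;
  lactZ : forall (k : R[i]) a x, lact (k *: a) x = k *: lact a x ;
  lactM : forall a b x, lact (a ** b) x = lact a (lact b x) ;
  lact_adj : forall a x y, ip (lact a x) y = ip x (lact (adj a) y)
}.

Variable X : correspondence.
Implicit Types (x y z : X) (t u : X -> X).

Definition hnorm x : R[i] := sqrtC `|ip x x|.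

Definition adjoint_of t u : Prop := forall x y, ip (t x) y = ip x (u y).

Definition theta x y z : X := ract x (ip y z).

(* K(X): the adjointable operators that are operator-norm limits of finite sums
   of theta's (scalars are absorbed by the first argument of theta). *)
Definition compact_op : set (X -> X) := [set t |
  (exists u, adjoint_of t u) /\
  forall e : R[i], 0 < e -> exists s : seq (X * X), forall z,
    hnorm (t z - \sum_(p <- s) theta p.1 p.2 z) <= e * hnorm z].

(* Elements acting by compact operators and annihilating the kernel of the left
   action. *)
Definition katsura_ideal : set A := [set a |
  compact_op (lact a) /\
  forall b, (forall x, lact b x = 0) -> a ** b = 0].

Variable B : cstarType R.
Implicit Types (psi : X -> B) (pi : A -> B) (h : (X -> X) -> B).

Record toeplitz_rep psi pi : Prop := {
  toeplitz_linear : linear psi ;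
  toeplitz_star_hom : star_hom pi ;
  toeplitz_ip : forall x y, adj (psi x) ** psi y = pi (ip x y) ;
  toeplitz_lact : forall a x, psi (lact a x) = pi a ** psi x
}.

(* h restricts on K(X) to the *-homomorphism psi^(1). This restriction is unique
   when it exists, the span of the theta's being dense in K(X) and
   *-homomorphisms of C*-algebras being continuous; the values of h outside
   K(X) are irrelevant. *)
Record induced_hom psi h : Prop := {
  inducedD : forall t u, compact_op t -> compact_op u ->
    h (fun x => t x + u x) = h t + h u ;
  inducedZ : forall (k : R[i]) t, compact_op t ->
    h (fun x => k *: t x) = k *: h t ;
  inducedM : forall t u, compact_op t -> compact_op u ->
    h (t \o u) = h t ** h u ;
  induced_adj : forall t u, compact_op t -> adjoint_of t u ->
    h u = adj (h t) ;
  induced_theta : forall x y, h (theta x y) = psi x ** adj (psi y)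
}.

Record covariant_rep psi pi : Prop := {
  covariant_toeplitz : toeplitz_rep psi pi ;
  covariant_ideal : exists2 h, induced_hom psi h &
    forall a, katsura_ideal a -> h (lact a) = pi a
}.

End Correspondence.

Record is_cuntz_pimsner (R : realType) (A : cstarType R) (X : correspondence A)
    (O : cstarType R) (psi : X -> O) (pi : A -> O) : Prop := {
  cuntz_pimsner_covariant : covariant_rep psi pi ;
  cuntz_pimsner_generates : generates (range psi `|` range pi) ;
  cuntz_pimsner_universal :
    forall (B : cstarType R) (psi' : X -> B) (pi' : A -> B),
      covariant_rep psi' pi' ->
      exists2 rho : O -> B, star_hom rho &
        (forall x, rho (psi x) = psi' x) /\ (forall a, rho (pi a) = pi' a)
}.

Record digraph := Digraph {
  vertex : choiceType ;
  edge : choiceType ;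
  src : edge -> vertex ;
  rng : edge -> vertex
}.

(* E^oo inside the product of countably many copies of the discrete space E^1;
   the edge e_(n+1) of the path is [alpha n]. *)
Definition infinite_path (E : digraph) :
    set (prod_topology (fun _ : nat => discrete_topology (edge E))) :=
  [set alpha | forall n, src (alpha n) = rng (alpha n.+1)].
Arguments infinite_path : clear implicits.

Section Graph.
Variable E : digraph.

Definition row_finite : Prop :=
  forall v : vertex E, finite_set [set e : edge E | rng e = v].
Definition no_sources : Prop :=
  forall v : vertex E, [set e : edge E | rng e = v] !=set0.

Definition path_range (alpha : infinite_path E) : vertex E := rng (val alpha 0).

Definition cons_fun (e : edge E) (alpha : nat -> edge E) (n : nat) : edge E :=
  if n is m.+1 then alpha m else e.

Fact cons_path_subproof (e : edge E) (alpha : infinite_path E) :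
  path_range alpha = src e -> cons_fun e (val alpha) \in infinite_path E.
Proof.
move=> h; apply/mem_set => -[|n] /=; first by rewrite -h.
by case: alpha {h} => a /= /set_mem; apply.
Qed.

Definition cons_path (e : edge E) (alpha : infinite_path E)
    (h : path_range alpha = src e) : infinite_path E :=
  exist _ (cons_fun e (val alpha)) (cons_path_subproof h).

Variables (R : realType) (B : cstarType R).

Record ck_family (p : vertex E -> B) (s : edge E -> B) : Prop := {
  ck_proj : forall v, p v ** p v = p v /\ adj (p v) = p v ;
  ck_orth : forall v w, v <> w -> p v ** p w = 0 ;
  ck_pisom : forall e, s e ** adj (s e) ** s e = s e ;
  ck_src : forall e, adj (s e) ** s e = p (src e) ;
  ck_rng : forall v, p v = \sum_(e \in [set e | rng e = v]) s e ** adj (s e)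
}.

End Graph.

Record is_graph_algebra (R : realType) (E : digraph) (C : cstarType R)
    (p : vertex E -> C) (s : edge E -> C) : Prop := {
  graph_algebra_ck : ck_family p s ;
  graph_algebra_generates : generates (range p `|` range s) ;
  graph_algebra_universal :
    forall (B : cstarType R) (q : vertex E -> B) (t : edge E -> B),
      ck_family q t ->
      exists2 rho : C -> B, star_hom rho &
        (forall v, rho (p v) = q v) /\ (forall e, rho (s e) = t e)
}.

#[global] Existing Instance totally_filter.

Section ComplexOrder.
Variable R : realType.
Implicit Types x y : R[i].

Lemma lec_addgt0P x y : 0 <= x -> 0 <= y ->
  (forall e : R[i], 0 < e -> x <= e + y) -> x <= y.
Proof.
move=> x0 y0 H; rewrite -(ge0_ReK x0) -(ge0_ReK y0) lecR.
apply/ler_addgt0Pl => e e0.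
have e0' : 0 < e%:C%C :> R[i] by rewrite ltcR.
by have := H _ e0'; rewrite -{1}(ge0_ReK x0) -{1}(ge0_ReK y0) -rmorphD lecR.
Qed.

Lemma normM_le_sqr x y : `|x * y| <= `|x| ^+ 2 + `|y| ^+ 2.
Proof.
have := real_exprn_even_ge0 (n := 2) (realB (normr_real x) (normr_real y)) erefl.
rewrite normrM sqrrB addrAC subr_ge0; apply: le_trans.
by rewrite mulr2n lerDl mulr_ge0.
Qed.

Lemma normD_le_sqr x y : `|x + y| ^+ 2 <= 2 * (`|x| ^+ 2 + `|y| ^+ 2).
Proof.
apply: (@le_trans _ _ ((`|x| + `|y|) ^+ 2)).
  by rewrite lerXn2r ?nnegrE ?addr_ge0 ?ler_normD.
have := real_exprn_even_ge0 (n := 2) (realB (normr_real x) (normr_real y)) erefl.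
rewrite sqrrB sqrrD mulrDl mul1r addrAC subr_ge0 => H.
by rewrite addrAC lerD2l.
Qed.

Lemma sqrtC_dist x y : 0 <= x -> 0 <= y ->
  `|sqrtC x - sqrtC y| ^+ 2 <= `|x - y|.
Proof.
move=> x0 y0; rewrite -{2}(sqrtCK x) -{2}(sqrtCK y) subr_sqr normrM expr2.
rewrite ler_wpM2l // (le_trans (ler_normB _ _)) // !ger0_norm ?sqrtC_ge0 //.
by rewrite addr_ge0 ?sqrtC_ge0.
Qed.

Lemma sqrtC_lt_sqr x y : 0 <= x -> 0 <= y -> (sqrtC x < y) = (x < y ^+ 2).
Proof.
by move=> x0 y0; rewrite -{2}(sqrtCK x) ltr_pXn2r ?nnegrE ?sqrtC_ge0.
Qed.

End ComplexOrder.

Section PartialSums.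
Variables (R : realType) (I : choiceType).
Local Open Scope fset_scope.

Lemma partial_sumE (V : zmodType) (x : I -> V) (F : {fset I}) :
  partial_sum x F = \sum_(i <- F) x i.
Proof. by rewrite /partial_sum big_seq_fsetE. Qed.

Lemma totallyI (F : {fset I}) (P : set {fset I}) :
  (forall G : {fset I}, F `<=` G -> P G) -> totally P.
Proof. by move=> H; exists F. Qed.

Lemma sum_fsetD (V : zmodType) (x : I -> V) (F G : {fset I}) : F `<=` G ->
  (\sum_(i <- G) x i = \sum_(i <- F) x i + \sum_(i <- G `\` F) x i)%R.
Proof.
move=> FG; rewrite (big_fsetID _ (mem F)) /=; congr (_ + _)%R.
  apply: congr_big => //; congr enum_fset; apply/fsetP => i; rewrite !inE /=.
  by rewrite andbC; apply/andb_idr => iF; exact: (fsubsetP FG).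
apply: congr_big => //; congr enum_fset; apply/fsetP => i; rewrite !inE /=.
by rewrite andbC.
Qed.

Lemma cvg_partial_sumP (V : completeNormedModType R[i]) (x : I -> V) :
  (exists a : V, partial_sum x @ totally --> a) <->
  forall e : R[i], 0 < e -> exists F : {fset I}, forall G : {fset I},
    (forall i, i \in G -> i \notin F) -> `|\sum_(i <- G) x i| <= e.
Proof.
split=> [[a /cvgrPdist_lt xa] e e0|H].
  have e20 : 0 < e / 2 by rewrite divr_gt0.
  have [F _ HF] := xa _ e20; exists F => G FG.
  have := HF _ (fsubsetUl F G); have := HF _ (fsubset_refl F).
  rewrite /= !partial_sumE (sum_fsetD x (fsubsetUl F G)).
  have -> : (F `|` G) `\` F = G.
    apply/fsetP => i; rewrite !inE; case: (boolP (i \in F)) => //= iF.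
    by apply/esym/negP => /FG; rewrite iF.
  rewrite opprD addrA => aF aFG; rewrite -[(\sum_(i <- G) _)%R](subKr (a - \sum_(i <- F) x i)%R).
  rewrite ltW // [e]splitr.
  exact: le_lt_trans (ler_normB _ _) (ltrD aF aFG).
apply/cvg_ex; apply: cauchy_cvg; apply: cauchy_exP => e e0.
have e20 : 0 < e / 2 by rewrite divr_gt0.
have [F HF] := H _ e20.
exists (partial_sum x F); apply: (@totallyI F) => G FG.
rewrite -ball_normE /= !partial_sumE (sum_fsetD x FG) opprD addNKr normrN; apply: le_lt_trans (HF _ _) _.
  by move=> i; rewrite inE => /andP[].
by rewrite [ltRHS]splitr ltrDl.
Qed.

End PartialSums.

Section Evaluation.
Variables (R : realType) (V : choiceType) (T : V -> topologicalType).
Local Notation A := (c0_sum (fun v => C0 R (T v))).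
Implicit Types a b : A.

Definition ev a (v : V) (t : T v) : R[i] :=
  @section_fun R _ _ (C0_alg R (T v)) (@section_fun R _ _ (c0_alg _) a v) t.

Lemma evD a b v t : @ev (a + b) v t = ev a t + ev b t. Proof. by []. Qed.
Lemma ev0 v t : @ev 0 v t = 0. Proof. by []. Qed.
Lemma evN a v t : @ev (- a) v t = - ev a t.
Proof.
rewrite /ev (sectionNE (a : sections (c0_alg (fun v => C0 R (T v)))) v).
exact: (@sectionNE R _ _ (C0_alg R (T v))).
Qed.
Lemma evB a b v t : @ev (a - b) v t = ev a t - ev b t.
Proof. by rewrite evD evN. Qed.
Lemma evZ (k : R[i]) a v t : @ev (k *: a) v t = k * ev a t. Proof. by []. Qed.
Lemma evM a b v t : @ev (a ** b) v t = ev a t * ev b t. Proof. by []. Qed.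
Lemma ev_adj a v t : @ev (adj a) v t = (ev a t)^*. Proof. by []. Qed.
Lemma ev_sum (I : Type) (r : seq I) (P : pred I) (F : I -> A) v t :
  @ev (\sum_(i <- r | P i) F i) v t = \sum_(i <- r | P i) ev (F i) t.
Proof. by elim/big_rec2: _ => // i x y _ <-. Qed.

Lemma ev_ext a b : (forall v t, @ev a v t = ev b t) -> a = b.
Proof. by move=> ab; apply: section_ext => v; apply: section_ext; exact: ab. Qed.

Lemma ev_norm a v t : `|@ev a v t| <= `|a|.
Proof.
apply: le_trans (section_norm_ub (a : sections (c0_alg (fun v => C0 R (T v)))) v).
exact: (@section_norm_ub R _ _ (C0_alg R (T v))).
Qed.

Lemma ev_norm_le a (M : R[i]) : 0 <= M -> (forall v t, `|@ev a v t| <= M) ->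
  `|a| <= M.
Proof.
move=> M0 H; apply: section_norm_le => // v.
by apply: (@section_norm_le R _ _ (C0_alg R (T v))) => // t; exact: H.
Qed.

Lemma cmul_comm a b : a ** b = b ** a.
Proof. by apply: ev_ext => v t; rewrite !evM mulrC. Qed.

Section Families.
Variable I : choiceType.
Implicit Types x y : I -> A.

Definition sq_tail x := forall e : R[i], 0 < e -> exists F : {fset I},
  forall G : {fset I}, (forall i, i \in G -> i \notin F) ->
  forall v t, \sum_(i <- G) `|@ev (x i) v t| ^+ 2 <= e.

Lemma sq_tail_le (M : R[i]) x y : 0 <= M ->
  (forall i v t, `|@ev (y i) v t| <= M * `|ev (x i) t|) ->
  sq_tail x -> sq_tail y.
Proof.
move=> M0 xy tx e e0; have M1 : 0 < M ^+ 2 + 1 by rewrite ltr_wpDl ?exprn_ge0.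
have [F HF] := tx _ (divr_gt0 e0 M1); exists F => G GF v t.
have := HF G GF v t; rewrite ler_pdivlMr // mulrC => H; apply: le_trans H.
rewrite mulr_sumr ler_sum // => i _.
apply: (@le_trans _ _ ((M * `|ev (x i) t|) ^+ 2)).
  by rewrite lerXn2r ?nnegrE ?mulr_ge0.
by rewrite exprMn ler_wpM2r ?exprn_ge0 // lerDl.
Qed.

Lemma sq_tailD x y : sq_tail x -> sq_tail y -> sq_tail (fun i => x i + y i).
Proof.
move=> tx ty e e0; have e40 : 0 < e / 2 / 2 by rewrite !divr_gt0.
have [F HF] := tx _ e40; have [G HG] := ty _ e40.
exists (F `|` G)%fset => H HFG v t.
have HFH : forall i, i \in H -> i \notin F.
  by move=> i /HFG; rewrite inE negb_or => /andP[].
have HGH : forall i, i \in H -> i \notin G.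
  by move=> i /HFG; rewrite inE negb_or => /andP[].
apply: (@le_trans _ _ (\sum_(i <- H)
    2 * (`|ev (x i) t| ^+ 2 + `|ev (y i) t| ^+ 2))).
  by apply: ler_sum => i _; rewrite evD normD_le_sqr.
rewrite -mulr_sumr big_split /= mulrC -ler_pdivlMr // [leRHS]splitr.
by rewrite lerD ?HF ?HG.
Qed.

Lemma cvg_ip x y : sq_tail x -> sq_tail y ->
  exists a : A, partial_sum (fun i => adj (x i) ** y i) @ totally --> a.
Proof.
move=> tx ty; apply/cvg_partial_sumP => e e0.
have e20 : 0 < e / 2 by rewrite divr_gt0.
have [F HF] := tx _ e20; have [G HG] := ty _ e20.
exists (F `|` G)%fset => H HFG.
have HFH : forall i, i \in H -> i \notin F.
  by move=> i /HFG; rewrite inE negb_or => /andP[].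
have HGH : forall i, i \in H -> i \notin G.
  by move=> i /HFG; rewrite inE negb_or => /andP[].
apply: ev_norm_le => [|v t]; first exact: ltW.
rewrite ev_sum (le_trans (ler_norm_sum _ _ _)) //.
apply: (@le_trans _ _ (\sum_(i <- H)
    (`|ev (x i) t| ^+ 2 + `|ev (y i) t| ^+ 2))).
  apply: ler_sum => i _; rewrite evM ev_adj.
  by rewrite (le_trans (normM_le_sqr _ _)) // norm_conjC.
by rewrite big_split /= [leRHS]splitr lerD ?HF ?HG.
Qed.

Lemma ev_sq x (G : {fset I}) v t :
  @ev (partial_sum (fun i => adj (x i) ** x i) G) v t =
  \sum_(i <- G) `|ev (x i) t| ^+ 2.
Proof.
rewrite partial_sumE ev_sum; apply: eq_bigr => i _.
by rewrite evM ev_adj normCK mulrC.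
Qed.

Lemma sq_tailP x :
  (exists a : A, partial_sum (fun i => adj (x i) ** x i) @ totally --> a) <->
  sq_tail x.
Proof.
split=> [|tx]; last exact: cvg_ip.
move/cvg_partial_sumP => H e e0; have [F HF] := H _ e0; exists F => G FG v t.
rewrite -ev_sq; have := HF _ FG; rewrite -partial_sumE.
set a := partial_sum _ _ => ae.
have a0 : 0 <= ev a t by rewrite ev_sq sumr_ge0 // => i _; rewrite exprn_ge0.
by rewrite -(ger0_norm a0) (le_trans (ev_norm _ _)).
Qed.

Section Limit.
Variables (x : I -> A) (a : A).
Hypothesis xa : partial_sum (fun i => adj (x i) ** x i) @ totally --> a.

Lemma sq_approx (e : R[i]) (F : {fset I}) : 0 < e ->
  exists2 G : {fset I}, (F `<=` G)%fset &
    forall v t, `|@ev a v t - \sum_(i <- G) `|ev (x i) t| ^+ 2| <= e.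
Proof.
move=> e0; move/cvgrPdist_lt : xa => /(_ _ e0)[H _ HH].
exists (F `|` H)%fset => [|v t]; first exact: fsubsetUl.
rewrite -ev_sq -evB (le_trans (ev_norm _ _)) // ltW //.
by apply: HH; rewrite /= fsubsetUr.
Qed.

Lemma sq_sum_ge0 (G : {fset I}) v t : 0 <= \sum_(i <- G) `|@ev (x i) v t| ^+ 2.
Proof. by rewrite sumr_ge0 // => i _; rewrite exprn_ge0. Qed.

Lemma sq_lim_ge0 v t : 0 <= @ev a v t.
Proof.
suff -> : @ev a v t = `|ev a t| by [].
apply/eqP; rewrite -subr_eq0 -normr_le0; apply: lec_addgt0P => // e e0.
have [G _ /(_ v t)] := @sq_approx (e / 2) fset0 (divr_gt0 e0 (ltr0Sn _ 1)).
set s := \sum_(i <- _) _ => H; have s0 : 0 <= s by exact: sq_sum_ge0.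
rewrite addr0 -[ev a t](subrK s) -addrA [e]splitr.
rewrite (le_trans (ler_normD _ _)) // lerD // subrK.
by rewrite -{1}(ger0_norm s0) distrC (le_trans (ler_dist_dist _ _)).
Qed.

Lemma sq_le_lim (G : {fset I}) v t :
  \sum_(i <- G) `|@ev (x i) v t| ^+ 2 <= ev a t.
Proof.
apply: lec_addgt0P; [exact: sq_sum_ge0|exact: sq_lim_ge0|move=> e e0].
have [H GH /(_ v t) He] := sq_approx G e0.
apply: (@le_trans _ _ (\sum_(i <- H) `|ev (x i) t| ^+ 2)).
  by rewrite (sum_fsetD (fun i => `|ev (x i) t| ^+ 2) GH) lerDl sq_sum_ge0.
rewrite -lerBlDr -(ger0_norm (sq_sum_ge0 H t)) -(ger0_norm (sq_lim_ge0 t)).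
by rewrite (le_trans (lerB_dist _ _)) // distrC.
Qed.

Lemma sq_lim_le (M : R[i]) : 0 <= M ->
  (forall (G : {fset I}) v t, \sum_(i <- G) `|@ev (x i) v t| ^+ 2 <= M) ->
  `|a| <= M.
Proof.
move=> M0 H; apply: ev_norm_le => // v t.
apply: lec_addgt0P => // e e0; have [G _ /(_ v t) He] := sq_approx fset0 e0.
rewrite -[ev a t](subrK (\sum_(i <- G) `|ev (x i) t| ^+ 2)).
rewrite (le_trans (ler_normD _ _)) // lerD //.
by rewrite ger0_norm ?sq_sum_ge0.
Qed.

Lemma sq_lim_pos : exists b : A, a = adj b ** b.
Proof.
pose bf v (t : T v) : R[i] := sqrtC (ev a t).
have bf0 v t : 0 <= bf v t by rewrite sqrtC_ge0 sq_lim_ge0.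
have Cb v : inSec (C0_alg R (T v)) (bf v).
  have [ca va] := section_funP (@section_fun R _ _ (c0_alg _) a v).
  split=> [t|e e0].
    apply/cvgrPdist_lt => e e0; have e20 : 0 < e ^+ 2 by rewrite exprn_gt0.
    have /cvgrPdist_lt/(_ _ e20) := ca t; apply: filterS => s.
    move=> H; rewrite -(@ltr_pXn2r _ 2) ?nnegrE ?normr_ge0 ?ltW //.
    by apply: le_lt_trans H; apply: sqrtC_dist; exact: sq_lim_ge0.
  have e20 : 0 < e ^+ 2 by rewrite exprn_gt0.
  have [K cK HK] := va _ e20; exists K => // t /HK H.
  have {H} : `|ev a t| < e ^+ 2 by exact: H.
  by rewrite !ger0_norm ?bf0 ?sq_lim_ge0 // sqrtC_lt_sqr ?sq_lim_ge0 // ltW.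
pose b1 v : C0 R (T v) := @MkSection R _ _ (C0_alg R (T v)) _ (Cb v).
have cb : inSec (c0_alg (fun v => C0 R (T v))) b1.
  move=> e e0; have e20 : 0 < e ^+ 2 by rewrite exprn_gt0.
  apply: sub_finite_set (@section_funP R _ _ (c0_alg _) a _ e20) => v /= eb.
  set w := section_fun _ _.
  apply: (@le_trans _ _ (`|b1 v| ^+ 2)).
    by rewrite lerXn2r ?nnegrE ?normr_ge0 // ltW.
  have w0 : 0 <= sqrtC `|w| by rewrite sqrtC_ge0.
  rewrite -[leRHS]sqrtCK lerXn2r ?nnegrE ?normr_ge0 //.
  apply: (@section_norm_le R _ _ (C0_alg R (T v))) => // t.
  rewrite -(@ler_pXn2r _ 2) ?nnegrE ?normr_ge0 // sqrtCK.
  rewrite -normrX /= sqrtCK.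
  exact: (@section_norm_ub R _ _ (C0_alg R (T v)) w).
exists (@MkSection R _ _ (c0_alg _) _ cb); apply: ev_ext => v t.
by rewrite evM ev_adj /= geC0_conj ?bf0 // -expr2 sqrtCK.
Qed.

End Limit.
End Families.

Lemma ev_summand u (x : C0 R (T u)) v t :
  @ev (@summand R V (fun v => C0 R (T v)) u x) v t =
  @section_fun R _ _ (C0_alg R (T v))
    (@dfwith V (fun v => C0 R (T v)) (fun=> 0) u x v) t.
Proof. by []. Qed.

End Evaluation.

Section C0Eval.
Variables (R : realType) (T : topologicalType).
Definition C0ev (f : C0 R T) (t : T) : R[i] := @section_fun R _ _ (C0_alg R T) f t.
Lemma C0ev_ext (f g : C0 R T) : (forall t, C0ev f t = C0ev g t) -> f = g.
Proof. exact: section_ext. Qed.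
Lemma C0evD (f g : C0 R T) t : C0ev (f + g) t = C0ev f t + C0ev g t.
Proof. by []. Qed.
Lemma C0evB (f g : C0 R T) t : C0ev (f - g) t = C0ev f t - C0ev g t.
Proof. exact: (@sectionBE R _ _ (C0_alg R T)). Qed.
Lemma C0evZ (k : R[i]) (f : C0 R T) t : C0ev (k *: f) t = k * C0ev f t.
Proof. by []. Qed.
Lemma C0evM (f g : C0 R T) t : C0ev (f ** g) t = C0ev f t * C0ev g t.
Proof. by []. Qed.
Lemma C0ev_adj (f : C0 R T) t : C0ev (adj f) t = (C0ev f t)^*.
Proof. by []. Qed.
Lemma C0ev_norm (f : C0 R T) t : `|C0ev f t| <= `|f|.
Proof. exact: (@section_norm_ub R _ _ (C0_alg R T)). Qed.
Lemma C0_norm_le (f : C0 R T) (M : R[i]) : 0 <= M ->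
  (forall t, `|C0ev f t| <= M) -> `|f| <= M.
Proof. exact: (@section_norm_le R _ _ (C0_alg R T)). Qed.
End C0Eval.

Section Pullback.
Variables (R : realType) (S T : topologicalType) (phi : S -> T).
Hypothesis cphi : continuous phi.

(* (f o phi) x lies in C_0(S) although f o phi need not vanish at infinity. *)
Fact pullback_act_subproof (f : C0 R T) (x : C0 R S) :
  inSec (C0_alg R S) (fun s => C0ev f (phi s) * C0ev x s).
Proof.
have [cf _] := @section_funP R _ _ (C0_alg R T) f.
have [cx vx] := @section_funP R _ _ (C0_alg R S) x.
split.
  move=> s; apply: cvgM; last exact: cx.
  by apply: (@continuous_comp _ _ _ phi (C0ev f)); [exact: cphi|exact: cf].
apply: (@vanishes_le R S `|f| (C0ev x)) => // s.
by rewrite normrM ler_wpM2r // C0ev_norm.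
Qed.

Definition pullback_act (f : C0 R T) (x : C0 R S) : C0 R S :=
  @MkSection R _ _ (C0_alg R S) _ (pullback_act_subproof f x).

Lemma pullback_actE f x s :
  C0ev (pullback_act f x) s = C0ev f (phi s) * C0ev x s.
Proof. by []. Qed.
End Pullback.

Section CStarCvg.
Variables (R : realType) (A : cstarType R) (I : Type) (F : set_system I).
Hypothesis FF : ProperFilter F.

Lemma cvg_cmulr (f : I -> A) (l a : A) :
  f @ F --> l -> (fun i => f i ** a) @ F --> l ** a.
Proof.
move=> /cvgrPdist_lt fl; apply/cvgrPdist_lt => e e0.
have a1 : 0 < `|a| + 1 by rewrite ltr_wpDl.
apply: filterS (fl _ (divr_gt0 e0 a1)) => i.
rewrite ltr_pdivlMr // -cmulrBl; apply: le_lt_trans.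
by rewrite (le_trans (cnormM _ _)) // ler_wpM2l // lerDl.
Qed.

Lemma cvg_adj (f : I -> A) (l : A) :
  f @ F --> l -> (fun i => adj (f i)) @ F --> adj l.
Proof.
move=> /cvgrPdist_lt fl; apply/cvgrPdist_lt => e e0.
by apply: filterS (fl _ e0) => i; rewrite -adjB norm_adj.
Qed.

End CStarCvg.

Section GraphCorrespondence.
Variables (R : realType) (E : digraph) (T : vertex E -> topologicalType).
Variable phi : forall e : edge E, T (src e) -> T (rng e).
Hypothesis cphi : forall e, continuous (@phi e).

Local Notation A := (c0_sum (fun v => C0 R (T v))).
Local Notation Xe e := (C0 R (T (src e))).
Local Notation "x @_ v" := (@section_fun R _ _ (c0_alg _) x v)
  (at level 2, v at level 2, format "x @_ v").

(* The inclusion of the summand C_0(T_v) in the direct sum. *)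
Definition inA (v : vertex E) (f : C0 R (T v)) : A :=
  @summand R _ (fun v => C0 R (T v)) v f.

Lemma inA_at u (f : C0 R (T u)) t : @ev R _ T (inA f) u t = C0ev f t.
Proof. by rewrite /ev /inA /summand /= dfwithin. Qed.

Lemma inA_case u v (t : T v) :
  (exists t' : T u, forall f : C0 R (T u), @ev R _ T (inA f) v t = C0ev f t') \/
  (forall f : C0 R (T u), @ev R _ T (inA f) v t = 0).
Proof.
case: (eqVneq u v) => [uv|uv].
  by case: _ / uv t => t; left; exists t => f; exact: inA_at.
by right => f; rewrite /ev /inA /summand /= dfwithout.
Qed.

Lemma inA_adjM u (f g : C0 R (T u)) : inA (adj f ** g) = adj (inA f) ** inA g.
Proof.
apply: ev_ext => v t; rewrite evM ev_adj.
have [[t' H]|H] := inA_case u t; rewrite !H //.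
by rewrite mulr0.
Qed.

Lemma inAD u (f g : C0 R (T u)) : inA (f + g) = inA f + inA g.
Proof.
apply: ev_ext => v t; rewrite evD.
by have [[t' H]|H] := inA_case u t; rewrite !H ?addr0.
Qed.

Lemma inAZ u (k : R[i]) (f : C0 R (T u)) : inA (k *: f) = k *: inA f.
Proof.
apply: ev_ext => v t; rewrite evZ.
by have [[t' H]|H] := inA_case u t; rewrite !H ?mulr0.
Qed.

Lemma inA_mulr u (f : C0 R (T u)) (a : A) : inA (f ** a@_u) = inA f ** a.
Proof.
apply: ev_ext => v t; rewrite evM.
case: (eqVneq u v) => [uv|uv].
  by case: _ / uv t => t; rewrite !inA_at.
by rewrite /ev /inA /summand /= !dfwithout // mul0r.
Qed.

Implicit Types x y z : forall e : edge E, Xe e.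

(* The sum over e of <x_e, x_e> converges in A, unconditionally. *)
Definition summable_ip x := exists a : A,
  partial_sum (fun e => inA (adj (x e) ** x e)) @ totally --> a.

Let ipE x y : (fun e => inA (adj (x e) ** y e)) =
  (fun e => adj (inA (x e)) ** inA (y e)).
Proof. by apply/funext => e; rewrite inA_adjM. Qed.

Lemma summable_ipP x : summable_ip x <-> sq_tail (fun e => inA (x e)).
Proof. by rewrite /summable_ip ipE; exact: sq_tailP. Qed.

Lemma summable_ip_le (M : R[i]) x y : 0 <= M ->
  (forall e t, `|C0ev (y e) t| <= M * `|C0ev (x e) t|) ->
  summable_ip x -> summable_ip y.
Proof.
move=> M0 xy /summable_ipP sx; apply/summable_ipP.
apply: sq_tail_le M0 _ sx => e v t.
have [[t' H]|H] := inA_case (src e) t; rewrite !H //.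
by rewrite normr0 mulr0.
Qed.

Fact summable_ip0 : summable_ip (fun e => 0).
Proof.
exists 0; rewrite (_ : partial_sum _ = fun=> 0); first exact: cvg_cst.
apply/funext => F; rewrite partial_sumE big1 // => e _.
by rewrite cmulr0; apply: ev_ext => v t;
  have [[t' H]|H] := inA_case (src e) t; rewrite H.
Qed.

Fact summable_ipD x y : summable_ip x -> summable_ip y ->
  summable_ip (fun e => x e + y e).
Proof.
move=> /summable_ipP sx /summable_ipP sy; apply/summable_ipP.
rewrite (_ : (fun e => _) = fun e => inA (x e) + inA (y e)).
  exact: sq_tailD.
by apply/funext => e; rewrite inAD.
Qed.

Fact summable_ipZ (k : R[i]) x : summable_ip x -> summable_ip (fun e => k *: x e).
Proof. by apply: (@summable_ip_le `|k|) => // e t; rewrite C0evZ normrM. Qed.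

Fact summable_ip_ract x (a : A) : summable_ip x ->
  summable_ip (fun e => x e ** a@_(src e)).
Proof.
apply: (@summable_ip_le `|a|) => // e t; rewrite C0evM normrM mulrC.
by rewrite ler_wpM2r //; exact: (@ev_norm R _ T a).
Qed.

Fact summable_ip_lact (a : A) x : summable_ip x ->
  summable_ip (fun e => pullback_act (@cphi e) a@_(rng e) (x e)).
Proof.
apply: (@summable_ip_le `|a|) => // e t; rewrite pullback_actE normrM.
by rewrite ler_wpM2r //; exact: (@ev_norm R _ T a).
Qed.

Record graph_module := GraphModule {
  gm_fun :> forall e : edge E, Xe e ;
  gm_funP : summable_ip gm_fun
}.
Local Notation X := graph_module.
Implicit Types xi eta zeta : X.

Lemma gm_ext xi eta : (forall e, xi e = eta e) -> xi = eta.
Proof.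
case: xi eta => [x Px] [y Py] /= xy.
have E0 : x = y by apply: functional_extensionality_dep.
by case: _ / E0 Py => Py; congr GraphModule; exact: Prop_irrelevance.
Qed.

HB.instance Definition _ := gen_eqMixin X.
HB.instance Definition _ := gen_choiceMixin X.

Definition gm0 : X := GraphModule summable_ip0.
Definition gmD xi eta : X :=
  GraphModule (summable_ipD (gm_funP xi) (gm_funP eta)).
Definition gmZ (k : R[i]) xi : X := GraphModule (summable_ipZ k (gm_funP xi)).
Definition gm_ract xi (a : A) : X :=
  GraphModule (summable_ip_ract a (gm_funP xi)).
Definition gm_lact (a : A) xi : X :=
  GraphModule (summable_ip_lact a (gm_funP xi)).
(* The component at v of this sum in A is the sum of adj (xi e) ** eta e over the
   edges e with src e = v, the other terms having component 0 at v. *)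
Definition gm_ip xi eta : A :=
  lim (partial_sum (fun e => inA (adj (xi e) ** eta e)) @ totally).

Fact gmDA : associative gmD.
Proof. by move=> x y z; apply: gm_ext => e /=; rewrite addrA. Qed.
Fact gmDC : commutative gmD.
Proof. by move=> x y; apply: gm_ext => e /=; rewrite addrC. Qed.
Fact gm0D : left_id gm0 gmD.
Proof. by move=> x; apply: gm_ext => e /=; rewrite add0r. Qed.
Fact gmND : left_inverse gm0 (gmZ (- 1)) gmD.
Proof. by move=> x; apply: gm_ext => e /=; rewrite scaleN1r addNr. Qed.
HB.instance Definition _ := GRing.isZmodule.Build X gmDA gmDC gm0D gmND.

Fact gmZA (k l : R[i]) xi : gmZ k (gmZ l xi) = gmZ (k * l) xi.
Proof. by apply: gm_ext => e /=; rewrite scalerA. Qed.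
Fact gmZ1 : left_id 1 gmZ.
Proof. by move=> x; apply: gm_ext => e /=; rewrite scale1r. Qed.
Fact gmZDr : right_distributive gmZ +%R.
Proof. by move=> k x y; apply: gm_ext => e /=; rewrite scalerDr. Qed.
Fact gmZDl xi : {morph gmZ^~ xi : k l / k + l}.
Proof. by move=> k l; apply: gm_ext => e /=; rewrite scalerDl. Qed.
HB.instance Definition _ :=
  GRing.Zmodule_isLmodule.Build R[i] X gmZA gmZ1 gmZDr gmZDl.

Lemma gmDE xi eta e : (xi + eta) e = xi e + eta e. Proof. by []. Qed.
Lemma gmZE (k : R[i]) xi e : (k *: xi) e = k *: xi e. Proof. by []. Qed.
Lemma gmBE xi eta e : (xi - eta) e = xi e - eta e.
Proof. by rewrite gmDE -[in RHS]scaleN1r. Qed.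

Lemma gm_ip_cvg xi eta :
  partial_sum (fun e => inA (adj (xi e) ** eta e)) @ totally --> gm_ip xi eta.
Proof.
apply/cvg_ex; rewrite ipE.
by apply: cvg_ip; apply/summable_ipP; exact: gm_funP.
Qed.

Lemma gm_ip_unique xi eta (a : A) :
  partial_sum (fun e => inA (adj (xi e) ** eta e)) @ totally --> a ->
  gm_ip xi eta = a.
Proof. by move=> H; apply: cvg_lim H; exact: norm_hausdorff. Qed.

Lemma gm_ip_sq_cvg xi :
  partial_sum (fun e => adj (inA (xi e)) ** inA (xi e)) @ totally
    --> gm_ip xi xi.
Proof. by rewrite -ipE; exact: gm_ip_cvg. Qed.

Fact gm_ractDl xi eta a : gm_ract (xi + eta) a = gm_ract xi a + gm_ract eta a.
Proof. by apply: gm_ext => e; exact: cmulDl. Qed.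
Fact gm_ractDr xi a b : gm_ract xi (a + b) = gm_ract xi a + gm_ract xi b.
Proof. by apply: gm_ext => e; exact: cmulDr. Qed.
Fact gm_ractZl (k : R[i]) xi a : gm_ract (k *: xi) a = k *: gm_ract xi a.
Proof. by apply: gm_ext => e; rewrite gmZE /= cscaleAl. Qed.
Fact gm_ractZr (k : R[i]) xi a : gm_ract xi (k *: a) = k *: gm_ract xi a.
Proof. by apply: gm_ext => e; rewrite gmZE /= cscaleAr. Qed.
Fact gm_ractM xi a b : gm_ract xi (a ** b) = gm_ract (gm_ract xi a) b.
Proof. by apply: gm_ext => e; exact: cmulA. Qed.

Fact gm_ipDr xi eta zeta : gm_ip xi (eta + zeta) = gm_ip xi eta + gm_ip xi zeta.
Proof.
apply: gm_ip_unique.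
rewrite (_ : partial_sum _ = fun F =>
    partial_sum (fun e => inA (adj (xi e) ** eta e)) F +
    partial_sum (fun e => inA (adj (xi e) ** zeta e)) F).
  by apply: cvgD; exact: gm_ip_cvg.
apply/funext => F; rewrite !partial_sumE -big_split.
by apply: eq_bigr => e _; rewrite gmDE cmulDr inAD.
Qed.

Fact gm_ipZr (k : R[i]) xi eta : gm_ip xi (k *: eta) = k *: gm_ip xi eta.
Proof.
apply: gm_ip_unique.
rewrite (_ : partial_sum _ = fun F =>
    k *: partial_sum (fun e => inA (adj (xi e) ** eta e)) F).
  by apply: cvgZr; exact: gm_ip_cvg.
apply/funext => F; rewrite !partial_sumE scaler_sumr.
by apply: eq_bigr => e _; rewrite gmZE -cscaleAr inAZ.
Qed.

Lemma csumr_mul (I : Type) (r : seq I) (F : I -> A) a :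
  (\sum_(i <- r) F i) ** a = \sum_(i <- r) F i ** a.
Proof.
elim: r => [|i r IH]; first by rewrite !big_nil cmul0r.
by rewrite !big_cons cmulDl IH.
Qed.

Fact gm_ip_ract xi eta a : gm_ip xi (gm_ract eta a) = gm_ip xi eta ** a.
Proof.
apply: gm_ip_unique.
rewrite (_ : partial_sum _ = fun F =>
    partial_sum (fun e => inA (adj (xi e) ** eta e)) F ** a).
  by apply: cvg_cmulr; exact: gm_ip_cvg.
apply/funext => F; rewrite !partial_sumE csumr_mul.
by apply: eq_bigr => e _; rewrite /= cmulA inA_mulr.
Qed.

Fact gm_ip_adj xi eta : adj (gm_ip xi eta) = gm_ip eta xi.
Proof.
apply/esym/gm_ip_unique.
rewrite (_ : partial_sum _ = fun F =>
    adj (partial_sum (fun e => inA (adj (xi e) ** eta e)) F)).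
  by apply: cvg_adj; exact: gm_ip_cvg.
apply/funext => F; rewrite !partial_sumE (big_morph _ (@adjD R A) (adj0 A)).
by apply: eq_bigr => e _; rewrite !inA_adjM adjM adjK.
Qed.

Fact gm_ip_pos xi : exists b, gm_ip xi xi = adj b ** b.
Proof. exact: sq_lim_pos (@gm_ip_sq_cvg xi). Qed.

Lemma gm_le_ip xi (F : {fset edge E}) v (t : T v) :
  \sum_(e <- F) `|ev (inA (xi e)) t| ^+ 2 <= `|gm_ip xi xi|.
Proof.
apply: le_trans (sq_le_lim (@gm_ip_sq_cvg xi) F t) _.
apply: le_trans (ev_norm _ t).
by rewrite ger0_norm // (sq_lim_ge0 (@gm_ip_sq_cvg xi)).
Qed.

Lemma gm_le_ip1 xi e (t : T (src e)) : `|C0ev (xi e) t| ^+ 2 <= `|gm_ip xi xi|.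
Proof.
by have := gm_le_ip xi [fset e]%fset t; rewrite big_seq_fset1 inA_at.
Qed.

Fact gm_ip_eq0 xi : gm_ip xi xi = 0 -> xi = 0.
Proof.
move=> x0; apply: gm_ext => e; apply: C0ev_ext => t; apply/eqP.
have := gm_le_ip1 xi t; rewrite x0 normr0 => H.
by rewrite -normr_eq0 -sqrf_eq0 eq_le H exprn_ge0.
Qed.

Fact gm_complete (u : nat -> X) :
  (forall e : R[i], 0 < e -> exists N, forall m n,
    (N <= m)%N -> (N <= n)%N ->
    sqrtC `|gm_ip (u m - u n) (u m - u n)| < e) ->
  exists l, forall e : R[i], 0 < e -> exists N, forall n,
    (N <= n)%N -> sqrtC `|gm_ip (u n - l) (u n - l)| < e.
Proof.
move=> uC.
have uC2 (d : R[i]) : 0 < d -> exists N, forall m n,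
    (N <= m)%N -> (N <= n)%N -> `|gm_ip (u m - u n) (u m - u n)| < d ^+ 2.
  move=> d0; have [N HN] := uC _ d0; exists N => m n Nm Nn.
  by have := HN m n Nm Nn; rewrite sqrtC_lt_sqr ?normr_ge0 // ltW.
have cv e : cvg ((fun n => u n e) @ \oo).
  apply: cauchy_cvg; apply: cauchy_exP => d d0.
  have d20 : 0 < d / 2 by rewrite divr_gt0.
  have [N HN] := uC2 _ d20; exists (u N e); exists N => // n /= Nn.
  rewrite -ball_normE /=; apply: (@le_lt_trans _ _ (d / 2)); last first.
    by rewrite [ltRHS]splitr ltrDl.
  apply: C0_norm_le => [|t]; first exact: ltW.
  rewrite -gmBE -(@ler_pXn2r _ 2) ?nnegrE ?normr_ge0 // ?ltW //.
  by apply: (le_lt_trans (gm_le_ip1 (u N - u n) t)); apply: HN.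
pose l e : Xe e := lim ((fun n => u n e) @ \oo).
have near_l (F : seq (edge E)) (d : R[i]) : 0 < d -> forall N, exists2 n,
    (N <= n)%N & forall e, e \in F -> `|l e - u n e| < d.
  move=> d0 N.
  have : \forall n \near \oo, (N <= n)%N /\
      forall e, e \in F -> `|l e - u n e| < d.
    apply: filterI; first by exists N.
    elim: F => [|e F IH]; first by near=> n.
    have /cvgrPdist_lt/(_ _ d0) := cv e; move: IH; apply: filterS2.
    by move=> n H1 H2 e'; rewrite inE => /predU1P[->|/H1].
  by move=> /filter_ex[n [Nn H]]; exists n.
have lbound (d : R[i]) N : 0 < d -> (forall m n, (N <= m)%N -> (N <= n)%N ->
      `|gm_ip (u m - u n) (u m - u n)| < d ^+ 2) ->
    forall n (F : {fset edge E}) v (t : T v), (N <= n)%N ->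
    \sum_(e <- F) `|ev (inA (u n e - l e)) t| ^+ 2 <= 4%:R * d ^+ 2.
  move=> d0 HN n F v t Nn; pose k : R[i] := (size F).+1%:R.
  have k0 : 0 < k by rewrite ltr0Sn.
  have [m Nm Hm] := near_l F _ (divr_gt0 d0 k0) N.
  have Fl : \sum_(e <- F) `|ev (inA (u m e - l e)) t| ^+ 2 <= d ^+ 2.
    apply: (@le_trans _ _ (\sum_(e <- F) (d / k) ^+ 2)).
      rewrite big_seq [leRHS]big_seq; apply: ler_sum => e eF.
      rewrite lerXn2r ?nnegrE ?normr_ge0 // ?divr_ge0 ?ltW //.
      have [[t' H]|H] := inA_case (src e) t; rewrite H.
        apply: le_lt_trans (C0ev_norm _ _) _.
        by rewrite distrC; exact: Hm.
      by rewrite normr0 divr_gt0.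
    rewrite big_const_seq count_predT iter_addr_0 expr_div_n -mulrnAr.
    rewrite -[leRHS]mulr1 ler_wpM2l ?exprn_ge0 ?ltW //.
    rewrite -mulr_natr mulrC ltr_pdivrMr ?exprn_gt0 // mul1r.
    by rewrite -natrX ltr_nat expnS expn1 leq_pmulr.
  have un : \sum_(e <- F) `|ev (inA (u n e - u m e)) t| ^+ 2 <= d ^+ 2.
    rewrite ltW //; apply: le_lt_trans (HN n m Nn Nm).
    have := gm_le_ip (u n - u m) F t.
    by under eq_bigr do rewrite gmBE.
  apply: (@le_trans _ _ (\sum_(e <- F) 2 * (`|ev (inA (u n e - u m e)) t| ^+ 2
      + `|ev (inA (u m e - l e)) t| ^+ 2))).
    apply: ler_sum => e _.
    have -> : u n e - l e = (u n e - u m e) + (u m e - l e).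
      by rewrite addrA subrK.
    by rewrite inAD evD normD_le_sqr.
  rewrite -mulr_sumr big_split /=.
  have -> : 4%:R * d ^+ 2 = 2 * (d ^+ 2 + d ^+ 2) :> R[i].
    by rewrite mulrDr -mulrDl -natrD.
  by rewrite ler_wpM2l // lerD.
have ls : summable_ip l.
  apply/summable_ipP => e e0.
  have d0 : 0 < sqrtC e / 4%:R by rewrite divr_gt0 ?sqrtC_gt0.
  have e40 : 0 < e / 4%:R by rewrite divr_gt0.
  have dE : 4%:R * (sqrtC e / 4%:R) ^+ 2 = e / 4%:R.
    by rewrite expr_div_n sqrtCK mulrCA expr2 invfM mulVKf ?pnatr_eq0.
  have [N HN] := uC2 _ d0; have /summable_ipP/(_ _ e40)[F HF] := gm_funP (u N).
  exists F => G GF v t.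
  apply: (@le_trans _ _ (\sum_(e <- G) 2 * (`|ev (inA (u N e)) t| ^+ 2
      + `|ev (inA (u N e - l e)) t| ^+ 2))).
    apply: ler_sum => i _.
    rewrite -[X in X <= _](_ : `|ev (inA (u N i)) t
      + - ev (inA (u N i - l i)) t| ^+ 2 = _); last first.
      by rewrite -evN -evD -[- inA _]scaleN1r -inAZ -inAD scaleN1r opprB addrC subrK.
    by rewrite (le_trans (normD_le_sqr _ _)) // normrN.
  rewrite -mulr_sumr big_split /= mulrC -ler_pdivlMr //.
  have -> : e / 2 = e / 4%:R + e / 4%:R.
    by rewrite [LHS]splitr -mulrA -invfM -natrM.
  by rewrite lerD ?HF // -dE (lbound _ N).
exists (GraphModule ls) => e e0.
have d0 : 0 < e / 4%:R by rewrite divr_gt0.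
have [N HN] := uC2 _ d0; exists N => n Nn; rewrite sqrtC_lt_sqr ?normr_ge0 ?(ltW e0) //.
apply: (@le_lt_trans _ _ (4%:R * (e / 4%:R) ^+ 2)).
  apply: (sq_lim_le (@gm_ip_sq_cvg (u n - GraphModule ls))).
    by rewrite mulr_ge0 ?exprn_ge0 ?ltW.
  move=> F v t; under eq_bigr do rewrite gmBE.
  exact: lbound d0 HN _ _ _ _ Nn.
rewrite expr_div_n mulrCA -[ltRHS]mulr1 ltr_pM2l ?exprn_gt0 //.
by rewrite expr2 invfM mulVKf ?pnatr_eq0 // invf_lt1 // ltr1n.
Unshelve. all: by end_near. Qed.

Lemma gm_lactE a xi e t :
  C0ev (gm_lact a xi e) t = ev a (phi t) * C0ev (xi e) t.
Proof. by []. Qed.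

Fact gm_lactD a b xi : gm_lact (a + b) xi = gm_lact a xi + gm_lact b xi.
Proof.
apply: gm_ext => e; apply: C0ev_ext => t.
by rewrite gmDE C0evD !gm_lactE evD mulrDl.
Qed.

Fact gm_lactZ (k : R[i]) a xi : gm_lact (k *: a) xi = k *: gm_lact a xi.
Proof.
apply: gm_ext => e; apply: C0ev_ext => t.
by rewrite gmZE C0evZ !gm_lactE evZ mulrA.
Qed.

Fact gm_lactM a b xi : gm_lact (a ** b) xi = gm_lact a (gm_lact b xi).
Proof.
by apply: gm_ext => e; apply: C0ev_ext => t; rewrite !gm_lactE evM mulrA.
Qed.

Fact gm_lact_adj a xi eta :
  gm_ip (gm_lact a xi) eta = gm_ip xi (gm_lact (adj a) eta).
Proof.
congr (lim (partial_sum _ @ totally)); apply/funext => e; congr inA.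
apply: C0ev_ext => t; rewrite !C0evM !C0ev_adj !gm_lactE ev_adj rmorphM.
by rewrite mulrCA mulrA.
Qed.

Definition graph_correspondence : correspondence A :=
  Correspondence gm_ractDl gm_ractDr gm_ractZl gm_ractZr gm_ractM
    gm_ipDr gm_ipZr gm_ip_ract gm_ip_adj gm_ip_pos gm_ip_eq0 gm_complete
    gm_lactD gm_lactZ gm_lactM gm_lact_adj.

End GraphCorrespondence.

(* Main.v *)
Require Import Defs.
From HB Require Import structures.
From mathcomp Require Import all_boot all_order all_algebra finmap.
From mathcomp Require Import all_classical reals topology normedtype complex.
From mathcomp Require Import sequences summability ring.
Set Implicit Arguments.
Unset Strict Implicit.
Unset Printing Implicit Defensive.
Import Order.TTheory GRing.Theory Num.Theory numFieldNormedType.Exports.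
Local Open Scope classical_set_scope.
Local Open Scope ring_scope.

(** The unit space of the graph algebra is the path space: for every
    Cuntz-Krieger family the range projections [s_mu s_mu^*] of the finite paths
    behave like the indicator functions of the cylinder sets of the paths that
    start with [mu]. So a continuous function [f] on [T] defines, through
    [f o Phi], an element [pi'(f)] of C*(E), and setting
    [psi'(xi) = sum_e s_e pi'(xi_e)] gives a covariant representation of [X],
    hence a map O_X -> C*(E). Conversely the elements [pi(1_v)] and [psi(1_e)] of
    O_X form a Cuntz-Krieger family, hence a map C*(E) -> O_X. The two maps are
    inverse to each other on generators.

    The spaces [T v] are compact, being images of the compact spaces of paths with
    range [v] ([T_compact]), so there are units [1_v] in the coefficient algebra
    and [1_e] in [X]. The hypothesis on [Phi] is used a second time in
    [oscillation_induction]: for [f] in [A] and long paths [mu], the function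
    [f o phi_mu] is almost constant, because its values are values of [f o Phi] on
    the cylinder set of [mu]. Covariance gives
    [pi(f) = sum_(r(e) = v) s_e pi(f o phi_e) s_e^*] on functions supported on
    [T v]; iterating this, [f] only enters through functions that are almost
    constant. This determines [pi] from the Cuntz-Krieger family ([coef_unique]),
    and it makes the Riemann sums [cylinder_sum] converge, which constructs [pi']
    from the family ([coef_rep]).

    Three facts on C*-algebras are needed and are obtained without spectral
    theory. *-homomorphisms are contractive ([star_hom_norm]); projections whose
    sum is a projection are orthogonal ([proj_sum_orthogonal]), so that the ranges
    of the [s_e] are orthogonal; and a Toeplitz representation induces a
    homomorphism on the compact operators ([induced_hom_exists]), because the norm
    of [sum_i psi(x_i) psi(y_i)^*] is at most the norm of the corresponding
    operator on [X] ([rank_sum_norm]). They rest on two devices: the norm of a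
    self-adjoint [c] is governed by the growth of the norms of its powers
    ([selfadj_norm_le]), and [|u|^2 <= |u^2 + v^2|] for commuting self-adjoint [u]
    and [v], as [u + i v] is normal with square [u^2 + v^2] ([re_im_norm]). There
    is no unit, so [1 - z] always stands for the operator [c |-> c - z c]. *)

(** * Limits and orders in the complex numbers *)

Section ComplexReals.
Variable R : realType.
Implicit Types x y m e : R[i].

Lemma ge0_cmp x y : 0 <= x -> 0 <= y -> x <= y \/ y < x.
Proof.
move=> x0 y0; have [|H] := boolP (x <= y); [by left|right].
by rewrite real_ltNge // ger0_real.
Qed.

Lemma expr_lt x e : 0 <= x -> x < 1 -> 0 < e ->
  exists N, forall n, (N <= n)%N -> x ^+ n < e.
Proof.
move=> x0 x1 e0; have xE := ge0_ReK x0; have eE := ge0_ReK (ltW e0).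
set r := complex.Re x in xE; set d := complex.Re e in eE.
have r0 : 0 <= r by rewrite -lecR xE.
have r1 : `|r| < 1 by rewrite ger0_norm // -ltcR xE.
have d0 : 0 < d by rewrite -ltcR eE.
have /cvgrPdist_lt/(_ _ d0)[N _ HN] := cvg_expr r1.
exists N => n Nn; rewrite -xE -eE -rmorphXn ltcR.
by have := HN n Nn; rewrite /= sub0r normrN ger0_norm // exprn_ge0.
Qed.

(** A constant factor disappears after taking roots of order [2 ^ k]. *)
Lemma expr_root_le x m C : 0 <= x -> 0 <= m -> 0 <= C ->
  (forall k, x ^+ (2 ^ k) <= C * m ^+ (2 ^ k).-1) -> x <= m.
Proof.
move=> x0 m0 C0 H; have [//|mx] := ge0_cmp x0 m0.
have xp : 0 < x by apply: le_lt_trans mx.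
have C1 : 0 < C + 1 by rewrite ltr_wpDl.
have mx1 : m / x < 1 by rewrite ltr_pdivrMr // mul1r.
have [N HN] := expr_lt (divr_ge0 m0 x0) mx1 (divr_gt0 xp C1).
have kN : (N <= (2 ^ N).-1)%N by rewrite -ltnS prednK ?expn_gt0 // ltn_expl.
have := HN _ kN; rewrite ltr_pdivlMr // mulrC => small.
have := H N; rewrite -{1}(prednK (n := 2 ^ N)) ?expn_gt0 // exprS.
rewrite -ler_pdivlMr ?exprn_gt0 // -mulrA -expr_div_n => xC.
have : x <= (C + 1) * (m / x) ^+ (2 ^ N).-1.
  by rewrite (le_trans xC) // ler_wpM2r ?exprn_ge0 ?divr_ge0 // lerDl.
by move=> /le_lt_trans/(_ small); rewrite ltxx.
Qed.

Lemma le_addgt0 x y : 0 <= x -> 0 <= y ->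
  (forall e : R[i], 0 < e -> x <= y + e) -> x <= y.
Proof.
by move=> x0 y0 H; apply: lec_addgt0P => // e e0; rewrite addrC H.
Qed.

Lemma norm_lim0 (V : normedModType R[i]) (v : V) :
  (forall e : R[i], 0 < e -> `|v| <= e) -> v = 0.
Proof.
move=> H; apply/eqP; rewrite -normr_le0; apply: le_addgt0 => // e e0.
by rewrite add0r H.
Qed.

End ComplexReals.

(** * Norms in C*-algebras *)

Section CStarNorms.
Variables (R : realType) (A : cstarType R).
Implicit Types a b c h x y z q : A.

Lemma norm_le_of_sq a (M : R[i]) : 0 <= M -> `|adj a ** a| <= M ^+ 2 -> `|a| <= M.
Proof. by move=> M0; rewrite cnorm_adj ler_pXn2r ?nnegrE. Qed.

Lemma csumMl (I : Type) (r : seq I) (P : pred I) (F : I -> A) a :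
  a ** (\sum_(i <- r | P i) F i) = \sum_(i <- r | P i) a ** F i.
Proof. exact: (big_morph _ (@cmulDr _ _ a) (cmulr0 a)). Qed.

Lemma csumMr (I : Type) (r : seq I) (P : pred I) (F : I -> A) a :
  (\sum_(i <- r | P i) F i) ** a = \sum_(i <- r | P i) F i ** a.
Proof.
by apply: (big_morph (fun x => x ** a)) => [x y|]; [rewrite cmulDl|rewrite cmul0r].
Qed.

Lemma adj_sum (I : Type) (r : seq I) (P : pred I) (F : I -> A) :
  adj (\sum_(i <- r | P i) F i) = \sum_(i <- r | P i) adj (F i).
Proof. exact: (big_morph _ (@adjD _ _) (adj0 _)). Qed.

Lemma cvg_cmul (I : Type) (F : set_system I) (f g : I -> A) a b : ProperFilter F ->
  f @ F --> a -> g @ F --> b -> (fun i => f i ** g i) @ F --> a ** b.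
Proof.
move=> FF fa gb.
have H0 : (fun i => (f i - a) ** (g i - b)) @ F --> (0 : A).
  apply/cvgrPdist_lt => e e0.
  have e1 : 0 < sqrtC e by rewrite sqrtC_gt0.
  move/cvgrPdist_lt: fa => /(_ _ e1) fa; move/cvgrPdist_lt: gb => /(_ _ e1) gb.
  apply: filterS2 fa gb => i fi gi; rewrite sub0r normrN.
  apply: le_lt_trans (cnormM _ _) _.
  by rewrite -[e]sqrtCK expr2 ltr_pM // distrC.
have H1 : (fun i => f i ** b) @ F --> a ** b by exact: cvg_cmulr.
have H2 : (fun i => a ** g i) @ F --> a ** b.
  rewrite -[a ** b]adjK adjM (_ : (fun i => _) = fun i => adj (adj (g i) ** adj a)).
    by apply: cvg_adj; apply: cvg_cmulr; apply: cvg_adj.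
  by apply/funext => i; rewrite adjM !adjK.
rewrite (_ : (fun i => f i ** g i) =
  (fun i => (f i - a) ** (g i - b) + (f i ** b + a ** g i - a ** b))).
  rewrite -[a ** b in X in _ --> X](_ : 0 + (a ** b + a ** b - a ** b) = _).
    by apply: cvgD => //; apply: cvgB; [apply: cvgD|exact: cvg_cst].
  by rewrite add0r addrK.
apply/funext => i; rewrite cmulrBl !cmulrBr opprB addrA.
by rewrite -[LHS](subrK (f i ** b)) -addrA [in RHS]addrACA [X in _ = _ + X]addrC
  !addrA !subrK addrK.
Qed.

Lemma cvg_sum_seq (I J : Type) (F : set_system I) (r : seq J) (f : J -> I -> A)
    (l : J -> A) : ProperFilter F -> (forall j, f j @ F --> l j) ->
  (fun i => \sum_(j <- r) f j i) @ F --> \sum_(j <- r) l j.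
Proof.
move=> FF fl; elim: r => [|j r IH].
  rewrite big_nil (_ : (fun i => _) = fun=> 0); first exact: cvg_cst.
  by apply/funext => i; rewrite big_nil.
rewrite big_cons (_ : (fun i => _) = fun i => f j i + \sum_(j <- r) f j i).
  by apply: cvgD; [exact: fl|exact: IH].
by apply/funext => i; rewrite big_cons.
Qed.

Lemma cvg_ext_unique (I : Type) (F : set_system I) (f g : I -> A) a b :
  ProperFilter F -> f @ F --> a -> g @ F --> b -> (forall i, f i = g i) -> a = b.
Proof.
move=> FF fa gb fg; rewrite (_ : f = g) in fa; last exact/funext.
exact: (cvg_unique (@norm_hausdorff _ A) fa gb).
Qed.

Lemma norm_lim_le (I : Type) (F : set_system I) (f : I -> A) a (M : R[i]) :
  ProperFilter F -> 0 <= M -> f @ F --> a -> (forall i, `|f i| <= M) -> `|a| <= M.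
Proof.
move=> FF M0 /cvgrPdist_lt fa fM; apply: le_addgt0 => // e /fa/filter_ex[i ai].
rewrite -[a](subrK (f i)) addrC (le_trans (ler_normD _ _)) //.
by rewrite lerD // ltW.
Qed.

(** [cpow c n] is the power with exponent [n + 1]; there is no unit to start from. *)
Definition cpow c n := iter n (cmul c) c.

Lemma cpowS c n : cpow c n.+1 = c ** cpow c n. Proof. by []. Qed.

Lemma cpowM c m n : cpow c m ** cpow c n = cpow c (m + n).+1.
Proof.
by elim: m => [//|m IH]; rewrite cpowS -cmulA IH.
Qed.

Lemma adj_cpow c n : adj c = c -> adj (cpow c n) = cpow c n.
Proof.
move=> cc; elim: n => [|n IH] //=; rewrite adjM IH cc.
by rewrite -[c in LHS]/(cpow c 0) cpowM addn0.
Qed.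

Lemma norm_cpow2 c k : adj c = c -> `|cpow c (2 ^ k).-1| = `|c| ^+ (2 ^ k).
Proof.
move=> cc; elim: k => [|k IH]; first by rewrite expr1.
have -> : (2 ^ k.+1).-1 = ((2 ^ k).-1 + (2 ^ k).-1).+1.
  rewrite expnS mul2n -addnn; have : (0 < 2 ^ k)%N by rewrite expn_gt0.
  by case: (2 ^ k)%N => // m _; rewrite addSn addnS.
by rewrite -cpowM -{1}(adj_cpow _ cc) cnorm_adj IH -exprM mulnC expnS.
Qed.

(** By the C*-identity [|c^(2^k)| = |c|^(2^k)], so a bound on the powers up to a
    constant factor bounds [|c|]. *)
Lemma selfadj_norm_le c (m C : R[i]) : adj c = c -> 0 <= m -> 0 <= C ->
  (forall n, `|cpow c n| <= C * m ^+ n) -> `|c| <= m.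
Proof.
move=> cc m0 C0 H; apply: (expr_root_le (C := C)) => // k.
by rewrite -norm_cpow2.
Qed.

(** The powers of [sum_i F_i^* F_i] are the sums of the powers of the [F_i^* F_i],
    so the number of terms is only a constant factor in the growth of their norms. *)
Lemma norm_orth_sum (I : eqType) (r : seq I) (F : I -> A) (M : R[i]) :
  uniq r -> 0 <= M -> (forall i, i \in r -> `|F i| <= M) ->
  (forall i j, i \in r -> j \in r -> i != j ->
    adj (F i) ** F j = 0 /\ F i ** adj (F j) = 0) ->
  `|\sum_(i <- r) F i| <= M.
Proof.
move=> ur M0 FM orth; apply: norm_le_of_sq => //.
have sumM (G H : I -> A) :
    (forall i j, i \in r -> j \in r -> i != j -> G i ** H j = 0) ->
    (\sum_(i <- r) G i) ** (\sum_(i <- r) H i) = \sum_(i <- r) G i ** H i.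
  move=> GH; rewrite csumMr [LHS]big_seq [RHS]big_seq; apply: eq_bigr => i ir.
  rewrite csumMl (bigD1_seq i) //= big_seq_cond big1 ?addr0 // => j /andP[jr ji].
  by rewrite GH // eq_sym.
rewrite adj_sum sumM; last by move=> i j ir jr ij; have [] := orth i j ir jr ij.
pose b i := adj (F i) ** F i.
have bb i : adj (b i) = b i by rewrite /b adjM adjK.
have borth i j : i \in r -> j \in r -> i != j -> b i ** b j = 0.
  move=> ir jr ij; rewrite /b -cmulA [F i ** _]cmulA.
  by have [_ ->] := orth i j ir jr ij; rewrite cmul0r cmulr0.
have powE n : cpow (\sum_(i <- r) b i) n = \sum_(i <- r) cpow (b i) n.
  elim: n => [//|n IH]; rewrite cpowS IH sumM // => i j ir jr ij.
  by case: n {IH} => [|n]; [exact: borth|rewrite cpowS cmulA borth ?cmul0r].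
apply: (@selfadj_norm_le _ _ ((size r)%:R * M ^+ 2)).
- by rewrite adj_sum; apply: eq_bigr => i _; exact: bb.
- by rewrite exprn_ge0.
- by rewrite mulr_ge0 ?exprn_ge0.
move=> n; rewrite powE (le_trans (ler_norm_sum _ _ _)) //.
apply: (@le_trans _ _ (\sum_(i <- r) M ^+ 2 * (M ^+ 2) ^+ n)); last first.
  by rewrite big_const_seq count_predT iter_addr_0 -mulrA mulr_natl.
rewrite big_seq [leRHS]big_seq; apply: ler_sum => i ir.
have bM : `|b i| <= M ^+ 2 by rewrite cnorm_adj lerXn2r ?nnegrE ?FM.
elim: n {powE} => [|n IH]; first by rewrite expr0 mulr1.
rewrite cpowS (le_trans (cnormM _ _)) // (exprS (M ^+ 2)).
by rewrite ler_pM.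
Qed.

(** A square root of [1 - h], written [1 - z] since there is no unit. It is the
    fixed point of the contraction [z |-> (h + z ^ 2) / 2]. *)
Lemma sqrt_one_sub h : adj h = h -> `|h| < 1 ->
  exists z, [/\ adj z = z, z + z = h + z ** z &
    forall x, x ** h = h ** x -> x ** z = z ** x].
Proof.
move=> hh h1; set b := `|h|; have b0 : 0 <= b by exact: normr_ge0.
pose f u := 2^-1 *: (h + u ** u).
pose u n := iter n f 0.
have uS n : u n.+1 = 2^-1 *: (h + u n ** u n) by [].
have n2 : `|2^-1 : R[i]| = 2^-1 by rewrite ger0_norm // invr_ge0.
have ub n : `|u n| <= b.
  elim: n => [|n IH]; first by rewrite normr0.
  rewrite uS normrZ n2 mulrC ler_pdivrMr // mulrDr mulr1.
  rewrite (le_trans (ler_normD _ _)) // lerD //.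
  rewrite (le_trans (cnormM _ _)) // -[leRHS]mulr1 ler_pM //.
  by rewrite (le_trans IH) // ltW.
have uu n : adj (u n) = u n.
  elim: n => [|n IH]; first by rewrite adj0.
  by rewrite uS Defs.adjZ adjD adjM hh IH geC0_conj // invr_ge0.
have uc n x : x ** h = h ** x -> x ** u n = u n ** x.
  move=> xh; elim: n => [|n IH]; first by rewrite cmulr0 cmul0r.
  rewrite uS -cscaleAr -cscaleAl cmulDr cmulDl xh.
  by rewrite cmulA IH -cmulA IH cmulA.
have uk n k : `|u (n + k)%N - u n| <= b ^+ n * b.
  elim: n => [|n IH]; first by rewrite add0n subr0 expr0 mul1r.
  rewrite addSn !uS -scalerBr opprD addrACA subrr add0r.
  have -> : u (n + k)%N ** u (n + k)%N - u n ** u n =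
    u (n + k)%N ** (u (n + k)%N - u n) + (u (n + k)%N - u n) ** u n.
    by rewrite cmulrBr cmulrBl addrA subrK.
  rewrite normrZ n2 mulrC ler_pdivrMr // mulrDr mulr1.
  rewrite (le_trans (ler_normD _ _)) // exprS -mulrA lerD //.
    by rewrite (le_trans (cnormM _ _)) // ler_pM.
  by rewrite (le_trans (cnormM _ _)) // mulrC ler_pM.
have cu : cvg (u @ \oo).
  apply: cauchy_cvg; apply: cauchy_exP => e e0.
  have [N HN] := expr_lt b0 h1 e0; exists (u N), N => // n /= Nn.
  rewrite -ball_normE /= distrC -(subnKC Nn); apply: le_lt_trans (uk _ _) _.
  apply: le_lt_trans (HN N (leqnn N)).
  by rewrite -[leRHS]mulr1 ler_wpM2l ?exprn_ge0 // ltW.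
have /cvg_ex[z uz] := cu.
have hA : hausdorff_space A by exact: norm_hausdorff.
exists z; split.
- apply: (cvg_unique hA _ uz).
  rewrite [X in X @ _](_ : u = fun n => adj (u n)); first exact: cvg_adj.
  by apply/funext => n; rewrite uu.
- have u1 : (fun n => u n.+1) @ \oo --> z by move: (uz); rewrite -(cvg_shiftS u).
  have u2 : (fun n => u n.+1) @ \oo --> f z.
    rewrite /u; apply: cvgZl_tmp; apply: cvgD; first exact: cvg_cst.
    exact: cvg_cmul.
  have zE := cvg_unique hA u1 u2.
  rewrite {1 2}zE /f -scalerDl -[2^-1]mul1r -mulrDl.
  by rewrite divff ?scale1r // -[1 + 1]/(2%:R) pnatr_eq0.
move=> x xh; apply: (cvg_unique hA (cvg_cmul _ (cvg_cst x) uz)).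
rewrite (_ : (fun i => _) = fun i => u i ** x); last by apply/funext => i; rewrite uc.
exact: cvg_cmulr.
Qed.

End CStarNorms.

(** * Projections with orthogonal ranges *)

Section RealImaginaryParts.
Variables (R : realType) (A : cstarType R).
Implicit Types (c d e q u v w x y z : A) (t : R[i]).

(** [x + i y] and [x - i y] both have square [d^* d], hence norm [|d|], and [x]
    and [y] are their averages. For commuting self-adjoint [u] and [v] this is
    [|u|^2 <= |u^2 + v^2|], a substitute for positivity. *)
Lemma re_im_norm x y d : adj x ** y = adj y ** x ->
  adj x ** x + adj y ** y = adj d ** d -> `|x| <= `|d| /\ `|y| <= `|d|.
Proof.
move=> xy xyd.
have sqE (k : R[i]) : k ^* = - k -> k * k = -1 -> `|x + k *: y| = `|d|.
  move=> kc kk; apply: (pexpIrn (n := 2)) => //; rewrite ?nnegrE //.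
  rewrite -!cnorm_adj; congr `|_|; rewrite adjD Defs.adjZ kc cmulDl !cmulDr.
  rewrite -!cscaleAr -!cscaleAl !scalerA ?mulNr ?mulrN kk opprK scale1r xy -xyd.
  by rewrite scaleNr addrA addrK.
have ii : 'i * 'i = -1 :> R[i] by rewrite -expr2 sqrCi.
have X1 := sqE 'i (conjCi _) ii.
have X2 : `|x - 'i *: y| = `|d|.
  by rewrite -scaleNr; apply: sqE; rewrite ?rmorphN /= ?conjCi // mulrNN.
have half w : `|w + w| <= `|d| + `|d| -> `|w| <= `|d|.
  by rewrite -!mulr2n normrMn ler_pMn2r.
split; apply: half.
  rewrite -{1}X1 -X2; apply: le_trans (ler_normD _ _).
  by rewrite addrACA subrr addr0.
have <- : `|'i *: (y + y)| = `|y + y|.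
  by rewrite normrZ normCi mul1r.
rewrite -{1}X1 -X2; apply: le_trans (ler_normB _ _).
by rewrite opprB [x + _]addrC addrACA subrr addr0 scalerDr.
Qed.

Lemma proj_norm q c : q ** q = q -> adj q = q -> `|q ** c| <= `|c|.
Proof.
move=> qq qa; have [->|qc] := eqVneq (q ** c) 0; first by rewrite normr0.
have qc0 : 0 < `|q ** c| by rewrite normr_gt0.
rewrite -(ler_pM2r qc0) -expr2 -cnorm_adj adjM qa -!cmulA (cmulA q q c) qq.
by rewrite (le_trans (cnormM _ _)) // norm_adj.
Qed.

Lemma projC_norm q c : q ** q = q -> adj q = q -> `|c - q ** c| <= `|c|.
Proof.
move=> qq qa; have [->|qc] := eqVneq (c - q ** c) 0; first by rewrite normr0.
have qc0 : 0 < `|c - q ** c| by rewrite normr_gt0.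
rewrite -(ler_pM2r qc0) -expr2 -cnorm_adj adjB adjM qa cmulrBl.
rewrite -[(adj c ** q) ** _]cmulA [q ** (_ - _)]cmulrBr (cmulA q q c) qq subrr.
by rewrite cmulr0 subr0 (le_trans (cnormM _ _)) // norm_adj.
Qed.

Section Corner.
Variable e : A.
Hypothesis ea : adj e = e.

(** [1 + v^2] is a contraction on the right ideal [e A]. *)
Definition corner_contraction v :=
  forall c, e ** c = c -> `|c + v ** (v ** c)| <= `|c|.

(** [(1 + v^2)^2 = (1 - v^2)^2 + (2v)^2]. *)
Lemma corner_contraction_half v : e ** v = v -> adj v = v ->
  corner_contraction v -> `|v| <= 2^-1.
Proof.
move=> ev va con; have [->|v0] := eqVneq v 0; first by rewrite normr0 invr_ge0.
have vv0 : 0 < `|v| by rewrite normr_gt0.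
pose g := v ** v; have ga : adj g = g by rewrite adjM va.
have vg : v ** g = g ** v by rewrite cmulA.
have gva : adj (g ** v) = g ** v by rewrite adjM va ga.
have gvg : g ** v ** g = g ** (g ** v) by rewrite -cmulA vg.
have gvv : g ** v ** v = g ** g by rewrite -cmulA.
have vgv : v ** (g ** v) = g ** g by rewrite cmulA vg gvv.
have [] := @re_im_norm (v - g ** v) (g + g) (v + g ** v).
- rewrite adjB adjD va ga gva cmulDr cmulDl.
  by rewrite cmulrBl cmulrBr vg gvg.
- rewrite adjB !adjD va ga gva !cmulrBl !cmulrBr !cmulDl !cmulDr gvv vgv -/g.
  set k := g ** v ** (g ** v); set b := g ** g; rewrite opprB.
  by rewrite [LHS]addrACA !addrA !subrK -addrA [k + b]addrC addrA.
have -> : v + g ** v = v + v ** (v ** v) by rewrite cmulA.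
move=> _ /le_trans/(_ (con v ev)); rewrite -mulr2n normrMn.
have -> : `|g| = `|v| * `|v| by rewrite /g -{1}va cnorm_adj expr2.
rewrite -[_ * _ *+ 2]mulr_natl mulrA -ler_pdivlMr // divff ?gt_eqF // mulrC.
by rewrite -ler_pdivlMr // mul1r.
Qed.

(** As [|2 v^2| < 1], there is a square root [1 - z] of [1 + 2 v^2]. Then
    [(1 - z)^2 + v^4 = (1 + v^2)^2], so [1 - z] and its square are contractions. *)
Lemma corner_contractionZ v : e ** v = v -> adj v = v ->
  corner_contraction v -> corner_contraction (sqrtC 2 *: v).
Proof.
move=> ev va con c ec.
have ve : v ** e = v by rewrite -[in LHS]va -[in RHS]va -[in RHS]ev adjM ea.
have vn := corner_contraction_half ev va con.
have [g gE0] : exists g, g = v ** v by exists (v ** v).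
have ga : adj g = g by rewrite gE0 adjM va.
pose h := - (g + g).
have ha : adj h = h by rewrite adjN adjD ga.
have h1 : `|h| < 1.
  rewrite /h gE0 normrN -mulr2n normrMn -{1}va cnorm_adj -mulr_natl -ltr_pdivlMl //.
  rewrite mulr1; apply: (@le_lt_trans _ _ (2^-1 ^+ 2)).
    by rewrite ler_pXn2r ?nnegrE ?normr_ge0 ?invr_ge0.
  by rewrite expr2 -[ltRHS]mul1r ltr_pM2r ?invr_gt0 // invf_lt1 // ltr1n.
have [z [za zE zcomm]] := sqrt_one_sub ha h1.
have gE x : v ** (v ** x) = g ** x by rewrite gE0 cmulA.
have comm x : x ** g = g ** x -> x ** z = z ** x.
  by move=> xg; apply: zcomm; rewrite cmulrN cmulNr cmulDl cmulDr xg.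
have gz : g ** z = z ** g by exact: comm.
have ez : e ** z = z ** e by apply: comm; rewrite gE0 cmulA ev -cmulA ve.
have root x : e ** x = x -> `|x - z ** x| <= `|x|.
  move=> ex; apply: le_trans (con x ex).
  have [] // := @re_im_norm (x - z ** x) (g ** x) (x + v ** (v ** x)).
    rewrite adjB (adjM z x) (adjM g x) za ga cmulrBl -!cmulA !cmulrBr; congr (_ - _).
    by rewrite (cmulA g z) gz -cmulA.
  rewrite gE adjB adjD (adjM z x) (adjM g x) za ga.
  rewrite !cmulrBl !cmulrBr !cmulDl !cmulDr -!cmulA.
  have -> : adj x ** (z ** (z ** x)) = adj x ** (g ** x) + adj x ** (g ** x) +
      adj x ** (z ** x) + adj x ** (z ** x).
    rewrite (cmulA z z) -[z ** z](addKr h) -zE /h opprK !cmulDl !cmulDr.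
    by rewrite !addrA.
  set a := adj x ** (z ** x); set b := adj x ** (g ** x).
  by rewrite opprB !addrA addrK !(addrAC _ (- a) b) subrK.
have ez' : e ** (c - z ** c) = c - z ** c.
  by rewrite cmulrBr cmulA ez -cmulA !ec.
have := le_trans (root _ ez') (root _ ec).
apply: le_trans; rewrite le_eqVlt; apply/orP; left; apply/eqP; congr `|_|.
rewrite cmulrBr opprB -addrA.
have -> : z ** (z ** c) = z ** c + z ** c + g ** c + g ** c.
  rewrite (cmulA z z) -[z ** z](addKr h) -zE /h opprK !cmulDl.
  by rewrite [LHS]addrC !addrA.
rewrite -!cscaleAl -cscaleAr scalerA -expr2 sqrtCK gE scaler_nat mulr2n.
rewrite -!addrA; congr (_ + _); rewrite !addrA addNr add0r.
by rewrite -[X in X - _]addrA addrAC subrr add0r.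
Qed.

(** The two preceding lemmas apply to all [sqrt 2 ^ n v]. *)
Lemma corner_contraction0 v : e ** v = v -> adj v = v ->
  corner_contraction v -> v = 0.
Proof.
move=> ev va con; set r : R[i] := sqrtC 2.
have r0 : 0 <= r by rewrite sqrtC_ge0.
have r1 : 1 < r by rewrite -(@ltr_pXn2r _ 2) ?nnegrE // sqrtCK expr1n ltr1n.
have rp : 0 < r by exact: lt_trans r1.
have H n : [/\ e ** (r ^+ n *: v) = r ^+ n *: v, adj (r ^+ n *: v) = r ^+ n *: v
    & corner_contraction (r ^+ n *: v)].
  elim: n => [|n [IH1 IH2 IH3]]; first by rewrite expr0 scale1r.
  rewrite exprS -scalerA; split.
  - by rewrite -cscaleAr IH1.
  - by rewrite Defs.adjZ IH2 geC0_conj.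
  - exact: corner_contractionZ.
apply: norm_lim0 => d d0.
have ri : r^-1 < 1 by rewrite invf_lt1.
have ri0 : 0 <= r^-1 by rewrite invr_ge0.
have [N HN] := expr_lt ri0 ri d0.
have [h1 h2 h3] := H N; have := corner_contraction_half h1 h2 h3.
rewrite normrZ ger0_norm ?exprn_ge0 // -ler_pdivlMl ?exprn_gt0 // -exprVn.
move=> /le_trans; apply; apply: le_trans (ltW (HN N (leqnn _))).
by rewrite -[leRHS]mulr1 ler_wpM2l ?exprn_ge0 // invf_le1 // ler1n.
Qed.

End Corner.

(** In the corner of [q j], whose unit is written 1, let [u i] be the compression
    of [q i]. Then [|1 - u i| <= 1], and [1 + sum_(i != j) u i] is the compression
    of the projection [sum_i q i], hence a contraction too. Adding the
    [1 - u i] for [i] other than [j] and [k] bounds [N + u k] by [N], and with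
    [v = u k / N] both [1 + v] and [1 - v] are contractions. So is their average
    of squares [1 + v^2], and [v = 0]. *)
Lemma proj_sum_orthogonal (I : eqType) (r : seq I) (q : I -> A) j k :
  uniq r -> (forall i, i \in r -> q i ** q i = q i /\ adj (q i) = q i) ->
  (\sum_(i <- r) q i) ** (\sum_(i <- r) q i) = \sum_(i <- r) q i ->
  j \in r -> k \in r -> j != k -> q j ** q k = 0.
Proof.
move=> ur qP pp jr kr jk.
have [qj qja] := qP j jr; have [qk qka] := qP k kr.
pose u i c := q j ** (q i ** (q j ** c)).
have u1 i c : i \in r -> q j ** c = c -> `|c - u i c| <= `|c|.
  move=> ir jc; have [qi qia] := qP i ir.
  rewrite /u jc -{1}jc -cmulrBr (le_trans (proj_norm _ qj qja)) //.
  exact: projC_norm.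
have ub c : q j ** c = c -> `|c + \sum_(i <- r | i != j) u i c| <= `|c|.
  move=> jc; have -> : c + \sum_(i <- r | i != j) u i c =
      q j ** ((\sum_(i <- r) q i) ** (q j ** c)).
    rewrite csumMr csumMl (bigD1_seq j) //=; congr (_ + _).
    by rewrite jc jc jc.
  rewrite (le_trans (proj_norm _ qj qja)) // jc proj_norm //.
  rewrite adj_sum big_seq [RHS]big_seq; apply: eq_bigr => i ir.
  by have [] := qP i ir.
pose s := [seq i <- [seq i <- r | i != j] | i != k].
pose N : R[i] := (size s).+1%:R.
have N0 : 0 < N by rewrite ltr0Sn.
have Nu c : q j ** c = c -> `|N *: c + u k c| <= N * `|c|.
  move=> jc.
  have -> : N *: c + u k c =
      (c + \sum_(i <- r | i != j) u i c) + \sum_(i <- s) (c - u i c).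
    rewrite sumrB big_const_seq count_predT iter_addr_0 /N -natr1 scalerDl scale1r.
    rewrite scaler_nat -[\sum_(i <- r | _) _]big_filter (bigD1_seq k) /=; first last.
    - exact: filter_uniq.
    - by rewrite mem_filter eq_sym jk.
    rewrite -[\sum_(i <- _ | _) _]big_filter -/s; set S := \sum_(i <- s) _.
    by rewrite [c + (_ + _)]addrA [RHS]addrACA subrr addr0 [RHS]addrC addrA.
  rewrite (le_trans (ler_normD _ _)) // /N -nat1r mulrDl mul1r lerD ?ub //.
  rewrite (le_trans (ler_norm_sum _ _ _)) //.
  apply: (@le_trans _ _ (\sum_(i <- s) `|c|)).
    rewrite big_seq [leRHS]big_seq; apply: ler_sum => i.
    by rewrite !mem_filter => /and3P[_ _ ir]; exact: u1.
  by rewrite big_const_seq count_predT iter_addr_0 mulr_natl.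
pose v := N^-1 *: (q j ** (q k ** q j)).
have uE c : u k c = N *: (v ** c).
  by rewrite /v -cscaleAl scalerA divff ?gt_eqF // scale1r /u !cmulA.
have va : adj v = v.
  by rewrite Defs.adjZ !adjM qja qka -cmulA geC0_conj // invr_ge0 ltW.
have ev : q j ** v = v by rewrite -cscaleAr cmulA qj.
have vp c : q j ** c = c -> `|c + v ** c| <= `|c|.
  move=> jc; rewrite -(ler_pM2l N0); apply: le_trans (Nu c jc).
  by rewrite uE -scalerDr normrZ gtr0_norm.
have vm c : q j ** c = c -> `|c - v ** c| <= `|c|.
  move=> jc; rewrite -(ler_pM2l N0) -[X in X * `|c - _|]gtr0_norm // -normrZ.
  rewrite scalerBr -uE /N -nat1r scalerDl scale1r addrAC mulrDl mul1r.
  by rewrite (le_trans (ler_normD _ _)) // lerD ?u1 // normrZ ger0_norm.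
have v0 : v = 0.
  apply: (corner_contraction0 (e := q j)) => // c jc.
  have jvc : q j ** (v ** c) = v ** c by rewrite cmulA ev.
  have jp : q j ** (c + v ** c) = c + v ** c by rewrite cmulDr jc jvc.
  have jm : q j ** (c - v ** c) = c - v ** c by rewrite cmulrBr jc jvc.
  have P := le_trans (vp _ jp) (vp _ jc); have M := le_trans (vm _ jm) (vm _ jc).
  rewrite -(@ler_pMn2r _ 2) // -normrMn mulr2n [leRHS]mulr2n.
  apply: le_trans (lerD P M); apply: le_trans (ler_normD _ _).
  rewrite cmulDr cmulrBr opprB !addrA le_eqVlt; apply/orP; left; apply/eqP.
  congr `|_|; set x := v ** c; set y := v ** _.
  by rewrite [RHS]addrAC !(addrAC _ x y) !(addrAC _ x c) !addrK.
have jkj : q j ** (q k ** q j) = 0.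
  apply/eqP; move/eqP: v0; rewrite /v scaler_eq0 invr_eq0 gt_eqF //.
have kj : q k ** q j = 0.
  apply/eqP; rewrite -normr_eq0 -sqrf_eq0 -cnorm_adj adjM qja qka.
  by rewrite cmulA -(cmulA (q j)) qk -cmulA jkj normr0.
by rewrite -[LHS]adjK adjM qja qka kj adj0.
Qed.

End RealImaginaryParts.

(** * *-homomorphisms *)

Section StarHomTheory.
Variables (R : realType) (A B : cstarType R) (f : A -> B).
Hypothesis Hf : star_hom f.

Lemma star_homD a b : f (a + b) = f a + f b.
Proof. by have := star_hom_linear Hf 1 a b; rewrite !scale1r. Qed.

Lemma star_hom0 : f 0 = 0.
Proof. by apply: (addrI (f 0)); rewrite -star_homD !addr0. Qed.

Lemma star_homZ (k : R[i]) a : f (k *: a) = k *: f a.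
Proof. by have := star_hom_linear Hf k a 0; rewrite star_hom0 !addr0. Qed.

Lemma star_homB a b : f (a - b) = f a - f b.
Proof. by rewrite star_homD -scaleN1r star_homZ scaleN1r. Qed.

Lemma star_hom_sum (I : Type) (r : seq I) (P : pred I) (F : I -> A) :
  f (\sum_(i <- r | P i) F i) = \sum_(i <- r | P i) f (F i).
Proof. exact: (big_morph _ star_homD star_hom0). Qed.

(** For self-adjoint [b] of norm below 1, let [b^2 = 1 - (1 - z)^2]; then
    [f b + i (1 - f z)] is formally a unitary. *)
Lemma star_hom_selfadj b : adj b = b -> `|b| < 1 -> `|f b| <= 1.
Proof.
move=> ba b1; set h := b ** b.
have ha : adj h = h by rewrite adjM ba.
have h1 : `|h| < 1 by rewrite /h -{1}ba cnorm_adj expr_lt1.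
have [z [za zE zcomm]] := sqrt_one_sub ha h1.
have bz : b ** z = z ** b by apply: zcomm; rewrite cmulA.
set u := f b; set w := f z.
have ua : adj u = u by rewrite -star_hom_adj ?ba.
have wa : adj w = w by rewrite -star_hom_adj ?za.
have uw : u ** w = w ** u by rewrite -!star_homM ?bz.
have wE : w + w = u ** u + w ** w by rewrite /w /u -!(star_homM Hf) -!star_homD zE.
have uc c : `|u ** c| <= `|c|.
  have [] // := @re_im_norm _ _ (u ** c) (c - w ** c) c.
    rewrite adjB (adjM u c) (adjM w c) ua wa cmulrBl -!cmulA !cmulrBr.
    by rewrite (cmulA u w) uw -cmulA.
  rewrite adjB (adjM u c) (adjM w c) ua wa cmulrBl !cmulrBr -!cmulA.
  have -> : adj c ** (u ** (u ** c)) = adj c ** (w ** c) + adj c ** (w ** c) -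
      adj c ** (w ** (w ** c)).
    rewrite (cmulA u u) -[u ** u](addrK (w ** w)) -wE cmulrBl cmulDl.
    by rewrite cmulrBr cmulDr -!cmulA.
  set x := adj c ** (w ** c); set y := adj c ** (w ** _); set k := adj c ** c.
  by rewrite opprB [y - x]addrC [k - x + _]addrA addrACA addNr addr0
    -[x + x + _]addrC addrA !subrK.
have [->|u0] := eqVneq u 0; first by rewrite normr0.
have := uc u; rewrite -{1}ua cnorm_adj expr2 -ler_pdivlMr ?normr_gt0 //.
by rewrite divff // normr_eq0.
Qed.

Lemma star_hom_norm a : `|f a| <= `|a|.
Proof.
have H b : adj b = b -> `|f b| <= `|b|.
  move=> ba; apply: le_addgt0 => // e e0.
  have M0 : 0 < `|b| + e by rewrite ltr_wpDl.
  have := @star_hom_selfadj ((`|b| + e)^-1 *: b).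
  have Mi : 0 <= (`|b| + e)^-1 by rewrite invr_ge0 ltW.
  rewrite Defs.adjZ ba geC0_conj // (star_homZ (`|b| + e)^-1 b) !normrZ.
  rewrite ger0_norm // mulrC ltr_pdivrMr // mul1r ltrDl.
  by move=> /(_ erefl e0); rewrite mulrC ler_pdivrMr // mul1r.
apply: norm_le_of_sq => //; rewrite -star_hom_adj // -star_homM //.
by rewrite -cnorm_adj H // adjM adjK.
Qed.

Lemma star_hom_cvg (I : Type) (F : set_system I) (u : I -> A) (l : A) :
  Filter F -> u @ F --> l -> (fun i => f (u i)) @ F --> f l.
Proof.
move=> FF /cvgrPdist_lt ul; apply/cvgrPdist_lt => e e0.
by apply: filterS (ul e e0) => i; rewrite -star_homB; apply: le_lt_trans; exact: star_hom_norm.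
Qed.

End StarHomTheory.

Section StarHomUnique.
Variable R : realType.
Implicit Types A B D : cstarType R.

Lemma star_hom_comp A B D (f : A -> B) (g : B -> D) :
  star_hom f -> star_hom g -> star_hom (g \o f).
Proof.
move=> Hf Hg; split=> [k a b|a b|a] /=.
- by rewrite (star_hom_linear Hf) (star_hom_linear Hg).
- by rewrite !star_homM.
- by rewrite !star_hom_adj.
Qed.

Lemma star_hom_id A : star_hom (@id A). Proof. by []. Qed.

(** The elements at which the two homomorphisms agree form a C*-subalgebra, closed
    because homomorphisms are continuous. *)
Lemma star_hom_eq_generated A B (G : set A) (f g : A -> B) :
  generates G -> star_hom f -> star_hom g -> (forall a, G a -> f a = g a) ->
  f =1 g.
Proof.
move=> genG Hf Hg fg a.
pose S := [set x | f x = g x].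
have [] : S = setT /\ S a; last by [].
suff ST : S = setT by split => //; rewrite ST.
apply: genG; last by [].
split; rewrite /S /mkset.
- by rewrite (star_hom0 Hf) (star_hom0 Hg).
- by move=> x y fx fy; rewrite (star_homD Hf) (star_homD Hg) fx fy.
- by move=> k x fx; rewrite (star_homZ Hf) (star_homZ Hg) fx.
- by move=> x y fx fy; rewrite (star_homM Hf) (star_homM Hg) fx fy.
- by move=> x fx; rewrite (star_hom_adj Hf) (star_hom_adj Hg) fx.
move=> x cx; apply/eqP; rewrite -subr_eq0; apply/eqP/norm_lim0 => e e0.
have e20 : 0 < e / 2 by rewrite divr_gt0.
have [y [fy xy]] := cx _ (nbhsx_ballx x _ e20).
move: xy; rewrite -ball_normE /= => xy.
have -> : f x - g x = f (x - y) - g (x - y).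
  by rewrite (star_homB Hf) (star_homB Hg) fy opprB addrA subrK.
rewrite (le_trans (ler_normB _ _)) // [leRHS]splitr lerD //.
  by rewrite (le_trans (star_hom_norm Hf _)) // ltW.
by rewrite (le_trans (star_hom_norm Hg _)) // ltW.
Qed.

End StarHomUnique.

(** * The homomorphism of compact operators induced by a Toeplitz representation *)

Section Correspondences.
Variables (R : realType) (A : cstarType R) (X : correspondence A).
Implicit Types (x y z : X) (a : A) (s : seq (X * X)) (t u : X -> X).

Lemma ipDl x y z : ip (x + y) z = ip x z + ip y z.
Proof. by rewrite -ip_adj ipDr adjD !ip_adj. Qed.

Lemma ip0r x : ip x 0 = 0.
Proof. by apply: (addrI (ip x 0)); rewrite -ipDr !addr0. Qed.

Lemma ip0l x : ip 0 x = 0.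
Proof. by rewrite -ip_adj ip0r adj0. Qed.

Lemma ipZl (k : R[i]) x y : ip (k *: x) y = k^* *: ip x y.
Proof. by rewrite -ip_adj ipZr Defs.adjZ ip_adj. Qed.

Lemma ipNr x y : ip x (- y) = - ip x y.
Proof. by rewrite -scaleN1r ipZr scaleN1r. Qed.

Lemma ipNl x y : ip (- x) y = - ip x y.
Proof. by rewrite -ip_adj ipNr adjN ip_adj. Qed.

Lemma ip_ractl x y a : ip (ract x a) y = adj a ** ip x y.
Proof. by rewrite -ip_adj ip_ract adjM ip_adj. Qed.

Lemma ip_sumr (I : Type) (r : seq I) (F : I -> X) x :
  ip x (\sum_(i <- r) F i) = \sum_(i <- r) ip x (F i).
Proof. by apply: (big_morph (ip x)); [exact: ipDr|exact: ip0r]. Qed.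

Lemma ip_suml (I : Type) (r : seq I) (F : I -> X) x :
  ip (\sum_(i <- r) F i) x = \sum_(i <- r) ip (F i) x.
Proof.
by apply: (big_morph (fun y => ip y x)) => [y z|]; [exact: ipDl|exact: ip0l].
Qed.

Lemma hnorm_ge0 x : 0 <= hnorm x.
Proof. by rewrite sqrtC_ge0. Qed.

Lemma hnorm_sq x : hnorm x ^+ 2 = `|ip x x|.
Proof. exact: sqrtCK. Qed.

Lemma hnorm_le x (M : R[i]) : 0 <= M -> `|ip x x| <= M ^+ 2 -> hnorm x <= M.
Proof.
by move=> M0; rewrite -hnorm_sq ler_pXn2r ?nnegrE ?hnorm_ge0.
Qed.

Lemma hnormZ (k : R[i]) x : hnorm (k *: x) = `|k| * hnorm x.
Proof.
apply: (pexpIrn (n := 2)); rewrite ?nnegrE ?mulr_ge0 ?hnorm_ge0 //.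
by rewrite exprMn !hnorm_sq ipZr ipZl !normrZ norm_conjC mulrA expr2.
Qed.

Lemma hnorm_ract x a : hnorm (ract x a) <= hnorm x * `|a|.
Proof.
apply: hnorm_le; first by rewrite mulr_ge0 ?hnorm_ge0.
rewrite exprMn hnorm_sq ip_ract ip_ractl (le_trans (cnormM _ _)) //.
by rewrite expr2 mulrA ler_wpM2r // mulrC -(norm_adj a) cnormM.
Qed.

Definition theta_sum s x : X := \sum_(p <- s) theta p.1 p.2 x.

Definition swap_pairs s := [seq (p.2, p.1) | p <- s].

Lemma theta_sum_cat s s' x : theta_sum (s ++ s') x = theta_sum s x + theta_sum s' x.
Proof. exact: big_cat. Qed.

Lemma theta_sum_adjoint s : adjoint_of (theta_sum s) (theta_sum (swap_pairs s)).
Proof.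
move=> x y; rewrite ip_suml ip_sumr big_map; apply: eq_bigr => p _ /=.
by rewrite /theta ip_ractl ip_ract ip_adj.
Qed.

Lemma adjoint_ofB t t' u u' : adjoint_of t u -> adjoint_of t' u' ->
  adjoint_of (fun x => t x - t' x) (fun x => u x - u' x).
Proof.
by move=> tu tu' x y; rewrite ipDl ipNl ipDr ipNr tu tu'.
Qed.

Definition cauchy_schwarz := forall x y, `|ip x y| <= hnorm x * hnorm y.

Hypothesis CS : cauchy_schwarz.

Lemma hnormD x y : hnorm (x + y) <= hnorm x + hnorm y.
Proof.
apply: hnorm_le; first by rewrite addr_ge0 ?hnorm_ge0.
rewrite ipDl !ipDr.
have -> : (hnorm x + hnorm y) ^+ 2 = hnorm x * hnorm x + hnorm x * hnorm y +
    (hnorm y * hnorm x + hnorm y * hnorm y) by rewrite expr2 mulrDl !mulrDr.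
rewrite (le_trans (ler_normD _ _)) // lerD // (le_trans (ler_normD _ _)) // lerD //.
Qed.

Lemma hnorm0 : hnorm (0 : X) = 0.
Proof. by rewrite /hnorm ip0r normr0 sqrtC0. Qed.

Lemma hnormN x : hnorm (- x) = hnorm x.
Proof. by rewrite -scaleN1r hnormZ normrN1 mul1r. Qed.

Lemma hnorm_distC x y : hnorm (x - y) = hnorm (y - x).
Proof. by rewrite -hnormN opprB. Qed.

Lemma hnorm_theta x y z : hnorm (theta x y z) <= hnorm x * hnorm y * hnorm z.
Proof.
rewrite -mulrA (le_trans (hnorm_ract _ _)) // ler_wpM2l ?hnorm_ge0 //.
Qed.

Lemma theta_sum_bounded s : exists2 M : R[i], 0 <= M &
  forall z, hnorm (theta_sum s z) <= M * hnorm z.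
Proof.
elim: s => [|p s [M M0 IH]].
  by exists 0 => // z; rewrite /theta_sum big_nil hnorm0 mul0r.
exists (hnorm p.1 * hnorm p.2 + M); first by rewrite addr_ge0 ?mulr_ge0 ?hnorm_ge0.
move=> z; rewrite /theta_sum big_cons mulrDl (le_trans (hnormD _ _)) //.
by rewrite lerD ?hnorm_theta ?IH.
Qed.

Lemma adjoint_bounded t u (M : R[i]) : 0 <= M -> adjoint_of t u ->
  (forall z, hnorm (t z) <= M * hnorm z) -> forall z, hnorm (u z) <= M * hnorm z.
Proof.
move=> M0 tu tM z; have [->|uz] := eqVneq (hnorm (u z)) 0.
  by rewrite mulr_ge0 ?hnorm_ge0.
have uz0 : 0 < hnorm (u z) by rewrite lt_neqAle eq_sym uz hnorm_ge0.
rewrite -(ler_pM2r uz0) -expr2 hnorm_sq -tu (le_trans (CS _ _)) //.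
by rewrite mulrAC ler_wpM2r ?hnorm_ge0.
Qed.

Section Toeplitz.
Variables (B : cstarType R) (psi : X -> B) (pi : A -> B).
Hypothesis Tr : toeplitz_rep psi pi.
Let piH : star_hom pi := toeplitz_star_hom Tr.

Lemma psiD x y : psi (x + y) = psi x + psi y.
Proof. by have := toeplitz_linear Tr 1 x y; rewrite !scale1r. Qed.

Lemma psi0 : psi 0 = 0.
Proof. by apply: (addrI (psi 0)); rewrite -psiD !addr0. Qed.

Lemma psiZ (k : R[i]) x : psi (k *: x) = k *: psi x.
Proof. by have := toeplitz_linear Tr k x 0; rewrite psi0 !addr0. Qed.

Lemma psiB x y : psi (x - y) = psi x - psi y.
Proof. by rewrite psiD -scaleN1r psiZ scaleN1r. Qed.

Lemma psi_sum (I : Type) (r : seq I) (F : I -> X) :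
  psi (\sum_(i <- r) F i) = \sum_(i <- r) psi (F i).
Proof. exact: (big_morph _ psiD psi0). Qed.

Lemma psi_norm x : `|psi x| <= hnorm x.
Proof.
apply: norm_le_of_sq; first exact: hnorm_ge0.
by rewrite (toeplitz_ip Tr) hnorm_sq (star_hom_norm piH).
Qed.

(** The difference [d] of the two sides satisfies [d^* d = 0]. *)
Lemma psi_ract x a : psi (ract x a) = psi x ** pi a.
Proof.
apply/eqP; rewrite -subr_eq0 -normr_eq0 -sqrf_eq0 -cnorm_adj adjB adjM.
rewrite cmulrBl !cmulrBr !cmulA -[adj (pi a) ** _ ** psi x]cmulA.
rewrite -[adj (pi a) ** _ ** psi (ract _ _)]cmulA !(toeplitz_ip Tr).
rewrite -(star_hom_adj piH) -!(star_homM piH) !ip_ract !ip_ractl !cmulA.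
by rewrite !subrr normr0.
Qed.

Definition rank_sum s : B := \sum_(p <- s) psi p.1 ** adj (psi p.2).

Lemma rank_sum_cat s s' : rank_sum (s ++ s') = rank_sum s + rank_sum s'.
Proof. exact: big_cat. Qed.

Lemma rank_sum_psi s z : rank_sum s ** psi z = psi (theta_sum s z).
Proof.
rewrite csumMr psi_sum; apply: eq_bigr => p _.
by rewrite -cmulA (toeplitz_ip Tr) psi_ract.
Qed.

Lemma adj_rank_sum s : adj (rank_sum s) = rank_sum (swap_pairs s).
Proof.
by rewrite adj_sum /rank_sum big_map; apply: eq_bigr => p _; rewrite adjM adjK.
Qed.

(** With [c = b^* b], the power [c^n] is a sum of a number of rank-one elements
    that is independent of [n], each of norm at most a constant times [M^(2n)];
    the spectral radius formula removes the constant. *)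
Lemma rank_sum_norm s (M : R[i]) : 0 <= M ->
  (forall z, hnorm (theta_sum s z) <= M * hnorm z) -> `|rank_sum s| <= M.
Proof.
move=> M0 sM; apply: norm_le_of_sq => //; set b := rank_sum s.
have sM' := adjoint_bounded M0 (theta_sum_adjoint s) sM.
pose K z := theta_sum (swap_pairs s) (theta_sum s z).
have KM z : hnorm (K z) <= M ^+ 2 * hnorm z.
  by rewrite expr2 -mulrA (le_trans (sM' _)) // ler_wpM2l.
pose c := adj b ** b; have cK z : c ** psi z = psi (K z).
  by rewrite -cmulA rank_sum_psi adj_rank_sum rank_sum_psi.
pose F n (p : X * X) := iter n K (theta_sum (swap_pairs s) p.1).
have cE n : cpow c n = \sum_(p <- s) psi (F n p) ** adj (psi p.2).
  elim: n => [|n IH].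
    rewrite /= /c {2}/b csumMl; apply: eq_bigr => p _.
    by rewrite cmulA adj_rank_sum rank_sum_psi.
  rewrite cpowS IH csumMl; apply: eq_bigr => p _.
  by rewrite cmulA cK.
pose C := \sum_(p <- s) hnorm (F 0 p) * hnorm p.2.
apply: (@selfadj_norm_le _ _ _ _ C).
- by rewrite adjM adjK.
- by rewrite exprn_ge0.
- by apply: sumr_ge0 => p _; rewrite mulr_ge0 ?hnorm_ge0.
move=> n; rewrite -/c cE (le_trans (ler_norm_sum _ _ _)) // mulr_suml.
apply: ler_sum => p _; rewrite (le_trans (cnormM _ _)) // norm_adj mulrAC.
rewrite ler_pM ?normr_ge0 ?psi_norm // (le_trans (psi_norm _)) //.
elim: n => [|n IH]; first by rewrite expr0 mulr1.
rewrite exprS mulrCA (le_trans (KM _)) // ler_wpM2l // exprn_ge0 //.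
Qed.

(** [b] is the image of [t] under the induced homomorphism. *)
Definition induces t (b : B) := forall e : R[i], 0 < e -> exists s,
  (forall z, hnorm (t z - theta_sum s z) <= e * hnorm z) /\
  `|b - rank_sum s| <= e.

Lemma induces_norm t b (M : R[i]) : 0 <= M -> induces t b ->
  (forall z, hnorm (t z) <= M * hnorm z) -> `|b| <= M.
Proof.
move=> M0 tb tM; apply: le_addgt0 => // e e0.
have e20 : 0 < e / 2 by rewrite divr_gt0.
have [s [ts bs]] := tb _ e20.
rewrite [e]splitr addrA -[b](subrK (rank_sum s)) addrC.
rewrite (le_trans (ler_normD _ _)) // lerD //.
apply: rank_sum_norm => [|z]; first by rewrite addr_ge0 // ltW.
rewrite -[theta_sum s z](subKr (t z)) (le_trans (hnormD _ _)) // hnormN mulrDl.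
by rewrite lerD.
Qed.

Lemma inducesD t t' b b' : induces t b -> induces t' b' ->
  induces (fun z => t z + t' z) (b + b').
Proof.
move=> tb tb' e e0; have e20 : 0 < e / 2 by rewrite divr_gt0.
have [s [ts bs]] := tb _ e20; have [s' [ts' bs']] := tb' _ e20.
exists (s ++ s'); split=> [z|].
  rewrite theta_sum_cat opprD addrACA (le_trans (hnormD _ _)) //.
  by rewrite [e]splitr mulrDl lerD.
by rewrite rank_sum_cat opprD addrACA (le_trans (ler_normD _ _)) // [e]splitr lerD.
Qed.

Lemma inducesZ (k : R[i]) t b : induces t b ->
  induces (fun z => k *: t z) (k *: b).
Proof.
move=> tb e e0; have k1 : 0 < `|k| + 1 by rewrite ltr_wpDl.
have [s [ts bs]] := tb _ (divr_gt0 e0 k1).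
have ke : `|k| * (e / (`|k| + 1)) <= e.
  by rewrite mulrCA ler_piMr ?ltW // ltr_pdivrMr // mul1r ltrDl.
exists [seq (k *: p.1, p.2) | p <- s]; split=> [z|].
  have -> : theta_sum [seq (k *: p.1, p.2) | p <- s] z = k *: theta_sum s z.
    rewrite /theta_sum big_map scaler_sumr; apply: eq_bigr => p _.
    by rewrite /theta ractZl.
  rewrite -scalerBr hnormZ (le_trans (ler_wpM2l _ (ts z))) // mulrA.
  by rewrite ler_wpM2r ?hnorm_ge0.
have -> : rank_sum [seq (k *: p.1, p.2) | p <- s] = k *: rank_sum s.
  rewrite /rank_sum big_map scaler_sumr; apply: eq_bigr => p _.
  by rewrite psiZ cscaleAl.
by rewrite -scalerBr normrZ (le_trans (ler_wpM2l _ bs)).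
Qed.

Lemma induces_unique t b b' : induces t b -> induces t b' -> b = b'.
Proof.
move=> tb tb'; apply/eqP; rewrite -subr_eq0 -normr_le0 -[- b']scaleN1r.
apply: (induces_norm (lexx 0) (inducesD tb (inducesZ (- 1) tb'))) => z.
by rewrite scaleN1r subrr hnorm0 mul0r.
Qed.

Lemma induces_adj t u b : adjoint_of t u -> induces t b -> induces u (adj b).
Proof.
move=> tu tb e e0; have [s [ts bs]] := tb _ e0.
exists (swap_pairs s); split.
  apply: (adjoint_bounded (ltW e0) _ ts).
  exact: adjoint_ofB tu (theta_sum_adjoint s).
by rewrite -adj_rank_sum -adjB norm_adj.
Qed.

Lemma theta_sumD s x y : theta_sum s (x + y) = theta_sum s x + theta_sum s y.
Proof.
rewrite /theta_sum -big_split; apply: eq_bigr => p _.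
by rewrite /theta ipDr ractDr.
Qed.

Lemma theta_sumN s x : theta_sum s (- x) = - theta_sum s x.
Proof.
rewrite /theta_sum -sumrN; apply: eq_bigr => p _.
by rewrite /theta ipNr -[- ip _ _]scaleN1r ractZr scaleN1r.
Qed.

Lemma theta_sum_comp s s' z :
  theta_sum [seq (theta_sum s p.1, p.2) | p <- s'] z = theta_sum s (theta_sum s' z).
Proof.
have S0 : theta_sum s 0 = 0 by apply: (addrI (theta_sum s 0)); rewrite -theta_sumD !addr0.
rewrite {1}/theta_sum big_map /= [X in theta_sum s X]/theta_sum.
rewrite (big_morph _ (@theta_sumD s) S0); apply: eq_bigr => p _.
rewrite {1}/theta {1}/theta_sum (big_morph (fun x => ract x (ip p.2 z))
  (fun x y => ractDl x y (ip p.2 z)) (_ : ract 0 _ = 0)).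
  by apply: eq_bigr => p' _; rewrite /theta ip_ract ractM.
by rewrite -(scale0r 0) ractZl !scale0r.
Qed.

Lemma rank_sum_comp s s' :
  rank_sum [seq (theta_sum s p.1, p.2) | p <- s'] = rank_sum s ** rank_sum s'.
Proof.
rewrite [X in _ ** X]/rank_sum csumMl /rank_sum big_map; apply: eq_bigr => p _.
by rewrite -rank_sum_psi cmulA.
Qed.

Lemma induces_bounded t b : induces t b -> exists2 M : R[i], 0 <= M &
  forall z, hnorm (t z) <= M * hnorm z.
Proof.
move=> tb; have [s [ts _]] := tb _ ltr01.
have [M M0 sM] := theta_sum_bounded s; exists (1 + M); first by rewrite addr_ge0.
move=> z; rewrite -[t z](subrK (theta_sum s z)) mulrDl.
by rewrite (le_trans (hnormD _ _)) // lerD.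
Qed.

Lemma inducesM t t' b b' : induces t b -> induces t' b' ->
  induces (t \o t') (b ** b').
Proof.
move=> tb tb' e e0; have e20 : 0 < e / 2 by rewrite divr_gt0.
have [M M0 tM] := induces_bounded tb.
have [M' M'0 tM'] := induces_bounded tb'.
have M1 : 0 < M + 1 by rewrite ltr_wpDl.
have M'e : 0 < M' + e / 2 by rewrite ltr_wpDl.
(* The error of the approximation of [t] is multiplied by the bound [M'] of [t'],
   and has to be at most 1 for [M + 1] to bound the approximation of [t]. *)
have [s' [ts' bs']] := tb' _ (divr_gt0 e20 M1).
have [s [ts bs]] := tb _ (divr_gt0 e20 M'e).
have d1 : e / 2 / (M' + e / 2) <= 1 by rewrite ler_pdivrMr // mul1r lerDr.
have dM' : e / 2 / (M' + e / 2) * M' <= e / 2.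
  by rewrite -mulrA ler_piMr ?(ltW e20) // mulrC ler_pdivrMr // mul1r lerDl ltW.
have Md' : (M + 1) * (e / 2 / (M + 1)) = e / 2 by rewrite mulrC divfK // gt_eqF.
have sM z : hnorm (theta_sum s z) <= (M + 1) * hnorm z.
  rewrite -[theta_sum s z](subKr (t z)) (le_trans (hnormD _ _)) // hnormN mulrDl.
  by rewrite lerD // (le_trans (ts z)) // ler_wpM2r ?hnorm_ge0.
exists [seq (theta_sum s p.1, p.2) | p <- s']; split=> [z|].
  rewrite theta_sum_comp /= -[t (t' z)](subrK (theta_sum s (t' z))) -addrA.
  rewrite -theta_sumN -theta_sumD (le_trans (hnormD _ _)) // [e]splitr mulrDl.
  rewrite lerD //.
    rewrite (le_trans (ts _)) // (le_trans (ler_wpM2l _ (tM' z))) //.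
      by rewrite divr_ge0 // ltW.
    by rewrite mulrA ler_wpM2r ?hnorm_ge0.
  rewrite (le_trans (sM _)) // (le_trans (ler_wpM2l (ltW M1) (ts' z))) //.
  by rewrite mulrA Md'.
rewrite rank_sum_comp.
have -> : b ** b' - rank_sum s ** rank_sum s' =
    (b - rank_sum s) ** b' + rank_sum s ** (b' - rank_sum s').
  by rewrite cmulrBl cmulrBr addrA subrK.
rewrite (le_trans (ler_normD _ _)) // [e]splitr lerD //.
  rewrite (le_trans (cnormM _ _)) // (le_trans _ dM') // ler_pM //.
  exact: induces_norm tb' tM'.
by rewrite (le_trans (cnormM _ _)) // -[leRHS]Md' ler_pM // rank_sum_norm // ltW.
Qed.

Lemma induces_theta x y : induces (theta x y) (psi x ** adj (psi y)).
Proof.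
move=> e e0; exists [:: (x, y)]; split=> [z|].
  by rewrite /theta_sum big_seq1 /= subrr hnorm0 mulr_ge0 ?hnorm_ge0 // ltW.
by rewrite /rank_sum big_seq1 /= subrr normr0 ltW.
Qed.

(** Finite-rank approximations of [t] with error [2^-n] have images that form a
    Cauchy sequence. *)
Lemma compact_induces t : compact_op t -> exists b, induces t b.
Proof.
case=> _ tK; pose d n : R[i] := 2^-1 ^+ n.
have i2 : 0 < 2^-1 :> R[i] by rewrite invr_gt0.
have d0 n : 0 < d n by rewrite exprn_gt0.
have [s sP] := choice (fun n => tK (d n) (d0 n)).
have bnd m n : `|rank_sum (s m) - rank_sum (s n)| <= d m + d n.
  pose s' := [seq (-1 *: p.1, p.2) | p <- s n].
  have tE z : theta_sum s' z = - theta_sum (s n) z.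
    rewrite /theta_sum big_map -sumrN; apply: eq_bigr => p _.
    by rewrite /theta /= ractZl scaleN1r.
  have rE : rank_sum s' = - rank_sum (s n).
    rewrite /rank_sum big_map -sumrN; apply: eq_bigr => p _.
    by rewrite /= psiZ scaleN1r cmulNr.
  rewrite -rE -rank_sum_cat; apply: rank_sum_norm => [|z].
    by rewrite addr_ge0 // ltW.
  rewrite theta_sum_cat tE -[theta_sum (s m) z](subrK (t z)) -addrA mulrDl.
  by rewrite (le_trans (hnormD _ _)) // hnorm_distC lerD // ?sP.
have small (e : R[i]) : 0 < e -> exists N, forall n, (N <= n)%N -> d n < e.
  by apply: expr_lt; rewrite ?(ltW i2) // invf_lt1 // ltr1n.
have : cvg ((fun n => rank_sum (s n)) @ \oo).
  apply: cauchy_cvg; apply: cauchy_exP => e e0.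
  have e20 : 0 < e / 2 by rewrite divr_gt0.
  have [N HN] := small _ e20; exists (rank_sum (s N)), N => // n /= Nn.
  rewrite -ball_normE /=; apply: le_lt_trans (bnd _ _) _.
  by rewrite [e]splitr ltrD ?HN.
move=> /cvg_ex[b sb]; exists b => e e0.
have [N HN] := small _ e0.
move/cvgrPdist_lt : sb => /(_ _ e0)[M _ HM].
exists (s (maxn M N)); split=> [z|]; last by rewrite ltW // HM //= leq_maxl.
rewrite (le_trans (sP _ z)) // ler_wpM2r ?hnorm_ge0 // ltW // HN //.
exact: leq_maxr.
Qed.

Lemma induced_hom_exists : exists2 h, induced_hom psi h &
  forall t b, induces t b -> h t = b.
Proof.
pose h t := xget 0 (induces t).
have hE t b : induces t b -> h t = b.
  by move=> tb; apply: induces_unique (tb); apply: (xgetPex 0); exists b.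
have hP t : compact_op t -> induces t (h t).
  by case/compact_induces => b tb; rewrite (hE _ _ tb).
exists h => //; split.
- by move=> t u /hP tb /hP ub; apply/hE/inducesD.
- by move=> k t /hP tb; apply/hE/inducesZ.
- by move=> t u /hP tb /hP ub; apply/hE/inducesM.
- by move=> t u /hP tb tu; apply/hE/(induces_adj tu).
- by move=> x y; apply/hE/induces_theta.
Qed.

Lemma theta_sum_compact s : compact_op (theta_sum s).
Proof.
split; first by exists (theta_sum (swap_pairs s)); exact: theta_sum_adjoint.
move=> e e0; exists s => z.
by rewrite subrr hnorm0 mulr_ge0 ?hnorm_ge0 // ltW.
Qed.

Lemma induced_theta_sum h s : induced_hom psi h -> h (theta_sum s) = rank_sum s.
Proof.
move=> hI; elim: s => [|[x y] s IH].
  have -> : theta_sum [::] = fun z => 0 *: theta_sum [::] z.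
    by apply/funext => z; rewrite scale0r /theta_sum big_nil.
  rewrite (inducedZ hI); last exact: theta_sum_compact.
  by rewrite scale0r /rank_sum big_nil.
have -> : theta_sum ((x, y) :: s) = fun z => theta x y z + theta_sum s z.
  by apply/funext => z; rewrite /theta_sum big_cons.
have xyE : theta x y = theta_sum [:: (x, y)].
  by apply/funext => z; rewrite /theta_sum big_seq1.
rewrite (inducedD hI); [|rewrite xyE; exact: theta_sum_compact|exact: theta_sum_compact].
by rewrite IH (induced_theta hI) [in RHS]/rank_sum big_cons.
Qed.

End Toeplitz.
End Correspondences.

(** * Infinite paths *)

Section Paths.
Variable E : digraph.
Implicit Types (alpha beta : infinite_path E) (e : edge E) (v : vertex E).

Lemma infinite_pathP alpha n : src (val alpha n) = rng (val alpha n.+1).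
Proof. by case: alpha => a /= /set_mem; apply. Qed.

(** A basic neighbourhood in the product topology restricts finitely many edges. *)
Lemma path_cvg (F : set_system (infinite_path E)) alpha : Filter F ->
  (forall n, F [set beta | val beta n = val alpha n]) -> F --> alpha.
Proof.
move=> FF Fn.
have vF : val @ F --> val alpha.
  apply/cvg_sup => n A /= [_ [[B Bop <-] /= Bn sBA]].
  change (F (val @^-1` A)); apply: filterS (Fn n) => beta bn; apply: sBA.
  by move: bn Bn; rewrite /preimage /= => ->.
move=> A /= [_ [[B Bop <-] /= Ba sBA]].
have /vF : nbhs (val alpha) B by apply: open_nbhs_nbhs.
by move=> FB; exact: (@filterS _ F FF _ _ sBA FB).
Qed.

Fact path_tail_subproof alpha : (fun n => val alpha n.+1) \in infinite_path E.
Proof. by apply/mem_set => n; exact: infinite_pathP. Qed.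

Definition path_tail alpha : infinite_path E :=
  exist _ (fun n => val alpha n.+1) (path_tail_subproof alpha).

Lemma path_tail_range alpha : path_range (path_tail alpha) = src (val alpha 0).
Proof. by rewrite /path_range /= -infinite_pathP. Qed.

Lemma cons_path_tail alpha : cons_path (path_tail_range alpha) = alpha.
Proof. by apply: val_inj; apply/funext => -[|n]. Qed.

Lemma ultra_finite (U : Type) (F : set_system U) (I : eqType) (f : U -> I)
    (r : seq I) : UltraFilter F -> F [set x | f x \in r] ->
  exists2 i, i \in r & F [set x | f x = i].
Proof.
move=> FU; elim: r => [|i r IH].
  move=> F0; suff : F set0 by move/(@filter_not_empty _ F _).
  by apply: filterS F0 => x.
move=> Fir; have [Fi|nFi] := in_ultra_setVsetC [set x | f x = i] FU.
  by exists i; rewrite ?mem_head.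
have /IH[j jr Fj] : F [set x | f x \in r].
  apply: filterS2 Fir nFi => x /=; rewrite inE => /predU1P[]//.
by exists j; rewrite // inE jr orbT.
Qed.

Hypothesis E_row_finite : row_finite E.

(** Koenig's lemma: an ultrafilter on the paths with range [v] selects
    successively a first edge, a second edge, and so on, and converges to the
    path so obtained. *)
Lemma paths_compact v : compact [set alpha | path_range alpha = v].
Proof.
rewrite compact_ultra => F FU Fv.
have step n w : F [set alpha | rng (val alpha n) = w] ->
    exists e, F [set alpha | val alpha n = e].
  move=> Fw; have fin := E_row_finite w.
  have [|e _ Fe] := @ultra_finite _ F _ (fun alpha => val alpha n)
    (fset_set [set e | rng e = w]) FU.
    apply: filterS Fw => alpha /= aw.
    by rewrite (in_fset_set fin); apply/mem_set.
  by exists e.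
have Fn n : exists e, F [set alpha | val alpha n = e].
  elim: n => [|n [e Fe]]; first exact: step Fv.
  apply: (@step _ (src e)); apply: filterS Fe => alpha /= <-.
  by rewrite infinite_pathP.
have [d Fd] := choice Fn.
have dP : infinite_path E d.
  move=> n; have [alpha [/= <- <-]] := filter_ex (filterI (Fd n) (Fd n.+1)).
  exact: infinite_pathP.
exists (exist _ d (mem_set dP)); split => /=.
  have [alpha [/= a0 <-]] := filter_ex (filterI (Fd 0) Fv).
  by rewrite /path_range /= a0.
exact: path_cvg.
Qed.

End Paths.

(** * The spaces T_v as images of path spaces *)

Section PathImages.
Variables (E : digraph) (E_row_finite : row_finite E).
Variables (T : vertex E -> topologicalType).
Variable phi : forall e : edge E, T (src e) -> T (rng e).
Variable Phi : infinite_path E -> {v : vertex E & T v}.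
Hypothesis Phi_continuous : continuous Phi.
Hypothesis Phi_surjective : forall y, exists alpha, Phi alpha = y.
Hypothesis Phi_equivariant : forall (e : edge E) (alpha : infinite_path E)
    (h : path_range alpha = src e),
  exists t : T (src e),
    Phi alpha = existT (fun v => T v : Type) (src e) t /\
    Phi (cons_path h) = existT (fun v => T v : Type) (rng e) (@phi e t).

Lemma sigT_fiber (y : {v : vertex E & T v}) v : projT1 y = v ->
  exists t : T v, y = existT (fun v => T v : Type) v t.
Proof. by case: y => w t /= <-; exists t. Qed.

Lemma Phi_head alpha : exists t : T (src (val alpha 0)),
  Phi (path_tail alpha) = existT (fun v => T v : Type) _ t /\
  Phi alpha = existT (fun v => T v : Type) _ (@phi (val alpha 0) t).
Proof.
have [t [H1 H2]] := Phi_equivariant (path_tail_range alpha).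
by exists t; split => //; rewrite -H2 cons_path_tail.
Qed.

Lemma Phi_vertex alpha : projT1 (Phi alpha) = path_range alpha.
Proof. by have [t [_ ->]] := Phi_head alpha. Qed.

Lemma Phi_onto v (y : T v) : exists2 alpha, path_range alpha = v &
  Phi alpha = existT (fun v => T v : Type) v y.
Proof.
have [alpha aE] := Phi_surjective (existT (fun v => T v : Type) v y).
by exists alpha => //; rewrite -Phi_vertex aE.
Qed.

Lemma phi_cover v (y : T v) : exists (e : edge E) (t : T (src e)),
  existT (fun v => T v : Type) v y = existT (fun v => T v : Type) (rng e) (phi t).
Proof.
have [alpha _ <-] := Phi_onto y; have [t [_ ->]] := Phi_head alpha.
by exists (val alpha 0), t.
Qed.

(** [T v] embeds into the disjoint union as a clopen subset, which is the image of
    the compact space of paths with range [v]. *)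
Lemma T_compact v : compact [set: T v].
Proof.
have cK : compact (Phi @` [set alpha | path_range alpha = v]).
  apply: continuous_compact; last exact: paths_compact.
  exact: continuous_subspaceT.
move=> F FF _; pose j (t : T v) := existT (fun v => T v : Type) v t.
have jK : (j @ F) (Phi @` [set alpha | path_range alpha = v]).
  change (F (j @^-1` (Phi @` [set alpha | path_range alpha = v]))).
  apply: filterS (@filterT _ F _) => t _.
  by have [alpha av aE] := Phi_onto t; exists alpha.
have [y [[alpha av <-] cl]] := cK _ _ jK.
have [t aE] : exists t, Phi alpha = j t.
  by apply: sigT_fiber; rewrite Phi_vertex.
exists t; split => // A B FA tB.
have [] := cl (j @` A) (j @` B).
- change (F (j @^-1` (j @` A))).
  by apply: filterS FA => x Ax; exists x.
- by rewrite aE; exact: (@existT_nbhs _ T).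
move=> _ [[a Aa <-] [b Bb ba]]; exists a; split => //.
by rewrite -(existT_inj2 ba).
Qed.

End PathImages.

(** * The coefficient algebra *)

Section CoefficientAlgebra.
Variables (R : realType) (E : digraph) (T : vertex E -> topologicalType).
Hypothesis T_cpt : forall v, compact [set: T v].
Local Notation A := (c0_sum (fun v => C0 R (T v))).
Implicit Types (a b : A) (v w : vertex E).

Fact one_subproof v : inSec (C0_alg R (T v)) (fun=> 1).
Proof.
split; first by move=> t; exact: cvg_cst.
by move=> e e0; exists setT => // t; case.
Qed.

Definition C0one v : C0 R (T v) :=
  @MkSection R _ _ (C0_alg R (T v)) _ (one_subproof v).

Definition unit_at v : A := inA (C0one v).

Lemma C0ev_one v (t : T v) : C0ev (C0one v) t = 1. Proof. by []. Qed.

Lemma ev_inA_neq u v (f : C0 R (T u)) (t : T v) : u != v -> ev (inA f) t = 0.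
Proof. by move=> uv; rewrite /ev /inA /summand /= dfwithout. Qed.

Lemma ev_unit_at v w (t : T w) : ev (unit_at v) t = (v == w)%:R.
Proof.
case: (eqVneq v w) => [vw|vw]; last by rewrite ev_inA_neq.
by case: _ / vw t => t; rewrite inA_at.
Qed.

Lemma adj_unit_at v : adj (unit_at v) = unit_at v.
Proof. by apply: ev_ext => w t; rewrite ev_adj ev_unit_at rmorph_nat. Qed.

Lemma unit_atM v : unit_at v ** unit_at v = unit_at v.
Proof.
by apply: ev_ext => w t; rewrite evM ev_unit_at; case: eqP; rewrite ?mulr1 ?mulr0.
Qed.

Lemma unit_at_orth v w : v != w -> unit_at v ** unit_at w = 0.
Proof.
move=> vw; apply: ev_ext => u t; rewrite evM !ev_unit_at ev0.
case: (eqVneq v u) vw => [->|_ _]; last by rewrite mul0r.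
by rewrite eq_sym => /negPf ->; rewrite mulr0.
Qed.

Lemma unit_at_approx a (e : R[i]) : 0 < e -> exists F : {fset vertex E},
  forall w (t : T w), w \notin F -> `|ev a t| <= e.
Proof.
move=> e0; have := @section_funP R _ _ (c0_alg _) a _ e0.
move=> /finite_fsetP[F FE]; exists F => w t wF.
have : ~ [set i | e <= `|section_fun (a : sections (c0_alg (fun v => C0 R (T v)))) i|] w.
  by rewrite FE /=; apply/negP.
rewrite /= => aw; apply: le_trans (C0ev_norm _ _) _.
have [|/ltW//] := ge0_cmp (ltW e0) (normr_ge0
  (section_fun (a : sections (c0_alg (fun v => C0 R (T v)))) w)).
by move/aw.
Qed.

Lemma ev_sum_unit_at (F : {fset vertex E}) a w (t : T w) :
  ev (\sum_(v <- F) unit_at v ** a) t = if w \in F then ev a t else 0.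
Proof.
rewrite ev_sum; case: ifPn => wF.
  rewrite (big_fsetD1 w) //= evM ev_unit_at eqxx mul1r big_seq big1 ?addr0 //.
  by move=> v; rewrite !inE => /andP[/negPf vw _]; rewrite evM ev_unit_at vw mul0r.
rewrite big_seq big1 // => v vF; rewrite evM ev_unit_at.
case: (eqVneq v w) => [vw|_]; last by rewrite mul0r.
by rewrite -vw vF in wF.
Qed.

Lemma norm_sub_sum_unit_at (F : {fset vertex E}) a (e : R[i]) : 0 <= e ->
  (forall w (t : T w), w \notin F -> `|ev a t| <= e) ->
  `|a - \sum_(v <- F) unit_at v ** a| <= e.
Proof.
move=> e0 Fe; apply: ev_norm_le => // w t; rewrite evB ev_sum_unit_at.
by case: ifPn => [_|/Fe aw]; rewrite ?subrr ?normr0 ?subr0.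
Qed.

(** At each point of [T] the inner product is a semi-inner product. With
    [N = |<y, y>|], the inequality is the positivity of [<z, z>] for
    [z = N x - y <y, x>]. *)
Lemma correspondence_cauchy_schwarz (X : correspondence A) : cauchy_schwarz X.
Proof.
move=> x y; have ip0 (z : X) v (t : T v) : 0 <= ev (ip z z) t.
  by have [b ->] := ip_pos z; rewrite evM ev_adj mulrC -normCK exprn_ge0.
set N := `|ip y y|; have N0 : 0 <= N by exact: normr_ge0.
have xy0 : 0 <= hnorm x * hnorm y by rewrite mulr_ge0 ?hnorm_ge0.
have [Nz|Nnz] := eqVneq N 0.
  move/eqP: Nz; rewrite normr_eq0 => /eqP/ip_eq0 ->.
  by rewrite ip0r normr0 mulr_ge0 ?hnorm_ge0.
have Np : 0 < N by rewrite lt_neqAle eq_sym Nnz.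
apply: ev_norm_le => // v t; set b := ev (ip x y) t.
have bc : ev (ip y x) t = b^* by rewrite -ip_adj ev_adj.
rewrite -(@ler_pXn2r _ 2) ?nnegrE // exprMn !hnorm_sq -/N.
have ax : ev (ip x x) t <= `|ip x x|.
  by rewrite -[ev _ t]ger0_norm ?ip0 ?ev_norm.
have cN : ev (ip y y) t <= N by rewrite -[ev _ t]ger0_norm ?ip0 ?ev_norm.
apply: le_trans (ler_wpM2r N0 ax); rewrite -(ler_pM2l Np).
have bb : b * b^* = `|b| ^+ 2 by rewrite -normCK.
have cb : `|b| ^+ 2 * ev (ip y y) t <= N * `|b| ^+ 2.
  by rewrite mulrC ler_wpM2r ?exprn_ge0.
have := ip0 (N *: x - ract y (ip y x)) v t.
rewrite !(ipDl, ipDr, ipNl, ipNr, ipZl, ipZr, ip_ract, ip_ractl, ip_adj).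
rewrite !(evD, evN, evZ, evM) !bc -/b geC0_conj // => H.
rewrite -subr_ge0; apply: le_trans H _; rewrite -subr_ge0.
have : 0 <= N * `|b| ^+ 2 - `|b| ^+ 2 * ev (ip y y) t by rewrite subr_ge0.
by rewrite -bb; congr (0 <= _); ring.
Qed.

End CoefficientAlgebra.

(** * Pulling functions back along edges *)

Section Pull.
Variables (R : realType) (E : digraph) (T : vertex E -> topologicalType).
Hypothesis T_cpt : forall v, compact [set: T v].
Variable phi : forall e : edge E, T (src e) -> T (rng e).
Hypothesis cphi : forall e, continuous (@phi e).
Local Notation A := (c0_sum (fun v => C0 R (T v))).
Implicit Types (a b : A) (v w : vertex E) (e : edge E).

(** This is [<1_e, a 1_e>] for the unit [1_e] of the summand [X_e] of the
    correspondence. *)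
Definition pull e a : A :=
  inA (pullback_act (@cphi e) (@section_fun R _ _ (c0_alg _) a (rng e))
    (C0one R T_cpt (src e))).

Lemma ev_pull e a (t : T (src e)) : ev (pull e a) t = ev a (phi t).
Proof. by rewrite /pull inA_at pullback_actE C0ev_one mulr1. Qed.

Lemma ev_pull_neq e a w (t : T w) : src e != w -> ev (pull e a) t = 0.
Proof. exact: ev_inA_neq. Qed.

Lemma pull_case e w (t : T w) : (exists y : T (rng e), forall a, ev (pull e a) t = ev a y) \/
  (forall a, ev (pull e a) t = 0).
Proof.
case: (eqVneq (src e) w) => [ew|ew].
  by case: _ / ew t => t; left; exists (phi t) => a; rewrite ev_pull.
by right => a; rewrite ev_pull_neq.
Qed.

Lemma pull_star_hom e : star_hom (pull e).
Proof.
split=> [k a b|a b|a]; apply: ev_ext => w t; have [[y H]|H] := pull_case e t.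
- by rewrite evD evZ !H evD evZ.
- by rewrite evD evZ !H mulr0 addr0.
- by rewrite evM !H evM.
- by rewrite evM !H mulr0.
- by rewrite ev_adj !H ev_adj.
- by rewrite ev_adj !H rmorph0.
Qed.

Lemma unit_at_pull e a : unit_at R T_cpt (src e) ** pull e a = pull e a.
Proof.
apply: ev_ext => w t; rewrite evM ev_unit_at; case: eqP => [_|/eqP ew].
  by rewrite mul1r.
by rewrite mul0r ev_pull_neq.
Qed.

End Pull.

Section OscillationInduction.
Variables (R : realType) (E : digraph) (T : vertex E -> topologicalType).
Hypothesis T_cpt : forall v, compact [set: T v].
Variable phi : forall e : edge E, T (src e) -> T (rng e).
Hypothesis cphi : forall e, continuous (@phi e).
Variable Phi : infinite_path E -> {v : vertex E & T v}.
Hypothesis Phi_continuous : continuous Phi.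
Hypothesis Phi_surjective : forall y, exists alpha, Phi alpha = y.
Hypothesis Phi_equivariant : forall (e : edge E) (alpha : infinite_path E)
    (h : path_range alpha = src e),
  exists t : T (src e),
    Phi alpha = existT (fun v => T v : Type) (src e) t /\
    Phi (cons_path h) = existT (fun v => T v : Type) (rng e) (@phi e t).
Local Notation A := (c0_sum (fun v => C0 R (T v))).
Local Notation pull := (pull T_cpt cphi).

Definition evT (a : A) (y : {v : vertex E & T v}) : R[i] := ev a (projT2 y).

Lemma evT_continuous a : continuous (evT a).
Proof.
move=> [v t] U; have [ca _] := @section_funP R _ _ (C0_alg R (T v))
  (@section_fun R _ _ (c0_alg (fun v => C0 R (T v))) a v).
by move=> /(ca t).
Qed.

(** Koenig's lemma for functions on the [T v]: if a property fails for [a] on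
    [T v], it fails for the pullbacks of [a] along the initial segments of some
    infinite path [alpha]. These are the restrictions of [a] to the images of
    the cylinder sets around [alpha], and by continuity they are eventually close
    to the value of [a] at [Phi alpha]. *)
Lemma oscillation_induction (e : R[i]) (P : vertex E -> A -> Prop) : 0 < e ->
  (forall v a (k : R[i]), (forall t : T v, `|ev a t - k| <= e) -> P v a) ->
  (forall v a, (forall f : edge E, rng f = v -> P (src f) (pull f a)) -> P v a) ->
  forall v a, P v a.
Proof.
move=> e0 small step v a; apply: contrapT => nP.
pose Q := {q : vertex E * A | ~ P q.1 q.2}.
have next (q : Q) : exists fq : edge E * Q, [/\ rng fq.1 = (sval q).1,
    (sval fq.2).1 = src fq.1 & (sval fq.2).2 = pull fq.1 (sval q).2].
  case: q => [[w b] /= nb]; apply: contrapT => H; apply: nb; apply: step => f fw.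
  apply: contrapT => nf; apply: H.
  by exists (f, exist _ (src f, pull f b) nf).
have [nx nxP] := choice next.
pose q n := iter n (fun r => (nx r).2) (exist _ (v, a) nP : Q).
pose al n := (nx (q n)).1.
have alP : infinite_path E al.
  move=> n; have [_ <- _] := nxP (q n); have [-> _ _] := nxP (q n.+1).
  by [].
pose alpha : infinite_path E := exist _ al (mem_set alP).
have walk n (g : infinite_path E) : path_range g = (sval (q n)).1 ->
    exists2 b : infinite_path E, (forall i, (i < n)%N -> val b i = al i) &
      evT a (Phi b) = evT (sval (q n)).2 (Phi g).
  suff : path_range g = (sval (q n)).1 -> exists b : infinite_path E,
      [/\ forall i, (i < n)%N -> val b i = al i, forall i, val b (n + i)%N = val g i &
      evT a (Phi b) = evT (sval (q n)).2 (Phi g)].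
    by move=> H /H [b [? _ ?]]; exists b.
  elim: n g => [|n IH] g gq; first by exists g.
  have [nx1 nx2 nx3] := nxP (q n).
  have h : path_range g = src (al n) by rewrite gq -nx2.
  have [b [b1 b2 b3]] := IH (cons_path h) nx1.
  exists b; split=> [i|i|].
  - rewrite ltnS leq_eqVlt => /predU1P[->|]; last exact: b1.
    by have := b2 0; rewrite addn0.
  - by rewrite addSnnS b2.
  have [t [t1 t2]] := Phi_equivariant h.
  by rewrite b3 t1 t2 /evT /= [in RHS]nx3 ev_pull.
have far n : exists b : infinite_path E, (forall i, (i < n)%N -> val b i = al i) /\
    ~ `|evT a (Phi b) - evT a (Phi alpha)| <= e.
  apply: contrapT => H; have := svalP (q n); apply.
  apply: (small _ _ (evT a (Phi alpha))) => t; apply: contrapT => tfar.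
  have [g gq gt] := Phi_onto Phi_surjective Phi_equivariant t.
  have [b b1 b2] := walk n g gq; apply: H; exists b => //.
  by rewrite b2 gt.
have [b bP] := choice far.
have ba : b @ \oo --> alpha.
  apply: path_cvg => n; exists n.+1 => // m /= nm.
  by have [+ _] := bP m; apply.
have : (fun n => evT a (Phi (b n))) @ \oo --> evT a (Phi alpha).
  apply: continuous_cvg; first exact: evT_continuous.
  by apply: continuous_cvg ba; exact: Phi_continuous.
move/cvgrPdist_lt => /(_ _ e0)[N _ HN].
by have [_ []] := bP N; rewrite distrC ltW // HN /=.
Qed.

End OscillationInduction.

(** * Edge units in the correspondence *)

Section EdgeUnits.
Variables (R : realType) (E : digraph) (E_row_finite : row_finite E).
Variable T : vertex E -> topologicalType.
Hypothesis T_cpt : forall v, compact [set: T v].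
Variable phi : forall e : edge E, T (src e) -> T (rng e).
Hypothesis cphi : forall e, continuous (@phi e).
Local Notation A := (c0_sum (fun v => C0 R (T v))).
Local Notation X := (graph_correspondence R cphi).
Local Notation pull := (pull T_cpt cphi).
Local Notation unit_at v := (unit_at R T_cpt v).
Implicit Types (a b : A) (v w : vertex E) (e f : edge E) (x y z : X).

Definition component x e : C0 R (T (src e)) := gm_fun (x : graph_module R T) e.

Lemma component_ext x y : (forall e t, C0ev (component x e) t = C0ev (component y e) t) -> x = y.
Proof. by move=> H; apply: gm_ext => e; apply: C0ev_ext => t; exact: H. Qed.

Lemma component_sum (I : Type) (r : seq I) (F : I -> X) e :
  component (\sum_(i <- r) F i) e = \sum_(i <- r) component (F i) e.
Proof. exact: (big_morph (fun x => component x e)). Qed.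
Lemma component_ract x a e (t : T (src e)) :
  C0ev (component (ract x a) e) t = C0ev (component x e) t * ev a t.
Proof. by []. Qed.
Lemma component_lact a x e (t : T (src e)) :
  C0ev (component (lact a x) e) t = ev a (phi t) * C0ev (component x e) t.
Proof. by []. Qed.

Definition edge_fun e f : C0 R (T (src f)) :=
  @dfwith (edge E) (fun f => C0 R (T (src f))) (fun=> 0) e (C0one R T_cpt (src e)) f.

Lemma edge_fun_neq e f : e != f -> edge_fun e f = 0.
Proof. by move=> ef; rewrite /edge_fun dfwithout. Qed.

Lemma edge_fun_eq e : edge_fun e e = C0one R T_cpt (src e).
Proof. by rewrite /edge_fun dfwithin. Qed.

Lemma inA0 v : inA (0 : C0 R (T v)) = 0 :> A.
Proof. by apply: ev_ext => w t; have [[t' H]|H] := inA_case R v t; rewrite H. Qed.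

Lemma unit_at_inA v (f : C0 R (T v)) : unit_at v ** inA f = inA f.
Proof.
apply: ev_ext => w t; rewrite evM ev_unit_at.
by case: eqVneq => [_|vw]; rewrite ?mul1r // mul0r ev_inA_neq.
Qed.

Fact edge_unit_subproof e : summable_ip (edge_fun e).
Proof.
apply/summable_ipP => d d0; exists [fset e]%fset => G Ge v t.
rewrite big_seq big1 ?(ltW d0) // => f /Ge; rewrite inE => fe.
by rewrite edge_fun_neq 1?eq_sym // inA0 normr0 expr0n.
Qed.

Definition edge_unit e : X := GraphModule (edge_unit_subproof e).

Lemma component_edge_unit e f (t : T (src f)) : C0ev (component (edge_unit e) f) t = (e == f)%:R.
Proof.
rewrite /component /=; case: eqVneq => [ef|ef]; last by rewrite edge_fun_neq.
by case: _ / ef t => t; rewrite edge_fun_eq.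
Qed.

Lemma cvg_totally_cst (I : choiceType) (U : topologicalType) (u : {fset I} -> U) (l : U)
    (F0 : {fset I}) :
  (forall F : {fset I}, (F0 `<=` F)%fset -> u F = l) -> u @ totally --> l.
Proof.
move=> H B lB; exists F0 => // F FF; rewrite /preimage /mkset H //.
exact: nbhs_singleton.
Qed.

Lemma ip_edge_unit e x : ip (edge_unit e) x = inA (component x e).
Proof.
apply: gm_ip_unique; apply: (@cvg_totally_cst _ _ _ _ [fset e]%fset) => F.
rewrite fsub1set => eF; rewrite partial_sumE (big_fsetD1 e) //=.
rewrite big_seq big1 ?addr0 => [|f]; last first.
  rewrite !inE => /andP[fe _]; rewrite edge_fun_neq 1?eq_sym //.
  by rewrite adj0 cmul0r inA0.
congr inA; rewrite edge_fun_eq; apply: C0ev_ext => t.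
by rewrite C0evM C0ev_adj C0ev_one rmorph1 mul1r.
Qed.

Lemma ip_edge_units e f : ip (edge_unit e) (edge_unit f) = if e == f then unit_at (src e) else 0.
Proof.
rewrite ip_edge_unit; case: eqVneq => [<-|ef].
  by congr inA; exact: edge_fun_eq.
by rewrite -(inA0 (src e)); congr inA; rewrite /component /= edge_fun_neq // eq_sym.
Qed.

Lemma ract_edge_unit e : ract (edge_unit e) (unit_at (src e)) = edge_unit e.
Proof.
apply: component_ext => f t; rewrite component_ract component_edge_unit.
case: eqVneq => [ef|]; last by rewrite mul0r.
by case: _ / ef t => t; rewrite ev_unit_at eqxx mul1r.
Qed.

Lemma lact_edge_unit a e : lact a (edge_unit e) = ract (edge_unit e) (pull e a).
Proof.
apply: component_ext => f t; rewrite component_ract component_lact component_edge_unit.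
case: eqVneq => [ef|_]; last by rewrite mul0r mulr0.
by case: _ / ef t => t; rewrite ev_pull mulrC.
Qed.

Lemma inA_lact a x e : inA (component (lact a x) e) = pull e a ** inA (component x e).
Proof.
apply: ev_ext => w t; rewrite evM; case: (eqVneq (src e) w) => [ew|ew].
  by case: _ / ew t => t; rewrite ev_pull !inA_at component_lact.
by rewrite !ev_inA_neq ?mulr0.
Qed.

Lemma hnorm_pointwise x y (M : R[i]) : 0 <= M ->
  (forall e t, `|C0ev (component x e) t| <= M * `|C0ev (component y e) t|) ->
  hnorm x <= M * hnorm y.
Proof.
move=> M0 xy; apply: hnorm_le; first by rewrite mulr_ge0 ?hnorm_ge0.
rewrite exprMn hnorm_sq; apply: (sq_lim_le (@gm_ip_sq_cvg _ _ _ x)).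
  by rewrite mulr_ge0 ?exprn_ge0.
move=> G v t; apply: (@le_trans _ _ (M ^+ 2 *
    \sum_(e <- G) `|ev (inA (component y e)) t| ^+ 2)); last first.
  by rewrite ler_wpM2l ?exprn_ge0 //; exact: gm_le_ip.
rewrite mulr_sumr; apply: ler_sum => e _; rewrite -exprMn.
rewrite lerXn2r ?nnegrE ?mulr_ge0 //.
by have [[t' H]|H] := inA_case R (src e) t; rewrite !H ?normr0 ?mulr0.
Qed.

Lemma hnorm_lact a x : hnorm (lact a x) <= `|a| * hnorm x.
Proof.
apply: hnorm_pointwise => // e t; rewrite component_lact normrM.
by rewrite ler_wpM2r // ev_norm.
Qed.

Definition edges_into v : {fset edge E} := fset_set [set e | rng e = v].

Lemma mem_edges_into v e : (e \in edges_into v) = (rng e == v).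
Proof.
rewrite /edges_into (in_fset_set (E_row_finite v)).
by apply/idP/eqP => [/set_mem|] //; exact: mem_set.
Qed.

(** The projection of [X] onto the summands [X_e] with [rng e = v] is the left
    action of the unit at [v], so the latter acts by a finite-rank operator. *)
Lemma lact_unit_at v a z : lact (unit_at v ** a) z =
  \sum_(e <- edges_into v) theta (lact a (edge_unit e)) (edge_unit e) z.
Proof.
apply: component_ext => f t; rewrite component_lact evM ev_unit_at component_sum.
have -> : C0ev (\sum_(e <- edges_into v) component (theta (lact a (edge_unit e)) (edge_unit e) z) f) t =
    \sum_(e <- edges_into v) C0ev (component (theta (lact a (edge_unit e)) (edge_unit e) z) f) t.
  by apply: (big_morph (fun g => C0ev g t)).
have thE e : C0ev (component (theta (lact a (edge_unit e)) (edge_unit e) z) f) t =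
    (e == f)%:R * (ev a (phi t) * C0ev (component z f) t).
  rewrite /theta component_ract component_lact component_edge_unit ip_edge_unit.
  case: (eqVneq e f) => [ef|_]; last by rewrite mulr0 !mul0r.
  by case: _ / ef t => t; rewrite inA_at mulr1 mul1r.
under eq_bigr do rewrite thE.
have [fv|fv] := eqVneq v (rng f).
  rewrite (big_fsetD1 f) /= ?mem_edges_into ?fv // eqxx !mul1r big_seq big1 ?addr0 //.
  by move=> e; rewrite !inE => /andP[/negPf -> _]; rewrite mul0r.
rewrite !mul0r big_seq big1 // => e; rewrite mem_edges_into => erv.
case: (eqVneq e f) => [ef|_]; last by rewrite mul0r.
by rewrite ef eq_sym (negPf fv) in erv.
Qed.

Lemma lact_unit_at_theta v : lact (unit_at v) =
  theta_sum [seq (edge_unit e, edge_unit e) | e <- edges_into v] :> (X -> X).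
Proof.
apply/funext => z; rewrite -{1}(unit_atM R T_cpt v) lact_unit_at /theta_sum big_map.
apply: eq_big_seq => e; rewrite mem_edges_into => /eqP rv /=; congr (theta _ _ z).
apply: component_ext => f t; rewrite component_lact component_edge_unit ev_unit_at -rv.
by case: (eqVneq e f) => [->|_]; rewrite ?mulr0 // eqxx mulr1.
Qed.

(** Evaluation of [a 1_e = 0] at [t] gives [a (phi e t) = 0], and every point of the
    spaces [T v] is some [phi e t]. *)
Lemma lact_faithful a :
  (forall v (y : T v), exists e (t : T (src e)),
    existT (fun v => T v : Type) v y = existT (fun v => T v : Type) (rng e) (phi t)) ->
  (forall x, lact a x = 0) -> a = 0.
Proof.
move=> cover a0; apply: ev_ext => v y; rewrite ev0.
have [e [t yE]] := cover v y.
have -> : ev a y = evT a (existT (fun v => T v : Type) v y) by [].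
have := congr1 (fun x => C0ev (component x e) t) (a0 (edge_unit e)).
by rewrite yE component_lact component_edge_unit eqxx mulr1.
Qed.

(** The edge units behave like an orthonormal basis: the partial sum [P] of [x]
    satisfies [<P, x> = <P, P>]. *)
Lemma edge_unit_sum_dist x (F : {fset edge E}) :
  let z := x - \sum_(e <- F) ract (edge_unit e) (inA (component x e)) in
  ip z z = ip x x - \sum_(e <- F) inA (adj (component x e) ** component x e).
Proof.
set P := \sum_(e <- F) _ => z.
have xP : ip x P = \sum_(e <- F) inA (adj (component x e) ** component x e).
  rewrite ip_sumr; apply: eq_bigr => e _; rewrite ip_ract -ip_adj ip_edge_unit.
  by rewrite inA_adjM.
have Px : ip P x = ip x P.
  rewrite -ip_adj xP adj_sum; apply: eq_bigr => e _.
  by rewrite inA_adjM adjM adjK.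
have PP : ip P P = ip x P.
  rewrite {1}/P ip_suml xP big_seq [RHS]big_seq; apply: eq_bigr => e eF.
  rewrite ip_ractl /P ip_sumr csumMl (big_fsetD1 e eF) big_seq big1 ?addr0.
    by rewrite [LHS]addr0 ip_ract ip_edge_units eqxx unit_at_inA inA_adjM.
  move=> f; rewrite !inE => /andP[fe _].
  by rewrite ip_ract ip_edge_units eq_sym (negPf fe) cmul0r cmulr0.
by rewrite /z ipDl !ipDr !ipNl !ipNr opprK PP Px xP addNr addr0.
Qed.

Lemma edge_unit_sum_cvg x (d : R[i]) : 0 < d -> exists F0 : {fset edge E},
  forall F : {fset edge E}, (F0 `<=` F)%fset ->
  hnorm (x - \sum_(e <- F) ract (edge_unit e) (inA (component x e))) < d.
Proof.
move=> d0; have d2 : 0 < d ^+ 2 by rewrite exprn_gt0.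
have /cvgrPdist_lt/(_ _ d2)[F0 _ HF] := @gm_ip_cvg R E T x x.
exists F0 => F FF; have := HF F FF; rewrite /= partial_sumE => H.
rewrite /hnorm edge_unit_sum_dist sqrtC_lt_sqr ?normr_ge0 ?(ltW d0) //.
Qed.

End EdgeUnits.

(** * Cuntz-Krieger families *)

Section CuntzKrieger.
Variables (R : realType) (E : digraph) (E_row_finite : row_finite E).
Variables (C : cstarType R) (p : vertex E -> C) (s : edge E -> C).
Hypothesis CK : ck_family p s.
Implicit Types (v w : vertex E) (e f : edge E).

Lemma ck_p v : p v ** p v = p v. Proof. by have [] := ck_proj CK v. Qed.
Lemma ck_padj v : adj (p v) = p v. Proof. by have [] := ck_proj CK v. Qed.

Lemma ck_sum v : p v = \sum_(e <- edges_into v) s e ** adj (s e).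
Proof. by rewrite (ck_rng CK) fsbig_finite //; exact: E_row_finite. Qed.

Lemma ck_s_src e : s e ** p (src e) = s e.
Proof. by rewrite -(ck_src CK) cmulA (ck_pisom CK). Qed.

Lemma ck_norm_s e : `|s e| <= 1.
Proof.
apply: norm_le_of_sq => //; rewrite (ck_src CK) expr1n.
have [->|p0] := eqVneq (p (src e)) 0; first by rewrite normr0.
rewrite -(@ler_pM2r _ `|p (src e)|) ?normr_gt0 // mul1r.
by rewrite -expr2 -cnorm_adj ck_padj ck_p.
Qed.

(** The Cuntz-Krieger relation at [rng e] writes the projection [p (rng e)] as the
    sum of the range projections. *)
Lemma ck_orth_same e f : rng e = rng f -> e != f -> adj (s e) ** s f = 0.
Proof.
move=> ef ne; pose q g := s g ** adj (s g).
have qP g : q g ** q g = q g /\ adj (q g) = q g.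
  by rewrite /q adjM adjK cmulA (ck_pisom CK).
have qef : q e ** q f = 0.
  apply: (@proj_sum_orthogonal _ _ _ (edges_into (rng e))) => //.
  - by rewrite -ck_sum ck_p.
  - by rewrite (mem_edges_into E_row_finite).
  - by rewrite (mem_edges_into E_row_finite) -ef.
have <- : adj (s e) ** (q e ** q f) ** s f = adj (s e) ** s f.
  rewrite /q !cmulA (ck_src CK) -[_ ** s f ** _ ** _]cmulA -cmulA.
  rewrite (ck_src CK) ck_s_src; congr (_ ** _).
  by rewrite -[in LHS](adjK (p (src e))) -adjM ck_padj ck_s_src.
by rewrite qef cmulr0 cmul0r.
Qed.

Lemma ck_p_s e : p (rng e) ** s e = s e.
Proof.
rewrite ck_sum csumMr (big_fsetD1 e) ?(mem_edges_into E_row_finite) //= big_seq big1 ?addr0.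
  exact: (ck_pisom CK).
move=> f; rewrite !inE (mem_edges_into E_row_finite) => /andP[fe /eqP rf].
by rewrite -cmulA ck_orth_same // cmulr0.
Qed.

Lemma ck_p_s_neq v e : rng e != v -> p v ** s e = 0.
Proof.
move=> ev; rewrite -ck_p_s cmulA (ck_orth CK) ?cmul0r //.
by move=> ve; rewrite ve eqxx in ev.
Qed.

Lemma ck_s_orth e f : e != f -> adj (s e) ** s f = 0.
Proof.
move=> ef; have [|rr] := eqVneq (rng e) (rng f); first by move/ck_orth_same; apply.
by rewrite -(ck_p_s f) cmulA -ck_padj -adjM ck_p_s_neq // adj0 cmul0r.
Qed.

Lemma ck_conj_sum_norm (r : seq (edge E)) (x : edge E -> C) (M : R[i]) :
  uniq r -> 0 <= M -> (forall e, e \in r -> `|x e| <= M) ->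
  `|\sum_(e <- r) s e ** x e ** adj (s e)| <= M.
Proof.
move=> ur M0 xM; apply: norm_orth_sum => // [e er|e f _ _ ef].
  rewrite (le_trans (cnormM _ _)) // norm_adj -[leRHS]mulr1 ler_pM ?ck_norm_s //.
  by rewrite (le_trans (cnormM _ _)) // -[leRHS]mul1r ler_pM ?ck_norm_s ?xM.
rewrite !adjM !adjK; split.
  by rewrite -!cmulA (cmulA (adj (s e)) (s f)) ck_s_orth // cmul0r !cmulr0.
by rewrite -!cmulA (cmulA (adj (s e)) (s f)) ck_s_orth // cmul0r !cmulr0.
Qed.

End CuntzKrieger.

Lemma star_hom_limit (R : realType) (A B : cstarType R) (I : Type)
    (F : set_system I) (f : I -> A -> B) (l : A -> B) : ProperFilter F ->
  (forall i, star_hom (f i)) -> (forall a, (fun i => f i a) @ F --> l a) ->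
  star_hom l.
Proof.
move=> FF Hf fl; have hB : hausdorff_space B by exact: norm_hausdorff.
split=> [k a b|a b|a].
- apply: (cvg_unique hB (fl _)).
  rewrite (_ : (fun i => _) = fun i => k *: f i a + f i b).
    by apply: cvgD; [apply: cvgZl_tmp; exact: fl|exact: fl].
  by apply/funext => i; rewrite (star_hom_linear (Hf i)).
- apply: (cvg_unique hB (fl _)).
  rewrite (_ : (fun i => _) = fun i => f i a ** f i b); first exact: cvg_cmul.
  by apply/funext => i; rewrite (star_homM (Hf i)).
- apply: (cvg_unique hB (fl _)).
  rewrite (_ : (fun i => _) = fun i => adj (f i a)); first exact: cvg_adj.
  by apply/funext => i; rewrite (star_hom_adj (Hf i)).
Qed.

(** * The covariant representation defined by a Cuntz-Krieger family *)

Section Representation.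
Variables (R : realType) (E : digraph) (E_row_finite : row_finite E).
Variable T : vertex E -> topologicalType.
Hypothesis T_cpt : forall v, compact [set: T v].
Variable phi : forall e : edge E, T (src e) -> T (rng e).
Hypothesis cphi : forall e, continuous (@phi e).
Local Notation A := (c0_sum (fun v => C0 R (T v))).
Local Notation X := (graph_correspondence R cphi).
Local Notation pull := (@pull R _ _ T_cpt _ cphi).
Local Notation unit_at v := (unit_at R T_cpt v).
Local Notation edge_unit e := (edge_unit R T_cpt cphi e).

(** The conclusion of [oscillation_induction], through which [Phi] enters. *)
Hypothesis osc : forall (d : R[i]) (P : vertex E -> A -> Prop), 0 < d ->
  (forall v a (k : R[i]), (forall t : T v, `|ev a t - k| <= d) -> P v a) ->
  (forall v a, (forall f : edge E, rng f = v -> P (src f) (pull f a)) -> P v a) ->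
  forall v a, P v a.

(** The points at which the Riemann sums below evaluate functions. *)
Variable pt : forall v, T v.

Variables (C : cstarType R) (p : vertex E -> C) (s : edge E -> C).
Hypothesis CK : ck_family p s.
Implicit Types (v w : vertex E) (e f : edge E) (a b : A) (x y z : X).

(** The Riemann sum of [a] over the cylinder sets of level [n] in the paths with
    range [v]: it is the sum of the [a (phi_mu (pt (s mu))) s_mu s_mu^*] over the
    paths [mu] of length [n] with range [v]. *)
Fixpoint cylinder_sum n v a : C :=
  if n is m.+1 then
    \sum_(e <- edges_into v) s e ** cylinder_sum m (src e) (pull e a) ** adj (s e)
  else ev a (pt v) *: p v.

Lemma cylinder_sumS n v a : cylinder_sum n.+1 v a =
  \sum_(e <- edges_into v) s e ** cylinder_sum n (src e) (pull e a) ** adj (s e).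
Proof. by []. Qed.

Lemma p_cylinder_sum n v a : p v ** cylinder_sum n v a = cylinder_sum n v a.
Proof.
case: n => [|n]; first by rewrite /= -cscaleAr (ck_p CK).
rewrite cylinder_sumS csumMl big_seq [RHS]big_seq; apply: eq_bigr => e.
by rewrite (mem_edges_into E_row_finite) !cmulA => /eqP <-; rewrite (ck_p_s E_row_finite CK).
Qed.

Lemma cylinder_sum_star_hom n v : star_hom (cylinder_sum n v).
Proof.
elim: n v => [|n IH] v.
  split=> [k a b|a b|a] /=.
  - by rewrite evD evZ scalerDl scalerA.
  - by rewrite evM -cscaleAl -cscaleAr scalerA (ck_p CK).
  - by rewrite ev_adj Defs.adjZ (ck_padj CK).
have Hpull e : star_hom (pull e) by exact: pull_star_hom.
split=> [k a b|a b|a]; rewrite !cylinder_sumS.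
- rewrite scaler_sumr -big_split; apply: eq_bigr => e _ /=.
  rewrite (star_hom_linear (Hpull e)) (star_hom_linear (IH _)).
  by rewrite cmulDr cmulDl -cscaleAr -cscaleAl.
- rewrite csumMr; apply: eq_big_seq => e ev.
  rewrite csumMl (big_fsetD1 e ev) big_seq big1 ?addr0 => [|f].
    rewrite [RHS]addr0 (star_homM (Hpull e)) (star_homM (IH _)).
    rewrite -!cmulA (cmulA (adj (s e)) (s e)) (ck_src CK).
    by rewrite (cmulA (p _)) p_cylinder_sum.
  rewrite !inE => /andP[fe _]; rewrite -!cmulA (cmulA (adj (s e)) (s f)).
  by rewrite (ck_s_orth E_row_finite CK) 1?eq_sym // cmul0r !cmulr0.
- rewrite adj_sum; apply: eq_bigr => e _; rewrite (star_hom_adj (Hpull e)).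
  by rewrite (star_hom_adj (IH _)) !adjM adjK cmulA.
Qed.

(** The Riemann sums of the constant function [k] are [k p v]. *)
Lemma cylinder_sum_close n v a (k d : R[i]) : 0 <= d ->
  (forall t : T v, `|ev a t - k| <= d) -> `|cylinder_sum n v a - k *: p v| <= d.
Proof.
move=> d0; elim: n v a => [|n IH] v a ak.
  rewrite /= -scalerBl normrZ -[leRHS]mulr1 ler_pM ?ak //.
  apply: norm_le_of_sq => //; rewrite (ck_padj CK) (ck_p CK) expr1n.
  have [->|p0] := eqVneq (p v) 0; first by rewrite normr0.
  rewrite -(@ler_pM2r _ `|p v|) ?normr_gt0 // mul1r.
  by rewrite -expr2 -cnorm_adj (ck_padj CK) (ck_p CK).
rewrite cylinder_sumS (ck_sum E_row_finite CK) scaler_sumr -sumrB.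
rewrite (eq_bigr (fun e => s e ** (cylinder_sum n (src e) (pull e a) -
  k *: p (src e)) ** adj (s e))) => [|e _]; last first.
  rewrite cmulrBr cmulrBl -cscaleAr -cscaleAl; congr (_ - _ *: _).
  by rewrite (ck_s_src CK).
apply: (ck_conj_sum_norm E_row_finite CK) => // e.
rewrite (mem_edges_into E_row_finite) => /eqP ev; apply: IH => t.
by rewrite ev_pull; case: _ / ev ak => ak; exact: ak.
Qed.

(** If [a] is almost constant on [T v], all its Riemann sums are close to one
    multiple of [p v]; from the [pull e a] to [a] the error does not grow, and
    the level increases by one from its maximum over the finitely many edges that end
    at [v]. *)
Lemma cylinder_sum_cauchy v a (d : R[i]) : 0 < d -> exists n, forall m m',
  (n <= m)%N -> (n <= m')%N -> `|cylinder_sum m v a - cylinder_sum m' v a| <= d.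
Proof.
move=> d0; have d20 : 0 < d / 2 by rewrite divr_gt0.
apply: (osc (P := fun v a => exists n, forall m m', (n <= m)%N -> (n <= m')%N ->
  `|cylinder_sum m v a - cylinder_sum m' v a| <= d) d20) => {}v {}a.
  move=> k ak; exists 0%N => m m' _ _.
  rewrite -[cylinder_sum m v a](subrK (k *: p v)) -addrA.
  rewrite (le_trans (ler_normD _ _)) // [d]splitr lerD //.
    by apply: cylinder_sum_close => //; exact: ltW.
  by rewrite distrC; apply: cylinder_sum_close => //; exact: ltW.
move=> H; have [N HN] : exists N : edge E -> nat, forall e, rng e = v ->
    forall m m', (N e <= m)%N -> (N e <= m')%N ->
    `|cylinder_sum m (src e) (pull e a) - cylinder_sum m' (src e) (pull e a)| <= d.
  suff /choice[N HN] : forall e, exists n, rng e = v -> forall m m',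
      (n <= m)%N -> (n <= m')%N ->
      `|cylinder_sum m (src e) (pull e a) - cylinder_sum m' (src e) (pull e a)| <= d.
    by exists N.
  move=> e; have [ev|ev] := eqVneq (rng e) v; last first.
    by exists 0%N => /eqP; rewrite (negPf ev).
  by have [n Hn] := H e ev; exists n.
exists (\max_(e <- edges_into v) N e).+1 => -[|m] [|m'] // Nm Nm'.
rewrite !cylinder_sumS -sumrB.
rewrite (eq_bigr (fun e => s e ** (cylinder_sum m (src e) (pull e a) -
  cylinder_sum m' (src e) (pull e a)) ** adj (s e))) => [|e _]; last first.
  by rewrite cmulrBr cmulrBl.
apply: (ck_conj_sum_norm E_row_finite CK) => //; first exact: ltW.
move=> e ev; have NeN : (N e <= \max_(e <- edges_into v) N e)%N.
  exact: (leq_bigmax_seq _ ev).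
apply: HN; first by move: ev; rewrite (mem_edges_into E_row_finite) => /eqP.
  exact: leq_trans NeN _.
exact: leq_trans NeN _.
Qed.

Definition vertex_rep v a : C := lim (cylinder_sum n v a @[n --> \oo]).

Lemma vertex_rep_cvg v a : cylinder_sum n v a @[n --> \oo] --> vertex_rep v a.
Proof.
suff : cvg (cylinder_sum n v a @[n --> \oo]) by [].
apply: cauchy_cvg; apply: cauchy_exP => d d0.
have d20 : 0 < d / 2 by rewrite divr_gt0.
have [N HN] := cylinder_sum_cauchy v a d20.
exists (cylinder_sum N v a), N => // n /= Nn; rewrite -ball_normE /=.
by apply: le_lt_trans (HN _ _ _ Nn) _ => //; rewrite [ltRHS]splitr ltrDl.
Qed.

Lemma vertex_rep_star_hom v : star_hom (vertex_rep v).
Proof.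
apply: (@star_hom_limit _ _ _ nat \oo (fun n => cylinder_sum n v)) => [n|a].
  exact: cylinder_sum_star_hom.
exact: vertex_rep_cvg.
Qed.


Lemma p_vertex_rep v a : p v ** vertex_rep v a = vertex_rep v a.
Proof.
apply: (cvg_ext_unique _ (cvg_cmul _ (cvg_cst (p v)) (@vertex_rep_cvg v a))
  (@vertex_rep_cvg v a)) => n.
exact: p_cylinder_sum.
Qed.

Lemma vertex_rep_p v a : vertex_rep v a ** p v = vertex_rep v a.
Proof.
rewrite -[vertex_rep v a](@adjK _ C) -(star_hom_adj (vertex_rep_star_hom v)).
by rewrite -{1}(ck_padj CK) -adjM p_vertex_rep.
Qed.

Lemma vertex_rep_norm v a (M : R[i]) : 0 <= M -> (forall t : T v, `|ev a t| <= M) ->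
  `|vertex_rep v a| <= M.
Proof.
move=> M0 aM; apply: (norm_lim_le _ M0 (@vertex_rep_cvg v a)) => n.
rewrite -[cylinder_sum _ _ _]subr0 -(scale0r (p v)).
by apply: cylinder_sum_close => // t; rewrite subr0.
Qed.

Lemma vertex_rep_unit v : vertex_rep v (unit_at v) = p v.
Proof.
apply: (cvg_ext_unique _ (@vertex_rep_cvg v _) (cvg_cst (p v))) => n.
apply/eqP; rewrite -subr_eq0 -normr_le0 -[X in _ - X]scale1r.
by apply: cylinder_sum_close => // t; rewrite ev_unit_at eqxx subrr normr0.
Qed.

Lemma vertex_rep_rec v a : vertex_rep v a =
  \sum_(e <- edges_into v) s e ** vertex_rep (src e) (pull e a) ** adj (s e).
Proof.
have c1 : (fun n => cylinder_sum n.+1 v a) @ \oo --> vertex_rep v a.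
  by rewrite (cvg_shiftS (fun n => cylinder_sum n v a)); exact: vertex_rep_cvg.
apply: (@cvg_ext_unique _ _ _ _ _ (fun n => \sum_(e <- edges_into v)
  s e ** cylinder_sum n (src e) (pull e a) ** adj (s e)) _ _ _ c1) => //.
apply: cvg_sum_seq => e; apply: cvg_cmul; last exact: cvg_cst.
by apply: cvg_cmul; [exact: cvg_cst|exact: vertex_rep_cvg].
Qed.

Lemma vertex_rep_orth v w a b : v != w -> vertex_rep v a ** vertex_rep w b = 0.
Proof.
move=> vw; rewrite -(vertex_rep_p v a) -(p_vertex_rep w b) -cmulA.
rewrite (cmulA (p v)) (ck_orth CK) ?cmul0r ?cmulr0 //.
by move=> vw'; rewrite vw' eqxx in vw.
Qed.

Lemma partial_vertex_rep_star_hom (F : {fset vertex E}) :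
  star_hom (fun a => partial_sum (fun v => vertex_rep v a) F).
Proof.
split=> [k a b|a b|a]; rewrite !partial_sumE.
- rewrite scaler_sumr -big_split; apply: eq_bigr => v _.
  exact: (star_hom_linear (vertex_rep_star_hom v)).
- rewrite csumMr; apply: eq_big_seq => v vF.
  rewrite csumMl (big_fsetD1 v vF) big_seq big1 => [|w].
    by rewrite [RHS]addr0 (star_homM (vertex_rep_star_hom v)).
  by rewrite !inE => /andP[wv _]; rewrite vertex_rep_orth // eq_sym.
- rewrite adj_sum; apply: eq_bigr => v _.
  exact: (star_hom_adj (vertex_rep_star_hom v)).
Qed.

(** The terms are orthogonal, and all but finitely many of them are small since
    [a] vanishes at infinity. *)
Lemma vertex_rep_summable a :
  exists c : C, partial_sum (fun v => vertex_rep v a) @ totally --> c.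
Proof.
apply/cvg_partial_sumP => d d0; have [F FP] := unit_at_approx a d0.
exists F => G GF; apply: norm_orth_sum => [||v vG|v w _ _ vw].
- exact: fset_uniq.
- exact: ltW.
- by apply: vertex_rep_norm => [|t]; [exact: ltW|exact/FP/GF].
by rewrite -!(star_hom_adj (vertex_rep_star_hom _)) !vertex_rep_orth.
Qed.

Definition coef_rep a : C := lim (partial_sum (fun v => vertex_rep v a) @ totally).

Lemma coef_rep_cvg a : partial_sum (fun v => vertex_rep v a) @ totally --> coef_rep a.
Proof. by apply/cvg_ex; exact: vertex_rep_summable. Qed.

Lemma coef_rep_star_hom : star_hom coef_rep.
Proof.
exact: (star_hom_limit _ partial_vertex_rep_star_hom (fun a => @coef_rep_cvg a)).
Qed.

Lemma p_coef_rep v a : p v ** coef_rep a = vertex_rep v a.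
Proof.
have c1 : (fun F => p v ** partial_sum (fun v => vertex_rep v a) F) @ totally -->
    p v ** coef_rep a.
  by apply: cvg_cmul; [exact: cvg_cst|exact: coef_rep_cvg].
apply: (cvg_unique (@norm_hausdorff _ C) c1).
apply: (@cvg_totally_cst _ _ _ _ [fset v]%fset) => F; rewrite fsub1set => vF.
rewrite partial_sumE csumMl (big_fsetD1 v vF) big_seq big1 => [|w].
  by rewrite [LHS]addr0 p_vertex_rep.
rewrite !inE => /andP[wv _]; rewrite -p_vertex_rep cmulA (ck_orth CK) ?cmul0r //.
by move=> vw; rewrite vw eqxx in wv.
Qed.

Lemma coef_rep_p v a : coef_rep a ** p v = vertex_rep v a.
Proof.
rewrite -[a](@adjK _ A) (star_hom_adj coef_rep_star_hom).
rewrite (star_hom_adj (vertex_rep_star_hom v)) -p_coef_rep adjM.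
by rewrite (ck_padj CK).
Qed.

Lemma coef_rep_unit v : coef_rep (unit_at v) = p v.
Proof.
apply: (cvg_unique (@norm_hausdorff _ C) (@coef_rep_cvg _)).
apply: (@cvg_totally_cst _ _ _ _ [fset v]%fset) => F; rewrite fsub1set => vF.
rewrite partial_sumE (big_fsetD1 v vF) big_seq big1 => [|w].
  by rewrite [LHS]addr0 vertex_rep_unit.
rewrite !inE => /andP[wv _]; apply/eqP; rewrite -normr_le0.
by apply: vertex_rep_norm => // t; rewrite ev_unit_at eq_sym (negPf wv) normr0.
Qed.

Lemma coef_rep_s a e : coef_rep a ** s e = s e ** coef_rep (pull e a).
Proof.
have ee : e \in edges_into (rng e) by rewrite (mem_edges_into E_row_finite).
rewrite -{1}(ck_p_s E_row_finite CK e) cmulA coef_rep_p vertex_rep_rec csumMr.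
rewrite (big_fsetD1 e ee) big_seq big1 => [|f].
  rewrite [LHS]addr0 -!cmulA (ck_src CK) vertex_rep_p -p_coef_rep cmulA.
  by rewrite (ck_s_src CK).
rewrite !inE => /andP[fe _].
by rewrite -cmulA (ck_s_orth E_row_finite CK) // cmulr0.
Qed.

Definition edge_term x e : C := s e ** coef_rep (inA (component x e)).

(** Orthogonality of the ranges of the [s e] removes the mixed terms. *)
Lemma partial_edge_term_ip x y (F : {fset edge E}) :
  adj (partial_sum (edge_term x) F) ** partial_sum (edge_term y) F =
  coef_rep (partial_sum (fun e => inA (adj (component x e) ** component y e)) F).
Proof.
rewrite !partial_sumE adj_sum csumMr (star_hom_sum coef_rep_star_hom).
apply: eq_big_seq => e eF.
rewrite csumMl (big_fsetD1 e eF) big_seq big1 => [|f].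
  rewrite [LHS]addr0 /edge_term adjM -cmulA (cmulA (adj (s e))) (ck_src CK).
  rewrite -coef_rep_unit -(star_hom_adj coef_rep_star_hom).
  by rewrite -!(star_homM coef_rep_star_hom) unit_at_inA inA_adjM.
rewrite !inE => /andP[fe _]; rewrite /edge_term adjM -cmulA (cmulA (adj (s e))).
by rewrite (ck_s_orth E_row_finite CK) 1?eq_sym // cmul0r cmulr0.
Qed.

Lemma edge_term_summable x :
  exists c : C, partial_sum (edge_term x) @ totally --> c.
Proof.
apply/cvg_partial_sumP => d d0; have d20 : 0 < d ^+ 2 by rewrite exprn_gt0.
have [/(_ (gm_funP x)) H _] := cvg_partial_sumP
  (fun e => inA (adj (component x e) ** component x e) : A).
have [F FP] := H _ d20; exists F => G GF; rewrite -partial_sumE.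
apply: norm_le_of_sq; first exact: ltW.
rewrite partial_edge_term_ip (le_trans (star_hom_norm coef_rep_star_hom _)) //.
by rewrite partial_sumE FP.
Qed.

Definition module_rep x : C := lim (partial_sum (edge_term x) @ totally).

Lemma module_rep_cvg x : partial_sum (edge_term x) @ totally --> module_rep x.
Proof. by apply/cvg_ex; exact: edge_term_summable. Qed.

Lemma module_rep_linear : linear module_rep.
Proof.
move=> k x y.
have c : (fun F => k *: partial_sum (edge_term x) F + partial_sum (edge_term y) F)
    @ totally --> k *: module_rep x + module_rep y.
  by apply: cvgD; [apply: cvgZl_tmp; exact: module_rep_cvg|exact: module_rep_cvg].
apply: (cvg_ext_unique _ (@module_rep_cvg _) c) => F.
rewrite !partial_sumE scaler_sumr -big_split; apply: eq_bigr => e _ /=.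
by rewrite /edge_term inAD inAZ (star_hom_linear coef_rep_star_hom) cmulDr cscaleAr.
Qed.

Lemma module_rep_ip x y : adj (module_rep x) ** module_rep y = coef_rep (ip x y).
Proof.
apply: (cvg_ext_unique _ (cvg_cmul _ (cvg_adj _ (@module_rep_cvg x)) (@module_rep_cvg y))
  (star_hom_cvg coef_rep_star_hom _ (@gm_ip_cvg R E T x y))) => F.
exact: partial_edge_term_ip.
Qed.

Lemma module_rep_lact a x : module_rep (lact a x) = coef_rep a ** module_rep x.
Proof.
apply: (cvg_ext_unique _ (@module_rep_cvg _)
  (cvg_cmul _ (cvg_cst (coef_rep a)) (@module_rep_cvg x))) => F.
rewrite !partial_sumE csumMl; apply: eq_bigr => e _.
rewrite /edge_term inA_lact (star_homM coef_rep_star_hom) !cmulA.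
by rewrite coef_rep_s.
Qed.

Lemma module_rep_edge_unit e : module_rep (edge_unit e) = s e.
Proof.
apply: (cvg_unique (@norm_hausdorff _ C) (@module_rep_cvg _)).
apply: (@cvg_totally_cst _ _ _ _ [fset e]%fset) => F; rewrite fsub1set => eF.
rewrite partial_sumE (big_fsetD1 e eF) big_seq big1 => [|f].
  rewrite [LHS]addr0 /edge_term -ip_edge_unit ip_edge_units eqxx coef_rep_unit.
  exact: (ck_s_src CK).
rewrite !inE => /andP[fe _]; rewrite /edge_term -ip_edge_unit ip_edge_units (negPf fe).
by rewrite (star_hom0 coef_rep_star_hom) cmulr0.
Qed.

Lemma module_toeplitz : toeplitz_rep (module_rep : X -> C) coef_rep.
Proof.
split; [exact: module_rep_linear|exact: coef_rep_star_hom|exact: module_rep_ip|].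
exact: module_rep_lact.
Qed.

(** The elements of [A] supported on finitely many of the [T v] act by sums of
    rank-one operators, on which covariance is the Cuntz-Krieger relation; the
    general case follows by approximation. *)
Lemma induces_coef_rep a : induces module_rep (lact a : X -> X) (coef_rep a).
Proof.
move=> d d0; have [F FP] := unit_at_approx a d0.
have aF : `|a - \sum_(v <- F) unit_at v ** a| <= d.
  by apply: norm_sub_sum_unit_at => //; exact: ltW.
exists [seq (lact a (edge_unit e), edge_unit e) | v <- F, e <- edges_into v].
split=> [z|].
  have -> : theta_sum [seq (lact a (edge_unit e), edge_unit e) | v <- F,
      e <- edges_into v] z = lact (\sum_(v <- F) unit_at v ** a) z.
    rewrite /theta_sum big_allpairs_dep.
    rewrite (big_morph (fun b : A => lact b z) (fun b c => lactD b c z) (_ : lact 0 z = 0)).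
      by apply: eq_bigr => v _; rewrite (lact_unit_at E_row_finite).
    by rewrite -(scale0r 0) lactZ !scale0r.
  rewrite -[- lact _ z]scaleN1r -lactZ -lactD scaleN1r.
  by rewrite (le_trans (hnorm_lact _ _)) // ler_wpM2r ?hnorm_ge0.
rewrite /rank_sum big_allpairs_dep /=.
have -> : \sum_(v <- F) \sum_(e <- edges_into v)
    module_rep (lact a (edge_unit e)) ** adj (module_rep (edge_unit e)) =
    coef_rep (\sum_(v <- F) unit_at v ** a).
  rewrite (star_hom_sum coef_rep_star_hom); apply: eq_bigr => v _.
  rewrite (@cmul_comm R _ T) (star_homM coef_rep_star_hom) coef_rep_unit.
  rewrite (ck_sum E_row_finite CK) csumMl; apply: eq_bigr => e _.
  by rewrite module_rep_lact module_rep_edge_unit cmulA.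
rewrite -(star_homB coef_rep_star_hom).
exact: le_trans (star_hom_norm coef_rep_star_hom _) aF.
Qed.

Lemma module_covariant : covariant_rep (module_rep : X -> C) coef_rep.
Proof.
split; first exact: module_toeplitz.
have [h hI hE] := induced_hom_exists (@correspondence_cauchy_schwarz R E T X)
  module_toeplitz.
by exists h => // a _; apply/hE/induces_coef_rep.
Qed.

End Representation.

(** * The Cuntz-Krieger family in a covariant representation *)

Section FamilyOfRepresentation.
Variables (R : realType) (E : digraph) (E_row_finite : row_finite E).
Variable T : vertex E -> topologicalType.
Hypothesis T_cpt : forall v, compact [set: T v].
Variable phi : forall e : edge E, T (src e) -> T (rng e).
Hypothesis cphi : forall e, continuous (@phi e).
Local Notation A := (c0_sum (fun v => C0 R (T v))).
Local Notation X := (graph_correspondence R cphi).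
Local Notation pull := (@pull R _ _ T_cpt _ cphi).
Local Notation unit_at v := (unit_at R T_cpt v).
Local Notation edge_unit e := (edge_unit R T_cpt cphi e).
Hypothesis cover : forall v (y : T v), exists e (t : T (src e)),
  existT (fun v => T v : Type) v y = existT (fun v => T v : Type) (rng e) (phi t).

Lemma unit_at_katsura v : katsura_ideal X (unit_at v).
Proof.
split=> [|b b0]; last by rewrite (lact_faithful T_cpt cover b0) cmulr0.
rewrite (lact_unit_at_theta R E_row_finite T_cpt).
exact: theta_sum_compact.
Qed.

Variables (B : cstarType R) (psi : X -> B) (pi : A -> B).
Hypothesis Cov : covariant_rep psi pi.
Let Tr := covariant_toeplitz Cov.
Let piH := toeplitz_star_hom Tr.

(** The relation at [v] is covariance for [1_v], which belongs to Katsura's ideal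
    because it acts by a finite-rank operator and the left action is faithful. *)
Lemma rep_ck_family :
  ck_family (fun v => pi (unit_at v)) (fun e => psi (edge_unit e)).
Proof.
have srcE e : adj (psi (edge_unit e)) ** psi (edge_unit e) = pi (unit_at (src e)).
  by rewrite (toeplitz_ip Tr) ip_edge_units eqxx.
split=> [v|v w vw|e|//|v].
- by rewrite -(star_homM piH) -(star_hom_adj piH) unit_atM adj_unit_at.
- rewrite -(star_homM piH) unit_at_orth ?(star_hom0 piH) //.
  exact/eqP.
- by rewrite -cmulA srcE -(psi_ract Tr) ract_edge_unit.
have [h hI hE] := covariant_ideal Cov.
rewrite fsbig_finite; last exact: E_row_finite.
rewrite -(hE _ (unit_at_katsura v)) (lact_unit_at_theta R E_row_finite T_cpt).
by rewrite (induced_theta_sum _ hI) /rank_sum big_map.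
Qed.

Lemma rep_edge_unit a e :
  pi a ** psi (edge_unit e) = psi (edge_unit e) ** pi (pull e a).
Proof. by rewrite -(toeplitz_lact Tr) (lact_edge_unit T_cpt) (psi_ract Tr). Qed.

(** A Toeplitz representation is determined on [X] by its values on [A] and on
    the edge units. *)
Lemma rep_module_cvg x :
  partial_sum (fun e => psi (edge_unit e) ** pi (inA (component x e))) @ totally --> psi x.
Proof.
apply/cvgrPdist_lt => d d0.
have [F0 HF] := edge_unit_sum_cvg T_cpt x d0; exists F0 => // F FF /=.
apply: le_lt_trans (HF F FF).
rewrite partial_sumE (eq_bigr (fun e => psi (ract (edge_unit e) (inA (component x e))))).
  by rewrite -(psi_sum Tr) -(psiB Tr); exact: (psi_norm Tr).
by move=> e _; rewrite (psi_ract Tr).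
Qed.

End FamilyOfRepresentation.

Section CoefficientUnique.
Variables (R : realType) (E : digraph) (E_row_finite : row_finite E).
Variable T : vertex E -> topologicalType.
Hypothesis T_cpt : forall v, compact [set: T v].
Variable phi : forall e : edge E, T (src e) -> T (rng e).
Hypothesis cphi : forall e, continuous (@phi e).
Local Notation A := (c0_sum (fun v => C0 R (T v))).
Local Notation pull := (@pull R _ _ T_cpt _ cphi).
Local Notation unit_at v := (unit_at R T_cpt v).
Hypothesis osc : forall (d : R[i]) (P : vertex E -> A -> Prop), 0 < d ->
  (forall v a (k : R[i]), (forall t : T v, `|ev a t - k| <= d) -> P v a) ->
  (forall v a, (forall f : edge E, rng f = v -> P (src f) (pull f a)) -> P v a) ->
  forall v a, P v a.

(** On functions that are almost constant on [T v] both homomorphisms are close to a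
    multiple of [p v]. The commutation relations express the values on [a] by those
    on the [pull e a] without loss in the error, since the [s e] have orthogonal
    ranges, so [oscillation_induction] applies. *)
Lemma coef_unique (B : cstarType R) (p : vertex E -> B) (s : edge E -> B)
    (f g : A -> B) : ck_family p s -> star_hom f -> star_hom g ->
  (forall v, f (unit_at v) = p v) -> (forall v, g (unit_at v) = p v) ->
  (forall a e, f a ** s e = s e ** f (pull e a)) ->
  (forall a e, g a ** s e = s e ** g (pull e a)) -> f =1 g.
Proof.
move=> CK Hf Hg fp gp fs gs.
have locE (h : A -> B) : star_hom h -> (forall v, h (unit_at v) = p v) ->
    (forall a e, h a ** s e = s e ** h (pull e a)) -> forall v a,
    h (unit_at v ** a) = \sum_(e <- edges_into v)
      s e ** h (unit_at (src e) ** pull e a) ** adj (s e).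
  move=> Hh hp hs v a; rewrite (@cmul_comm R _ T) (star_homM Hh) hp.
  rewrite (ck_sum E_row_finite CK) csumMl; apply: eq_bigr => e _.
  by rewrite unit_at_pull cmulA hs.
have loc v a : f (unit_at v ** a) = g (unit_at v ** a).
  apply/eqP; rewrite -subr_eq0; apply/eqP/norm_lim0 => d d0.
  have d20 : 0 < d / 2 by rewrite divr_gt0.
  apply: (osc (P := fun v a => `|f (unit_at v ** a) - g (unit_at v ** a)| <= d) d20)
    => {}v {}a.
    move=> k ak.
    have close (h : A -> B) : star_hom h -> (forall v, h (unit_at v) = p v) ->
        `|h (unit_at v ** a) - k *: p v| <= d / 2.
      move=> Hh hp; rewrite -hp -(star_homZ Hh) -(star_homB Hh).
      rewrite (le_trans (star_hom_norm Hh _)) //.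
      apply: ev_norm_le => [|w t]; first exact: ltW.
      rewrite evB evM evZ ev_unit_at; case: (eqVneq v w) => [vw|_].
        by case: _ / vw t => t; rewrite mul1r mulr1.
      by rewrite mul0r mulr0 subrr normr0 ltW.
    rewrite -[f _](subrK (k *: p v)) -addrA (le_trans (ler_normD _ _)) //.
    by rewrite [d]splitr lerD ?close // distrC close.
  move=> H; rewrite (locE f) // (locE g) // -sumrB.
  rewrite (eq_bigr (fun e => s e ** (f (unit_at (src e) ** pull e a) -
    g (unit_at (src e) ** pull e a)) ** adj (s e))) => [|e _]; last first.
    by rewrite cmulrBr cmulrBl.
  apply: (ck_conj_sum_norm E_row_finite CK) => //; first exact: ltW.
  by move=> e; rewrite (mem_edges_into E_row_finite) => /eqP; exact: H.
move=> a; apply/eqP; rewrite -subr_eq0; apply/eqP/norm_lim0 => d d0.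
have d20 : 0 < d / 2 by rewrite divr_gt0.
have [F FP] := unit_at_approx a d20.
have aF := norm_sub_sum_unit_at T_cpt (ltW d20) FP.
set b := \sum_(v <- F) unit_at v ** a in aF.
have fgb : f b = g b.
  by rewrite (star_hom_sum Hf) (star_hom_sum Hg); apply: eq_bigr.
have -> : f a - g a = f (a - b) - g (a - b).
  by rewrite (star_homB Hf) (star_homB Hg) fgb opprB addrA subrK.
rewrite (le_trans (ler_normB _ _)) // [leRHS]splitr.
by rewrite lerD // (le_trans _ aF) // star_hom_norm.
Qed.

End CoefficientUnique.

Lemma path_from (E : digraph) : no_sources E ->
  forall v : vertex E, exists alpha : infinite_path E, path_range alpha = v.
Proof.
move=> ns v; have [f fP] := choice ns.
pose al n := f (iter n (fun w => src (f w)) v).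
have alP : infinite_path E al by move=> n; rewrite /al /= fP.
by exists (exist _ al (mem_set alP)); rewrite /path_range /= /al /= fP.
Qed.

Theorem theorem3p1 (R : realType) (E : digraph)
    (E_row_finite : row_finite E) (E_no_sources : no_sources E)
    (T : vertex E -> topologicalType)
    (T_hausdorff : forall v, hausdorff_space (T v))
    (T_locally_compact : forall v, locally_compact [set: T v])
    (phi : forall e : edge E, T (src e) -> T (rng e))
    (phi_continuous : forall e, continuous (@phi e))
    (Phi : infinite_path E -> {v : vertex E & T v})
    (Phi_continuous : continuous Phi)
    (Phi_surjective : forall y, exists alpha, Phi alpha = y)
    (Phi_equivariant : forall (e : edge E) (alpha : infinite_path E)
        (h : path_range alpha = src e),
      exists t : T (src e),
        Phi alpha = existT (fun v => T v : Type) (src e) t /\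
        Phi (cons_path h) = existT (fun v => T v : Type) (rng e) (@phi e t))
    (O : cstarType R)
    (psi : graph_correspondence R phi_continuous -> O)
    (pi : c0_sum (fun v => C0 R (T v)) -> O)
    (O_universal : is_cuntz_pimsner psi pi)
    (C : cstarType R) (p : vertex E -> C) (s : edge E -> C)
    (C_universal : is_graph_algebra p s) :
  star_isomorphic O C.
Proof.
have T_cpt := T_compact E_row_finite Phi_continuous Phi_surjective Phi_equivariant.
have osc := @oscillation_induction R E T T_cpt phi phi_continuous Phi
  Phi_continuous Phi_surjective Phi_equivariant.
have cover := phi_cover Phi_surjective Phi_equivariant.
(* Every vertex is the range of a path, so no [T v] is empty. *)
have pt_ex v : exists t : T v, True.
  have [alpha av] := path_from E_no_sources v.
  have [|t _] := @sigT_fiber _ _ (Phi alpha) v; last by exists t.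
  by rewrite (Phi_vertex Phi_equivariant).
pose pt v : T v := projT1 (cid (pt_ex v)).
have Cov := cuntz_pimsner_covariant O_universal.
have Tr := covariant_toeplitz Cov; have piH := toeplitz_star_hom Tr.
have CK := graph_algebra_ck C_universal.
have CKO := rep_ck_family E_row_finite T_cpt cover Cov.
have [rho Hrho [rhop rhos]] := graph_algebra_universal C_universal CKO.
have CovC := module_covariant E_row_finite osc pt CK.
have [sigma Hsigma [sigpsi sigpi]] := cuntz_pimsner_universal O_universal CovC.
have coefH := coef_rep_star_hom E_row_finite osc pt CK.
have coefE := coef_unique E_row_finite osc CKO (star_hom_comp coefH Hrho) piH.
have rho_coef a : rho (coef_rep T_cpt phi_continuous pt p s a) = pi a.
  apply: coefE => // [v|b e|b e] /=.
  - by rewrite (coef_rep_unit E_row_finite osc pt CK) rhop.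
  - rewrite -rhos -!(star_homM Hrho).
    by rewrite (coef_rep_s E_row_finite osc pt CK).
  - exact: rep_edge_unit Cov _ _.
have rho_module x : rho (module_rep T_cpt pt p s x) = psi x.
  have c1 : (fun F => rho (partial_sum (edge_term T_cpt pt p s x) F)) @ totally -->
      rho (module_rep T_cpt pt p s x).
    by apply: star_hom_cvg => //; exact: module_rep_cvg.
  apply: (cvg_ext_unique _ c1 (@rep_module_cvg _ _ _ T_cpt _ phi_continuous _ _ _ Cov x)) => F.
  rewrite !partial_sumE (star_hom_sum Hrho); apply: eq_bigr => e _.
  by rewrite (star_homM Hrho) rhos rho_coef.
exists sigma => //; exists rho => [y|c].
  apply: (star_hom_eq_generated (cuntz_pimsner_generates O_universal)
    (star_hom_comp Hsigma Hrho) (star_hom_id O) _ y) => _ [[x _ <-]|[a _ <-]] /=.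
    by rewrite sigpsi rho_module.
  by rewrite sigpi rho_coef.
apply: (star_hom_eq_generated (graph_algebra_generates C_universal)
  (star_hom_comp Hrho Hsigma) (star_hom_id C) _ c) => _ [[v _ <-]|[e _ <-]] /=.
  by rewrite rhop sigpi (coef_rep_unit E_row_finite osc pt CK).
rewrite rhos sigpsi.
exact: (module_rep_edge_unit E_row_finite osc pt CK).
Qed.
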